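(* Let $p$ be a prime, and let $c_p$ and $C_p=1+1/c_p$ be the constants defined in the context. (1) Let $0<\epsilon<1$ and $\delta=(\epsilon/3)^{C_p}$. For every positive integer $n$, writing $N=p^n$, if $X,Y,Z\subset\mathbb{F}_p^n$ are such that there are fewer than $\delta N^2$ triangles in $X\times Y\times Z$, then one can remove at most $\epsilon N$ elements in total from the sets $X$, $Y$, $Z$ so that no triangle remains; that is, there are $X_0\subset X$, $Y_0\subset Y$, $Z_0\subset Z$ with $|X_0|+|Y_0|+|Z_0|\le \epsilon N$ such that $(X\setminus X_0)\times(Y\setminus Y_0)\times(Z\setminus Z_0)$ contains no triangle. (2) This bound is essentially tight. Call a pair $(\epsilon,\delta)$ of positive reals admissible for $p$ if for every positive integer $n$ and all $X,Y,Z\subset\mathbb{F}_p^n$ with at most $\delta p^{2n}$ triangles in $X\times Y\times Z$, one can remove at most $\epsilon p^n$ elements in total from $X$, $Y$, $Z$ (in the sense of (1)) so that no triangle remains. Then every admissible pair satisfies $\delta\le \epsilon^{C_p-o(1)}$, where the $o(1)$ term tends to $0$ for $p$ fixed and $\epsilon\to 0$. That is, for every $\eta>0$ there is $\epsilon_0=\epsilon_0(p,\eta)>0$ such that every admissible pair $(\epsilon,\delta)$ with $0<\epsilon<\epsilon_0$ satisfies $\delta\le\epsilon^{C_p-\eta}$.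
   Context: A triangle in $\mathbb{F}_p^n$ is an ordered triple $(x,y,z)$ of points of $\mathbb{F}_p^n$ with $x+y+z=0$; a triangle in $X\times Y\times Z$ is a triangle $(x,y,z)$ with $x\in X$, $y\in Y$, $z\in Z$. The constant $c_p\in(0,1)$ is defined by $$p^{1-c_p}=\inf_{0<x<1} x^{-(p-1)/3}\left(1+x+x^2+\cdots+x^{p-1}\right),$$ and $C_p=1+1/c_p$. *)

(* Defs.v *)
From HB Require Import structures.
From mathcomp Require Import all_boot all_order all_algebra.
From mathcomp Require Import classical_sets reals exp.
From mathcomp Require Import ring lra.

Set Implicit Arguments.
Unset Strict Implicit.
Unset Printing Implicit Defensive.

Import Order.TTheory GRing.Theory Num.Theory.

Local Open Scope ring_scope.

Section Triangles.
Variables p n : nat.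
Implicit Types X Y Z : {set 'rV['F_p]_n}.

Definition triangles X Y Z : {set 'rV['F_p]_n * 'rV['F_p]_n * 'rV['F_p]_n} :=
  [set t | [&& t.1.1 \in X, t.1.2 \in Y, t.2 \in Z
            & t.1.1 + t.1.2 + t.2 == 0]]%SET.

Definition removable (R : realType) (epsilon : R) X Y Z : Prop :=
  exists X0 Y0 Z0 : {set 'rV['F_p]_n},
    [/\ X0 \subset X, Y0 \subset Y & Z0 \subset Z] /\
    [/\ (#|X0| + #|Y0| + #|Z0|)%:R <= epsilon * (p ^ n)%:R
      & triangles (X :\: X0) (Y :\: Y0) (Z :\: Z0) = finset.set0].

End Triangles.

Definition admissible (R : realType) (p : nat) (epsilon delta : R) : Prop :=
  [/\ 0 < epsilon, 0 < delta &
   forall n : nat, (0 < n)%N -> forall X Y Z : {set 'rV['F_p]_n},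
     #|triangles X Y Z|%:R <= delta * (p ^ (2 * n))%:R ->
     removable epsilon X Y Z].

Section Constants.
Variables (R : realType) (p : nat).

Definition growth_fun (x : R) : R :=
  x `^ (- (p.-1%:R / 3)) * \sum_(i < p) x ^+ i.

Definition growth_rate : R :=
  inf [set growth_fun x | x in [set x : R | 0 < x < 1]]%classic.

(* For prime p, the unique c with p `^ (1 - c) = growth_rate (powR_cexp below);
   it lies in ]0, 1[ (cexp_in01), so the division in Cexp is genuine. *)
Definition cexp : R := 1 - ln growth_rate / ln p%:R.

Definition Cexp : R := 1 + 1 / cexp.

End Constants.

Section ConstantsTheory.
Variables (R : realType) (p : nat).
Hypothesis p_prime : prime p.

Let p_ge2 : 2 <= p%:R :> R.
Proof. by rewrite (ler_nat R 2 p) prime_gt1. Qed.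

Let pS : p = p.-2.+2.
Proof. by case: p p_prime => [|[|]]. Qed.

Let predE : p.-1%:R = p%:R - 1 :> R.
Proof. by rewrite {2}pS -(natr1 p.-2.+1) addrK pS. Qed.

Lemma growth_fun_ge (x : R) : 0 < x < 1 -> 9 / 8 <= growth_fun p x.
Proof.
move=> /andP[x0 x1].
have S1 : 1 + x <= \sum_(i < p) x ^+ i.
  rewrite pS !big_ord_recl expr0 expr1 addrA lerDl.
  by apply: sumr_ge0 => i _; rewrite exprn_ge0 // ltW.
have a0 : 3^-1 <= p.-1%:R / 3 :> R.
  by rewrite predE; have := p_ge2; lra.
have [xs|xl] := leP x 8^-1.
- have P2 : 2 <= x `^ (- (p.-1%:R / 3)).
    rewrite powRN.
    rewrite -[leLHS]invrK lef_pV2 ?posrE ?powR_gt0 ?invr_gt0 //.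
    apply: (@le_trans _ _ (x `^ 3^-1)).
      by apply: ger_powR => //; rewrite x0 ltW.
    have -> : 2^-1 = (8^-1 : R) `^ 3^-1.
      have -> : 8^-1 = (2^-1 : R) `^ 3%:R.
        by rewrite powR_mulrn ?invr_ge0 // exprVn; congr (_^-1); ring.
      by rewrite -powRrM divff ?pnatr_eq0 // powRr1 // invr_ge0.
    by apply: ge0_ler_powR; rewrite ?nnegrE ?invr_ge0 ?(ltW x0).
  by apply: (@le_trans _ _ (2 * (1 + x))); [lra | apply: ler_pM => //; lra].
- have P1 : 1 <= x `^ (- (p.-1%:R / 3)).
    rewrite -[leLHS](powRr0 x); apply: ger_powR; first by rewrite x0 ltW.
    lra.
  by apply: (@le_trans _ _ (1 * (1 + x))); [lra | apply: ler_pM => //; lra].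
Qed.

Lemma growth_rate_ge : 9 / 8 <= growth_rate R p.
Proof.
apply: lb_le_inf.
  by exists (growth_fun p 2^-1), 2^-1 => //=; lra.
by move=> _ [x /= x01 <-]; exact: growth_fun_ge.
Qed.

Let expr_le (t : R) k : 0 <= t <= 1 ->
  (1 - t) ^+ k <= 1 - k%:R * t + k%:R ^+ 2 * t ^+ 2.
Proof.
move=> t01; elim: k => [|k IH]; first by rewrite expr0; nra.
rewrite exprSr -natr1.
have k0 : 0 <= k%:R :> R by [].
apply: (@le_trans _ _ ((1 - k%:R * t + k%:R ^+ 2 * t ^+ 2) * (1 - t))).
  by apply: ler_wpM2r => //; lra.
rewrite -subr_ge0 (_ : _ - _ = (k%:R + 1) * t ^+ 2 + k%:R ^+ 2 * t ^+ 3);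
  last by ring.
by rewrite addr_ge0 // mulr_ge0 ?exprn_ge0 //; lra.
Qed.

Let expr_ge (t : R) k : 0 <= t <= 1 -> 1 - k%:R * t <= (1 - t) ^+ k.
Proof.
move=> t01; elim: k => [|k IH]; first by rewrite expr0; lra.
rewrite exprSr -natr1.
apply: (@le_trans _ _ ((1 - k%:R * t) * (1 - t))); last first.
  by apply: ler_wpM2r => //; lra.
rewrite -subr_ge0 (_ : _ - _ = k%:R * t ^+ 2); last by ring.
by rewrite mulr_ge0 ?exprn_ge0 //; lra.
Qed.

Let sum_idE k : \sum_(i < k) i%:R = k%:R * (k%:R - 1) / 2 :> R.
Proof.
elim: k => [|k IH]; first by rewrite big_ord0 !mul0r.
by rewrite big_ord_recr /= IH -natr1; field.
Qed.

Lemma growth_rate_lt : growth_rate R p < p%:R.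
Proof.
set P : R := p%:R; have P2 : 2 <= P by [].
pose t : R := (36 * P ^+ 2)^-1.
have tP : t * P ^+ 2 = 36^-1.
  by rewrite /t; field; apply/lt0r_neq0; lra.
have t0 : 0 < t by rewrite invr_gt0; nra.
have t1 : t < 1 by nra.
pose y : R := 1 - t.
have y01 : 0 < y < 1 by rewrite /y; lra.
have [y0 y1] := andP y01.
have x01 : 0 < y ^+ 3 < 1.
  by rewrite exprn_gt0 //= exprn_ilt1 // ltW.
suff : growth_fun p (y ^+ 3) < P.
  apply: le_lt_trans; apply: ge_inf; last by exists (y ^+ 3).
  by exists (9 / 8) => _ [x /= ? <-]; exact: growth_fun_ge.
rewrite /growth_fun -powR_mulrn ?(ltW y0) // -powRrM.
rewrite (_ : 3%:R * _ = - p.-1%:R); last by field.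
rewrite powR_mulrn ?(ltW y0) // powRN powR_mulrn ?(ltW y0) //.
rewrite mulrC ltr_pdivrMr ?exprn_gt0 //.
have t01 : 0 <= t <= 1 by lra.
apply: (@lt_le_trans _ _ (P * (1 - p.-1%:R * t))); last first.
  by apply: ler_wpM2l; [lra | exact: expr_ge].
apply: (@le_lt_trans _ _
  (\sum_(i < p) (1 + 9 * P ^+ 2 * t ^+ 2 - 3 * t * i%:R))).
  apply: ler_sum => i _; rewrite -exprM; apply: le_trans (expr_le _ t01) _.
  rewrite natrM; have i0 : 0 <= i%:R :> R by [].
  have iP : i%:R <= P by rewrite ler_nat ltnW.
  have : i%:R ^+ 2 <= P ^+ 2 by rewrite lerXn2r ?nnegrE //; lra.
  have : 0 <= t ^+ 2 by rewrite exprn_ge0 // ltW.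
  by nra.
rewrite big_split /= sumr_const card_ord sumrN -mulr_sumr sum_idE -/P.
rewrite predE -/P -[X in X - _]mulr_natr -/P.
have -> : 9 * P ^+ 2 * t ^+ 2 = 9 * t * (t * P ^+ 2) by ring.
rewrite tP -subr_gt0.
have -> : P * (1 - (P - 1) * t)
    - ((1 + 9 * t / 36) * P - 3 * t * (P * (P - 1) / 2))
  = P * t * (P / 2 - 3 / 4) by field.
by rewrite !mulr_gt0 //; lra.
Qed.

Lemma powR_cexp : p%:R `^ (1 - cexp R p) = growth_rate R p.
Proof.
have J0 : 0 < growth_rate R p by have := growth_rate_ge; lra.
have lp : 0 < ln p%:R :> R by rewrite ln_gt0 //; have := p_ge2; lra.
apply: (@ln_inj R); rewrite ?posrE ?powR_gt0 //; first by have := p_ge2; lra.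
rewrite ln_powR /cexp opprB addrC subrK divfK //; exact: lt0r_neq0.
Qed.

Lemma cexp_in01 : 0 < cexp R p < 1.
Proof.
have J1 := growth_rate_ge; have J2 := growth_rate_lt.
have lp : 0 < ln p%:R :> R by rewrite ln_gt0 //; have := p_ge2; lra.
have lJ : 0 < ln (growth_rate R p) by rewrite ln_gt0 //; lra.
apply/andP; split.
  by rewrite /cexp subr_gt0 ltr_pdivrMr // mul1r ltr_ln ?posrE //; lra.
by rewrite /cexp ltrBlDr ltrDl divr_gt0.
Qed.

End ConstantsTheory.

(* Main.v *)
Require Import Defs.
From HB Require Import structures.
From mathcomp Require Import classical_sets reals sequences exp.
From mathcomp Require Import all_boot all_order fingroup perm all_algebra.
From mathcomp Require finfield.
From mathcomp Require Import ring lra zify.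

Set Implicit Arguments.
Unset Strict Implicit.
Unset Printing Implicit Defensive.

Import Order.TTheory GRing.Theory Num.Theory.

Local Open Scope ring_scope.

(** For the removal statement, a family of triangles none of which shares a vertex
    with another triangle of its vertex sets is a tricoloured sum-free set, so by the
    slice rank method it has at most 3 p^((1 - c) n) members. Choosing random parallel
    affine subspaces in which a typical triangle becomes isolated turns this into an
    upper bound on the number of triangles with bounded degrees; deleting vertices of
    high degree and taking tensor powers upgrades it to: m disjoint triangles force
    at least (m / N)^C N^2 triangles. Apply this to a maximal disjoint family.

    For tightness, it suffices to build sum-free sets of size p^((1 - c - o(1)) n)
    (Kleinberg, Sawin and Speyer). Digit vectors of prescribed types whose digits add
    up to p - 1 form a regular 3-partite hypergraph, and hashing into a set without
    midpoints isolates enough edges. The types come from a measure on triples with sum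
    p - 1 all of whose marginals are geometric with the ratio that attains the infimum
    defining c; such a measure is written explicitly as a combination of "star" and
    "urn" measures. *)

(** * Geometric marginals on triples with constant sum *)

(** The exponent is a balance. With degrees at most D, affine subspaces of codimension about log_p
    (6 D) give T <= const * D^(1 + c) N^(1 - c). Given m disjoint triangles, D may be taken of order
    T / m, and solving for T yields m^C N^(2 - C) with C = 1 + 1 / c. Conversely, a sum-free set
    with N^(1 - c - o(1)) members spans no triangles besides its own; a subset with just over eps N
    members shows delta <= 2 eps / N, and N^(-c) of order eps gives the same exponent.

    The obstacle on the tightness side is the measure on triples. Having sum p - 1 forces mean (p -
    1) / 3 on the average marginal, which determines the geometric ratio but does not produce a
    nonnegative measure. Urn measures of complementary parameters coincide, so alone they cannot
    match weights at i and p - 1 - i independently; the stars carry the remaining asymmetry. Both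
    families of weights must be nonnegative for every p, which is why explicit numerical bounds on
    hyperbolic sums are needed. *)

Ltac nneg := repeat first [assumption | exact: sqr_ge0 | exact: ler0n
  | apply: exprn_ge0 | lra | apply: mulr_ge0 | apply: addr_ge0].

Section HyperbolicSums.
Variable R : realFieldType.

Let nS i : i.+1%:R = i%:R + 1 :> R. Proof. by rewrite natr1. Qed.

Implicit Types d : nat -> R.

(** Comparison principle for the recurrence c(t+2) = (2 + k) c(t+1) - c(t). The second difference of
    a defect d typically contains k * d(t+1), so convexity is asked only where d(t+1) is already
    known to be nonnegative. *)
Lemma convex_ge0 d (T : nat) : 0 <= d 0%N -> d 0%N <= d 1%N ->
  (forall t, (t.+1 < T)%N -> 0 <= d t.+1 -> d t.+1 *+ 2 <= d t.+2 + d t) ->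
  forall t, (t <= T)%N -> 0 <= d t.
Proof.
move=> d0 d1 dd.
have H t : (t < T)%N -> 0 <= d t /\ d t <= d t.+1.
  elim: t => [//|t IH] tT; have [e1 e2] := IH (ltnW tT).
  have e3 : 0 <= d t.+1 by exact: le_trans e2.
  split=> //; have := dd t tT e3; rewrite mulr2n; lra.
move=> t; rewrite leq_eqVlt => /orP[/eqP->|/H[]//].
by case: T H {dd} => [//|T] /(_ T (leqnn _)) [h1 h2]; exact: le_trans h2.
Qed.

Variables x y k : R.
Hypotheses (x_gt0 : 0 < x) (lt_xy : x < y) (xy1 : x * y = 1).
Hypothesis kE : k = x + y - 2.

(* With x = exp (- s) and y = exp s, these are 2 cosh (ts), 2 sinh (ts) and
   sinh (ts) / sinh s; the bounds below are expansions in k = 2 cosh s - 2. *)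
Definition csum t : R := y ^+ t + x ^+ t.
Definition sdiff t : R := y ^+ t - x ^+ t.
Definition usum t : R := sdiff t / (y - x).

Let sg0 : y - x != 0. Proof. by rewrite subr_eq0 gt_eqF. Qed.

Let k0 : 0 <= k.
Proof.
have h : x * (x + y - 2) = (x - 1) ^+ 2 by ring: xy1.
by rewrite kE -(pmulr_rge0 _ x_gt0) h sqr_ge0.
Qed.

Let c0 : csum 0 = 2. Proof. by rewrite /csum !expr0; ring. Qed.
Let c1 : csum 1 = 2 + k. Proof. by rewrite /csum kE !expr1; ring. Qed.
Let cS t : csum t.+2 = (2 + k) * csum t.+1 - csum t.
Proof.
rewrite /csum kE !exprS.
by ring: xy1.
Qed.
Let u0 : usum 0 = 0. Proof. by rewrite /usum /sdiff !expr0 subrr mul0r. Qed.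
Let u1 : usum 1 = 1. Proof. by rewrite /usum /sdiff !expr1 divff. Qed.
Let sdS t : sdiff t.+2 = (2 + k) * sdiff t.+1 - sdiff t.
Proof. by rewrite /sdiff kE !exprS; ring: xy1. Qed.
Let uS t : usum t.+2 = (2 + k) * usum t.+1 - usum t.
Proof. by rewrite /usum sdS mulrBl mulrA. Qed.
Let cu t : csum t.+2 - csum t = k * (k + 4) * usum t.+1.
Proof.
have -> : k * (k + 4) = (y - x) ^+ 2 by rewrite kE; ring: xy1.
rewrite /usum mulrC expr2 mulrA divfK // /csum /sdiff !exprS.
by ring: xy1.
Qed.

Lemma csum_ge t : 2 + k * t%:R ^+ 2 <= csum t.
Proof.
have hk := k0.
rewrite -subr_ge0; move: t (leqnn t) => t.
apply: (@convex_ge0 (fun t => csum t - (2 + k * t%:R ^+ 2))) => [||i _].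
- rewrite c0 expr0n /=; lra.
- rewrite c0 c1 expr0n expr1n /=; lra.
- rewrite mulr2n cS (nS i.+1) (nS i); set z : R := i%:R; set C := csum _.
  have z0 : 0 <= z by [].
  have : 0 <= k * (k * (z + 1) ^+ 2) by nneg.
  move=> h1 h2; have := mulr_ge0 k0 h2; nra.
Qed.

Lemma csum_ge2 t : 2 <= csum t.
Proof. by have := csum_ge t; have := mulr_ge0 k0 (sqr_ge0 (t%:R : R)); lra. Qed.

Lemma usum_ge_id t : t%:R <= usum t.
Proof.
have hk := k0.
rewrite -subr_ge0; move: t (leqnn t) => t.
apply: (@convex_ge0 (fun t => usum t - t%:R)) => [||i _].
- rewrite u0; lra.
- rewrite u0 u1; lra.
- rewrite mulr2n uS (nS i.+1) (nS i); set z : R := i%:R; set C := usum _.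
  have z0 : 0 <= z by [].
  move=> h2; have := mulr_ge0 k0 h2; have := mulr_ge0 k0 z0; nra.
Qed.

Lemma usum_ge t : t%:R + k * (t%:R ^+ 3 - t%:R) / 6 <= usum t.
Proof.
have hk := k0.
rewrite -subr_ge0; move: t (leqnn t) => t.
apply: (@convex_ge0 (fun t => usum t - (t%:R + k * (t%:R ^+ 3 - t%:R) / 6))) => [||i _].
- rewrite u0 expr0n /=; lra.
- rewrite u0 u1 expr0n expr1n /=; lra.
- have := usum_ge_id i.+1.
  rewrite mulr2n uS (nS i.+1) (nS i); set z : R := i%:R; set C := usum _.
  have z0 : 0 <= z by [].
  rewrite -subr_ge0 => h2 _; rewrite -subr_ge0.
  by rewrite (_ : _ - _ = k * (C - (z + 1))); [apply: mulr_ge0 | field].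
Qed.

Lemma csum_le T t : k * T%:R ^+ 2 <= 121 / 100 -> (t <= T)%N ->
  csum t <= 2 + k * t%:R ^+ 2 + 93 / 1000 * k ^+ 2 * t%:R ^+ 4.
Proof.
have hk := k0.
move=> kT tT; rewrite -subr_ge0; move: t tT.
apply: (@convex_ge0 (fun t => 2 + k * t%:R ^+ 2 + 93 / 1000 * k ^+ 2 * t%:R ^+ 4 - csum t))
   => [||i iT].
- rewrite c0 !expr0n /=; lra.
- rewrite c0 c1 !expr0n !expr1n /=; have := sqr_ge0 k; lra.
- have ki : k * i.+1%:R ^+ 2 <= 121 / 100.
    apply: le_trans kT; apply: ler_wpM2l => //.
    by rewrite lerXn2r ?nnegrE // ler_nat ltnW.
  move: ki; rewrite mulr2n cS (nS i.+1) (nS i); set z : R := i%:R + 1; set C := csum _.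
  have z1 : 1 <= z by rewrite /z lerDr.
  have -> : i%:R = z - 1 by rewrite /z; ring.
  move=> kz h2.
  have h3 := mulr_ge0 k0 h2.
  (* The Taylor coefficient of k^2 t^4 is 1/12. The value 93/1000 is slightly larger, so that
     93/1000 * (12 - 121/100) >= 1. *)
  have h4 : 0 <= k ^+ 2 * z ^+ 2 * (93 / 1000 * (12 - k * z ^+ 2) - 1).
    by nneg.
  have h5 := sqr_ge0 k.
  rewrite -subr_ge0.
  rewrite (_ : _ - _ = k * (2 + k * z ^+ 2 + 93 / 1000 * k ^+ 2 * z ^+ 4 - C)
    + k ^+ 2 * z ^+ 2 * (93 / 1000 * (12 - k * z ^+ 2) - 1) + 186 / 1000 * k ^+ 2); last by field.
  by nneg.
Qed.

(** To first order in k the two sides are k (t^3 - t) and k t^3. *)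
Lemma csum_usum t : 6 * (usum t - t%:R) <= t%:R * (csum t - 2).
Proof.
have hk := k0.
rewrite -subr_ge0; move: t (leqnn t) => t.
apply: (@convex_ge0 (fun t => t%:R * (csum t - 2) - 6 * (usum t - t%:R))) => [||i _].
- rewrite u0; lra.
- rewrite u0 u1 c1; have := k0; lra.
- have := csum_ge2 i.+1.
  have e : csum i = csum i.+2 - k * (k + 4) * usum i.+1 by rewrite -cu; ring.
  have e2 : csum i.+2 = csum i.+1 + (k * csum i.+1 + k * (k + 4) * usum i.+1) / 2.
    by rewrite -cu cS; field.
  rewrite mulr2n e uS e2 (nS i.+1) (nS i); set z : R := i%:R; set C := csum _; set U := usum _.
  have z0 : 0 <= z by [].
  rewrite -subr_ge0 => h1 h2.
  rewrite -subr_ge0.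
  rewrite (_ : _ - _ = k * ((z + 1) * C + (k - 2) * U)); last by field.
  apply: mulr_ge0 => //.
  have z1 : 0 <= (z + 1) * (C - 2) by apply: mulr_ge0 => //; lra.
  have u0' : 0 <= k * U.
    apply: mulr_ge0 => //; apply: le_trans (usum_ge_id _); exact: ler0n.
  nra.
Qed.

(** The left side is the expansion of the right side to first order in k. The remainder is
    [A t - v * B t] with B nonnegative, so v = 2 is the worst case. *)
Lemma gap_ge (v : R) t : 0 <= v <= 2 ->
  t%:R * (2 * (1 - v) + k * (t%:R ^+ 2 - v * (t%:R ^+ 2 - 1) / 3))
    <= t%:R * csum t - 2 * v * usum t.
Proof.
have hk := k0.
move=> /andP[v0 v2].
pose A t := t%:R * (csum t - 2) - k * t%:R ^+ 3.
pose B t := 2 * (usum t - t%:R) - k * (t%:R ^+ 3 - t%:R) / 3.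
have B0 : 0 <= B t by rewrite /B; have := usum_ge t; lra.
suff AB : 0 <= A t - 2 * B t.
  have : 0 <= (2 - v) * B t by apply: mulr_ge0 => //; lra.
  move=> h.
  rewrite -subr_ge0 (_ : _ - _ = A t - 2 * B t + (2 - v) * B t); last first.
    by rewrite /A /B; field.
  exact: addr_ge0.
move: t {B0} (leqnn t) => t.
apply: (@convex_ge0 (fun t => A t - 2 * B t)) => [||i _]; rewrite /A /B.
- rewrite u0 expr0n /=; lra.
- rewrite u0 u1 c1 expr0n expr1n /=; lra.
- have := csum_ge2 i.+1.
  have e : csum i = csum i.+2 - k * (k + 4) * usum i.+1 by rewrite -cu; ring.
  have e2 : csum i.+2 = csum i.+1 + (k * csum i.+1 + k * (k + 4) * usum i.+1) / 2.
    by rewrite -cu cS; field.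
  have := usum_ge_id i.+1.
  rewrite mulr2n e uS e2 (nS i.+1) (nS i); set z : R := i%:R; set C := csum _; set U := usum _.
  have z0 : 0 <= z by [].
  move=> h1 h2 _.
  rewrite -subr_ge0.
  rewrite (_ : _ - _ = k * ((z + 1) * (C - 2) + k * U)); last by field.
  apply: mulr_ge0 => //; apply: addr_ge0; apply: mulr_ge0 => //; try lra.
Qed.

(** At v = 1 the cubic coefficient is 2/3 from the first-order terms plus 93/1000 * 121/100 from the
    quartic one, just below 78/100. *)
Lemma gap_le (v : R) T t : 1 <= v -> k * T%:R ^+ 2 <= 121 / 100 -> (t <= T)%N ->
  t%:R * csum t - 2 * v * usum t <= k * (78 / 100 * t%:R ^+ 3 + t%:R / 3).
Proof.
have hk := k0.
move=> v1 kT tT.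
have tn : 0 <= t%:R :> R by [].
have kt : k * t%:R ^+ 2 <= 121 / 100.
  apply: le_trans kT; apply: ler_wpM2l => //.
  by rewrite lerXn2r ?nnegrE // ler_nat.
have h1 := ler_wpM2l tn (csum_le kT tT).
have h2 := usum_ge t.
have h3 : 0 <= (v - 1) * usum t.
  by apply: mulr_ge0; [lra | apply: le_trans (usum_ge_id t)].
have h4 : 0 <= k * t%:R ^+ 3 * (121 / 100 - k * t%:R ^+ 2).
  by nneg.
have h5 : 0 <= k * t%:R ^+ 3 by nneg.
nra.
Qed.

End HyperbolicSums.

(** * The ratio for which the geometric law has mean (p - 1) / 3 *)

Section CriticalPoint.
Variable R : rcfType.
Implicit Types (x y k v : R) (m t : nat).

Lemma sum_sq m : \sum_(t < m) t.+1%:R ^+ 2 = m%:R * (m%:R + 1) * (2 * m%:R + 1) / 6 :> R.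
Proof.
elim: m => [|m IH]; first by rewrite big_ord0 !mul0r.
by rewrite big_ord_recr /= IH -(natr1 m); field.
Qed.

Lemma sum_quart m : \sum_(t < m) t.+1%:R ^+ 4
  = m%:R * (m%:R + 1) * (2 * m%:R + 1) * (3 * m%:R ^+ 2 + 3 * m%:R - 1) / 30 :> R.
Proof.
elim: m => [|m IH]; first by rewrite big_ord0 !mul0r.
by rewrite big_ord_recr /= IH -(natr1 m); field.
Qed.

Lemma sum_centered (g : nat -> R) m :
  \sum_(i < m.*2.+1) g i = g m + \sum_(t < m) (g (m + t.+1)%N + g (m - t.+1)%N).
Proof.
have -> : m.*2.+1 = (m + m.+1)%N by rewrite addnS addnn.
rewrite big_split_ord /= big_ord_recl /= addn0 (reindex_inj rev_ord_inj) /=.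
by rewrite big_split /= addrC -addrA; congr (_ + (_ + _)).
Qed.

(** Here 2 m = p - 1. A root x is a ratio for which the geometric law on 0..2m has mean 2m/3. *)
Definition mean_defect m x := \sum_(i < m.*2.+1) (3 * i%:R - 2 * m%:R) * x ^+ i.
(** The indices m + t and m - t are paired and x^m is divided out, which exposes the hyperbolic
    sums. *)
Definition mean_half m x y :=
  m%:R + \sum_(t < m) (m%:R * csum x y t.+1 - 3 * t.+1%:R * sdiff x y t.+1).

Lemma mean_defectE m x y : x * y = 1 -> mean_defect m x = x ^+ m * mean_half m x y.
Proof.
move=> xy1; rewrite /mean_defect /mean_half.
rewrite (sum_centered (fun i => (3 * i%:R - 2 * m%:R) * x ^+ i)) mulrDr mulr_sumr.
congr (_ + _); first by ring.
apply: eq_bigr => t _; rewrite /csum /sdiff natrD exprD natrB //.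
have -> : x ^+ m = x ^+ (m - t.+1) * x ^+ t.+1 by rewrite -exprD subnK.
set a := x ^+ (m - t.+1); set b := x ^+ t.+1; set c := y ^+ t.+1.
have bc : b * c = 1 by rewrite /b /c -exprMn xy1 expr1n.
have -> : a = a * (b * c) by rewrite bc mulr1.
by ring: bc.
Qed.

(** For large m the root is about 1 - sigma / m with coth sigma - 1 / sigma = 1/3, so sigma is near
    1.07. The point tested here corresponds to sigma = 1, the one in [mean_half_le0] to sigma =
    11/10. *)
Lemma mean_half_ge0 m x y : (1 < m)%N -> 0 < x -> x < y -> x * y = 1 ->
  x = (2 * m%:R + 1) / (2 * m%:R + 3) -> 0 <= mean_half m x y.
Proof.
move=> m1 x0 xy xy1 xE; pose k := x + y - 2.
have M2 : 2 <= m%:R :> R by rewrite (ler_nat _ 2).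
have yE : y = (2 * m%:R + 3) / (2 * m%:R + 1).
  apply: (mulfI (lt0r_neq0 x0)); rewrite xy1 xE; field.
  by apply/andP; split; apply/lt0r_neq0; lra.
have kE : k = 4 / ((2 * m%:R + 1) * (2 * m%:R + 3)).
  by rewrite /k xE yE; field; apply/andP; split; apply/lt0r_neq0; lra.
have sE : y - x = (2 + k / 2) / (m%:R + 1).
  by rewrite kE xE yE; field; apply/and3P; split; apply/lt0r_neq0; lra.
have k0 : 0 <= k.
  by rewrite kE divr_ge0 // mulr_ge0 //; lra.
have km : k * m%:R ^+ 2 <= 121 / 100.
  rewrite kE mulrAC ler_pdivrMr; last by rewrite mulr_gt0 //; lra.
  nra.
(* These comparison terms add up to exactly -m, which cancels the leading m. *)
apply: (@le_trans _ _ (m%:R + \sum_(t < m) (2 * m%:R - 6 / (m%:R + 1) * t.+1%:R ^+ 2))).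
  rewrite big_split /= sumr_const card_ord sumrN -mulr_sumr sum_sq.
  rewrite (_ : _ + _ = 0) //.
  by rewrite -[_ *+ m]mulr_natr; field; apply/lt0r_neq0; lra.
rewrite lerD2l; apply: ler_sum => t _.
have h1 := csum_usum x0 xy xy1 (erefl k) t.+1.
have h2 := csum_ge x0 xy1 (erefl k) t.+1.
have h3 := csum_le x0 xy1 (erefl k) km (ltn_ord t).
have T0 : 0 <= t.+1%:R :> R by [].
have Tm : t.+1%:R <= m%:R :> R by rewrite ler_nat ltn_ord.
have -> : sdiff x y t.+1 = usum x y t.+1 * (y - x).
  by rewrite /usum divfK // subr_eq0 gt_eqF.
rewrite sE.
move: (csum _ _ _) (usum _ _ _) (t.+1%:R) (m%:R) h1 h2 h3 T0 Tm M2 km => C U T M h1 h2 h3 T0 TM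
  M2 km.
clearbody k; clear -h1 h2 h3 T0 TM M2 km k0.
have kT : 0 <= k * T ^+ 2 by nneg.
have kTM : k * T ^+ 2 <= 121 / 100.
  apply: le_trans km; apply: ler_wpM2l => //.
  by rewrite lerXn2r ?nnegrE //; lra.
have D : C - 2 <= 135 / 100.
  have : 0 <= (121 / 100 - k * T ^+ 2) * (121 / 100 + k * T ^+ 2) by nneg.
  nra.
rewrite -subr_ge0.
have M1 : 0 < M + 1 by lra.
rewrite (_ : _ - _ = (M * (M + 1) * (C - 2) - 6 * T * (U - T) - 3 / 2 * k * T * U) / (M + 1));
  last first.
  by field; exact: lt0r_neq0.
apply: divr_ge0; last by lra.
have a1 := ler_wpM2l T0 h1.
have a2 : k * T * U <= k * T ^+ 2 * (1 + (C - 2) / 6).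
  have : 0 <= k * T * (T * (C - 2) - 6 * (U - T)) by nneg.
  lra.
have a3 : k * T ^+ 2 * (1 + (C - 2) / 6) <= (C - 2) * (1 + (C - 2) / 6).
  by apply: ler_wpM2r; lra.
have C2 : 0 <= C - 2 by lra.
have a4 : 0 <= (C - 2) * ((M + T) * (M - T) + (M - 2) + (135 / 100 - (C - 2)) / 4).
  apply: mulr_ge0 => //; have : 0 <= (M + T) * (M - T) by nneg.
  lra.
nra.
Qed.

Lemma mean_half_le0 m x y : (1 < m)%N -> 0 < x -> x < y -> x * y = 1 ->
  x = (20 * m%:R + 11) / (20 * m%:R + 33) -> mean_half m x y <= 0.
Proof.
move=> m1 x0 xy xy1 xE; pose k := x + y - 2.
have M2 : 2 <= m%:R :> R by rewrite (ler_nat _ 2).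
have yE : y = (20 * m%:R + 33) / (20 * m%:R + 11).
  apply: (mulfI (lt0r_neq0 x0)); rewrite xy1 xE; field.
  by apply/andP; split; apply/lt0r_neq0; lra.
pose P : R := (20 * m%:R + 11) * (20 * m%:R + 33).
have P0 : 0 < P by rewrite /P mulr_gt0 //; lra.
have kE : k * P = 484.
  by rewrite /k xE yE /P; field; apply/andP; split; apply/lt0r_neq0; lra.
pose v := (m%:R + 1) * (y - x) / 2.
have vE : v * P = 44 * (m%:R + 1) * (10 * m%:R + 11).
  by rewrite /v xE yE /P; field; apply/andP; split; apply/lt0r_neq0; lra.
have k0 : 0 <= k by rewrite -(pmulr_lge0 _ P0) kE.
have v0 : 0 <= v by rewrite /v; nneg.
have km : k * m%:R ^+ 2 <= 121 / 100.
  rewrite -(ler_pM2r P0) mulrAC kE /P; nra.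
pose M : R := m%:R.
apply: (@le_trans _ _ (M + \sum_(t < m) (2 * M
   + (M * k - 6 * v / (M + 1) + v * k / (M + 1)) * t.+1%:R ^+ 2
   + (93 / 1000 * k ^+ 2 * M - v * k / (M + 1)) * t.+1%:R ^+ 4))).
  rewrite lerD2l; apply: ler_sum => t _.
  have h2 := usum_ge x0 xy xy1 (erefl k) t.+1.
  have h3 := csum_le x0 xy1 (erefl k) km (ltn_ord t).
  have -> : sdiff x y t.+1 = usum x y t.+1 * (2 * v / (M + 1)).
    rewrite /usum /v /M.
    rewrite (_ : 2 * _ / _ = y - x); last by field; apply/lt0r_neq0; lra.
    by rewrite divfK // subr_eq0 gt_eqF.
  have T0 : 0 <= t.+1%:R :> R by [].
  have MM : 0 <= M by [].
  have a1 := ler_wpM2l MM h3.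
  have M1 : 0 < M + 1 by lra.
  have a2 : 0 <= t.+1%:R * v / (M + 1) by apply: divr_ge0; [exact: mulr_ge0 | lra].
  have a3 := ler_wpM2l a2 h2.
  move: a1 a3; rewrite -/k.
  move: (csum _ _ _) (usum _ _ _) (t.+1%:R) => C U T a1 a3.
  rewrite -subr_ge0 (_ : _ - _ = (M * (2 + k * T ^+ 2 + 93 / 1000 * k ^+ 2 * T ^+ 4) - M * C)
     + 6 * (T * v / (M + 1) * U - T * v / (M + 1) * (T + k * (T ^+ 3 - T) / 6))); last first.
    by field; exact: lt0r_neq0.
  lra.
rewrite !big_split /= -!mulr_sumr sum_sq sum_quart sumr_const card_ord -[M *+ m]mulr_natr -/M.
pose F := 1 + k * M * (M + 1) / 6 + 93 / 1000 * k ^+ 2 * M * (M + 1) * (3 * M ^+ 2 + 3 * M - 1) / 30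
   - v - v * k * (3 * M ^+ 2 + 3 * M - 6) / 30.
have M0 : M + 1 != 0 by apply/lt0r_neq0; rewrite /M; lra.
rewrite [leLHS](_ : _ = M * (2 * M + 1) * F); last by rewrite /F; field.
have Mg : 2 <= M by [].
apply: mulr_ge0_le0; first by apply: mulr_ge0; lra.
have P2 : 0 < P ^+ 2 by rewrite exprn_gt0.
rewrite -(pmulr_lle0 _ P2).
have -> : F * P ^+ 2 = P ^+ 2 + (k * P) * P * M * (M + 1) / 6
  + 93 / 1000 * (k * P) ^+ 2 * M * (M + 1) * (3 * M ^+ 2 + 3 * M - 1) / 30 - (v * P) * P
  - (v * P) * (k * P) * (3 * M ^+ 2 + 3 * M - 6) / 30 by rewrite /F; field.
rewrite kE vE /P -/M.
(* After the shift M = 2 + r all coefficients of the quartic have one sign. *)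
have : 0 <= M - 2 by rewrite subr_ge0.
have -> : M = 2 + (M - 2) by ring.
move: (M - 2) => r r0.
have r2 := exprn_ge0 2 r0; have r3 := exprn_ge0 3 r0; have r4 := exprn_ge0 4 r0.
rewrite -subr_ge0; lra.
Qed.

End CriticalPoint.

Section CriticalPointExistence.
Variable R : rcfType.
Implicit Types (x y k v : R) (m t : nat).

Lemma mean_defect_ivt m a b : a <= b -> mean_defect m a <= 0 -> 0 <= mean_defect m b ->
  exists2 x : R, a <= x <= b & mean_defect m x = 0.
Proof.
move=> ab ha hb; pose p := \poly_(i < m.*2.+1) (3 * i%:R - 2 * m%:R : R).
have pE z : p.[z] = mean_defect m z by rewrite horner_poly.
have [|x xab /rootP px] := @poly_ivt _ p a b ab; first by rewrite !pE ha hb.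
by exists x => //; rewrite -pE.
Qed.

(* The brackets (20m+11)/(20m+33) and (2m+1)/(2m+3) of the root keep
   v = (m+1)(1/x - x)/2 in the interval [1, 11/10]; m = 1 needs its own bracket. *)
Lemma mean_defect_root m : (0 < m)%N -> exists2 x : R, mean_defect m x = 0 &
  [/\ 0 < x < 1, (2 * m%:R + 3) * x <= 2 * m%:R + 1 &
     (m%:R + 1) * (x^-1 - x) / 2 <= 11 / 10].
Proof.
case: m => [//|[_|m' _]].
  have [|||x /andP[x1 x2] x0] := @mean_defect_ivt 1 (16 / 27) (3 / 5).
  - by lra.
  - by rewrite /mean_defect !big_ord_recl big_ord0 /= /bump /=; lra.
  - by rewrite /mean_defect !big_ord_recl big_ord0 /= /bump /=; lra.
  have xp : 0 < x by lra.
  exists x => //; split; try lra.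
  have : x^-1 <= x + 11 / 10.
    rewrite -[leLHS]mul1r ler_pdivrMr //.
    by have : 0 <= (x - 16 / 27) * x; [apply: mulr_ge0; lra | lra].
  lra.
set m := m'.+2; have m1 : (1 < m)%N by [].
have M2 : 2 <= m%:R :> R by rewrite (ler_nat _ 2).
pose a : R := (20 * m%:R + 11) / (20 * m%:R + 33).
pose b : R := (2 * m%:R + 1) / (2 * m%:R + 3).
have a0 : 0 < a by rewrite divr_gt0 //; lra.
have a1 : a < 1 by rewrite ltr_pdivrMr; lra.
have b0 : 0 < b by rewrite divr_gt0 //; lra.
have b1 : b < 1 by rewrite ltr_pdivrMr; lra.
have ab : a <= b.
  rewrite -subr_ge0 (_ : b - a = 4 * m%:R / ((20 * m%:R + 33) * (2 * m%:R + 3))); last first.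
    by rewrite /a /b; field; apply/andP; split; apply/lt0r_neq0; lra.
  by apply: divr_ge0; apply: mulr_ge0; lra.
have inv1 (z : R) : 0 < z -> z < 1 -> z < z^-1.
  by move=> z0 z1; apply: (lt_trans z1); rewrite -[z^-1]mul1r ltr_pdivlMr // mul1r.
have [||x /andP[ax xb] fx] := mean_defect_ivt (m := m) ab.
- rewrite (@mean_defectE _ m a a^-1) ?divff ?lt0r_neq0 // pmulr_rle0 ?exprn_gt0 //.
  by apply: mean_half_le0; rewrite ?divff ?lt0r_neq0 //; exact: inv1.
- rewrite (@mean_defectE _ m b b^-1) ?divff ?lt0r_neq0 // pmulr_rge0 ?exprn_gt0 //.
  by apply: mean_half_ge0; rewrite ?divff ?lt0r_neq0 //; exact: inv1.
exists x => //; split.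
- by apply/andP; split; lra.
- by rewrite mulrC -ler_pdivlMr //; lra.
- have : x^-1 - x <= a^-1 - a.
    by apply: lerB => //; rewrite lef_pV2 ?posrE //; lra.
  move=> h; apply: (@le_trans _ _ ((m%:R + 1) * (a^-1 - a) / 2)).
    by rewrite ler_pM2r ?invr_gt0 // ler_pM2l //; lra.
  rewrite (_ : a^-1 - a = 44 * (20 * m%:R + 22) / ((20 * m%:R + 11) * (20 * m%:R + 33))); last
    first.
    by rewrite /a; field; apply/andP; split; apply/lt0r_neq0; lra.
  rewrite ler_pdivrMr // mulrA ler_pdivrMr; last by apply: mulr_gt0; lra.
  lra.
Qed.

Lemma critical_point m : (0 < m)%N -> exists x y k v : R,
  [/\ [/\ 0 < x, x < y, x * y = 1 & k = x + y - 2],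
      [/\ v = (m%:R + 1) * (y - x) / 2, 1 <= v & v <= 11 / 10],
      [/\ k * (m%:R + 1) ^+ 2 <= 121 / 100, v <= k * (m%:R + 1) ^+ 2 &
          (2 * m%:R + 3) * x <= 2 * m%:R + 1] &
      mean_defect m x = 0].
Proof.
move=> m0; have [x fx [/andP[x0 x1] xb xv]] := mean_defect_root m0.
have M1 : 1 <= m%:R :> R by rewrite (ler_nat _ 1).
have xy1 : x * x^-1 = 1 by rewrite divff // lt0r_neq0.
have y1 : 1 < x^-1 by rewrite -[ltRHS]mul1r ltr_pdivlMr // mul1r.
exists x, x^-1, (x + x^-1 - 2), ((m%:R + 1) * (x^-1 - x) / 2).
move: (x^-1) xv xy1 y1 => y xv xy1 y1.
have hk : (x + y - 2) * x = (1 - x) ^+ 2 by ring: xy1.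
have hs : (y - x) * x = (1 - x) * (1 + x) by ring: xy1.
(* The middle factor is nonnegative by (2 m + 3) x <= 2 m + 1. Multiplied by x, the inequality v <=
   k (m + 1)^2 becomes this one up to a factor 2. *)
have xM : 0 <= (1 - x) * (2 * (m%:R + 1) * (1 - x) - (1 + x)) * (m%:R + 1).
  by nneg.
have k0 : 0 <= x + y - 2 by rewrite -(pmulr_lge0 _ x0) hk sqr_ge0.
split=> //; split=> //; try lra.
- have e : (m%:R + 1) * (y - x) / 2 * x = (m%:R + 1) / 2 * ((y - x) * x) by field.
  rewrite -(ler_pM2r x0) mul1r e hs -subr_ge0.
  have w0 : 0 < 2 * (2 * m%:R + 3) ^+ 2 :> R by rewrite mulr_gt0 ?exprn_gt0 //; lra.
  rewrite -(pmulr_rge0 _ w0).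
  rewrite [leRHS](_ : _ = 2 + (2 * m%:R + 1 - (2 * m%:R + 3) * x)
    * ((m%:R + 1) * ((2 * m%:R + 3) * x + 2 * m%:R + 1) + 2 * (2 * m%:R + 3))); last by field.
  by nneg.
(* Since v^2 = k (m + 1)^2 (1 + k / 4), the bound 121/100 is just (11/10)^2. *)
- apply: (@le_trans _ _ (((m%:R + 1) * (y - x) / 2) ^+ 2)).
    have -> : ((m%:R + 1) * (y - x) / 2) ^+ 2 = (x + y - 2) * (m%:R + 1) ^+ 2 * (1 + (x + y -
      2) / 4).
      have e : (y - x) ^+ 2 = (x + y - 2) * (x + y - 2 + 4) by ring: xy1.
      rewrite (_ : _ ^+ 2 = (m%:R + 1) ^+ 2 * (y - x) ^+ 2 / 4); last by field.
      by rewrite e; field.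
    by rewrite ler_peMr; nneg.
  have v0 : 0 <= (m%:R + 1) * (y - x) / 2 by nneg.
  nra.
- rewrite -subr_ge0 -(pmulr_lge0 _ x0) mulrBl.
  rewrite (_ : _ - _ = (x + y - 2) * x * (m%:R + 1) ^+ 2 - (m%:R + 1) / 2 * ((y - x) * x));
    last by field.
  by rewrite hk hs; nra.
Qed.
End CriticalPointExistence.

(** * Sign and size of the star weights *)

Section WeightTail.
Variable R : rcfType.
Implicit Types (x y k v z : R) (m t s : nat).

Let S1 z := z * (z - 1) / 2.
Let S2 z := z * (z - 1) * (2 * z - 1) / 6.
Let S3 z := z ^+ 2 * (z - 1) ^+ 2 / 4.
Let S4 z := z * (z - 1) * (2 * z - 1) * (3 * z ^+ 2 - 3 * z - 1) / 30.

Let sum_weighted m t (a b : R) : (t <= m)%N ->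
  \sum_(t <= s < m) (m%:R + s%:R) * (a * s%:R ^+ 3 + b * s%:R)
  = a * (m%:R * (S3 m%:R - S3 t%:R) + (S4 m%:R - S4 t%:R))
    + b * (m%:R * (S1 m%:R - S1 t%:R) + (S2 m%:R - S2 t%:R)).
Proof.
move=> tm; pose f s := a * (m%:R * S3 s%:R + S4 s%:R) + b * (m%:R * S1 s%:R + S2 s%:R).
rewrite (@telescope_sumr_eq _ t m f) //; first by rewrite /f; ring.
by move=> s _; rewrite /f /S1 /S2 /S3 /S4 -(natr1 s); field.
Qed.

(** For v = (m + 1)(y - x) / 2 this is (m + 1 + t) x^t - (m + 1 - t) y^t. Up to the factor (1 - x)
    x^m it compares the target weight [lam] at m + t with the one at m - t, an asymmetry that
    symmetric urn weights cannot supply. *)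
Definition gap x y v t := t%:R * csum x y t - 2 * v * usum x y t.
(** Backward solution of the recurrence for the star weights. Its value 3m/10 at t = m is a free
    parameter, large enough for [wtail_ge0] and small enough for [wtail_le]. *)
Definition wtail m x y v t :=
  3 * m%:R / 10 + \sum_(t <= s < m) (m%:R + s%:R) * gap x y v s.

(* The summands change sign once, from negative to nonnegative, so a tail is
   nonnegative as soon as the full sum is. *)
Lemma wtail_ge0 m t x y k v : (0 < t <= m)%N -> 0 < x -> x < y -> x * y = 1 ->
  k = x + y - 2 -> 1 <= v <= 11 / 10 -> v <= k * (m%:R + 1) ^+ 2 ->
  0 <= wtail m x y v t.
Proof.
move=> /andP[t0 tm] x0 xy xy1 kE /andP[v1 v2] kv.
pose M : R := m%:R; pose w := (M + 1) ^+ 2.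
have M0 : 0 <= M by [].
have w0 : 0 < w by rewrite /w exprn_gt0 //; lra.
(* The bound of [gap_ge] at the extreme value v = 11/10 with k replaced by v / w; the coefficients
   11/10 - 121/300 and 121/300 are rounded down to 69/100 and 4/10. *)
pose b s := (69 / 100 * s%:R ^+ 2 + 4 / 10) / w - 1 / 5.
have bmono s s' : (s <= s')%N -> b s <= b s'.
  move=> ss; rewrite /b lerD2r ler_pM2r ?invr_gt0 // lerD2r ler_pM2l; last by lra.
  by rewrite lerXn2r ?nnegrE // ler_nat.
pose f s := (M + s%:R) * (s%:R * b s).
have gap_f s : (s < m)%N -> s%:R * b s <= gap x y v s.
  move=> sm; apply: le_trans (gap_ge x0 xy xy1 kE s _); last by lra.
  apply: ler_wpM2l => //.
  have sM : s%:R <= M by rewrite ler_nat ltnW.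
  have s0 : 0 <= s%:R :> R by [].
  rewrite /b; clear bmono f b; move: (s%:R) sM s0 => z zM z0.
  have h1 : 0 <= z ^+ 2 - v * (z ^+ 2 - 1) / 3.
    by have := sqr_ge0 z; nra.
  have h2 : v / w * (z ^+ 2 - v * (z ^+ 2 - 1) / 3) <= k * (z ^+ 2 - v * (z ^+ 2 - 1) / 3).
    by apply: ler_wpM2r => //; rewrite ler_pdivrMr.
  apply: (@le_trans _ _ (2 * (1 - v) + v / w * (z ^+ 2 - v * (z ^+ 2 - 1) / 3))); last by lra.
  rewrite -(ler_pM2r w0).
  rewrite (_ : (_ - _) * w = 69 / 100 * z ^+ 2 + 4 / 10 - w / 5); last first.
    by field; exact: lt0r_neq0.
  rewrite (_ : (_ + _) * w = 2 * (1 - v) * w + v * (z ^+ 2 - v * (z ^+ 2 - 1) / 3)); last first.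
    by field; exact: lt0r_neq0.
  have zw : z ^+ 2 + 1 <= w by rewrite /w; nra.
  pose u := 11 / 10 - v.
  have vE : v = 11 / 10 - u by rewrite /u; ring.
  have u0 : 0 <= u by rewrite /u; lra.
  have u1 : u <= 1 / 10 by rewrite /u; lra.
  rewrite vE; move: u u0 u1 {vE h1 h2} => u u0 u1.
  have z2 : 0 <= z ^+ 2 by exact: sqr_ge0.
  have a1 : 0 <= u * (w - z ^+ 2 - 1) by nneg.
  have a2 : 0 <= u * z ^+ 2 by nneg.
  have a3 : 0 <= u * (1 / 10 - u) by nneg.
  have a4 : 0 <= u * (1 / 10 - u) * z ^+ 2 by nneg.
  nra.
have step : \sum_(t <= s < m) f s <= \sum_(t <= s < m) (m%:R + s%:R) * gap x y v s.
  apply: ler_sum_nat => s /andP[_ sm]; apply: ler_wpM2l; last exact: gap_f.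
  exact: addr_ge0.
rewrite /wtail; apply: (@le_trans _ _ (3 * M / 10 + \sum_(t <= s < m) f s)); last by rewrite lerD2l.
have [bt|bt] := lerP 0 (b t).
  apply: addr_ge0; first by apply: divr_ge0 => //; apply: mulr_ge0.
  rewrite big_nat_cond; apply: sumr_ge0 => s /andP[/andP[ts _] _].
  apply: mulr_ge0; first exact: addr_ge0.
  by apply: mulr_ge0 => //; apply: le_trans (bmono _ _ ts).
apply: (@le_trans _ _ (3 * M / 10 + \sum_(1 <= s < m) f s)); last first.
  rewrite lerD2l (@big_cat_nat _ _ _ t 1) //= gerDr.
  rewrite big_nat_cond; apply: sumr_le0 => s /andP[/andP[_ st] _].
  apply: mulr_ge0_le0; first exact: addr_ge0.
  by apply: mulr_ge0_le0 => //; apply: le_trans (bmono _ _ (ltnW st)) (ltW bt).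
have fE s : f s = (m%:R + s%:R) * (69 / 100 / w * s%:R ^+ 3 + (4 / 10 / w - 1 / 5) * s%:R).
  by rewrite /f /b -/M; field; exact: lt0r_neq0.
rewrite (eq_bigr _ (fun s _ => fE s)) sum_weighted; last exact: leq_trans tm.
rewrite -/M -(pmulr_lge0 _ w0).
rewrite [leRHS](_ : _ = 3 * M / 10 * (M + 1) ^+ 2 + 69 / 100 * (M * (S3 M - S3 1) + (S4 M - S4 1))
   + (4 / 10 - (M + 1) ^+ 2 / 5) * (M * (S1 M - S1 1) + (S2 M - S2 1))); last first.
  by rewrite -/w; field; exact: lt0r_neq0.
have : 0 <= M - 1 by rewrite subr_ge0 (ler_nat _ 1) (leq_trans t0).
have -> : M = 1 + (M - 1) by ring.
move: (M - 1) => r r0; rewrite /S1 /S2 /S3 /S4.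
have r2 := exprn_ge0 2 r0; have r3 := exprn_ge0 3 r0; have r4 := exprn_ge0 4 r0.
have r5 := exprn_ge0 5 r0.
(* The quintic in r has negative coefficients at r^3 and r^4. Subtracting r times this square leaves
   only nonnegative ones. *)
have := mulr_ge0 r0 (sqr_ge0 (37 / 100 * r ^+ 2 - 15 / 100 * r - 9 / 10)).
clear -r0 r2 r3 r4 r5; lra.
Qed.

Lemma bernoulli_ge (z : R) t : 0 <= z -> 1 + t%:R * z <= (1 + z) ^+ t.
Proof.
move=> z0; elim: t => [|t IH]; first by rewrite mul0r addr0.
rewrite exprS -(natr1 t); apply: (@le_trans _ _ ((1 + z) * (1 + t%:R * z))).
  have t0 : 0 <= t%:R :> R by [].
  have := mulr_ge0 t0 (sqr_ge0 z); lra.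
by apply: ler_wpM2l => //; lra.
Qed.

(** This is what makes the urn weight [o (m - t)] nonnegative. Bounding y^t below by Bernoulli's
    inequality leaves a polynomial inequality, which has nonnegative coefficients in t - 1 and m -
    t. *)
Lemma wtail_le m t x y k v : (0 < t <= m)%N -> 0 < x -> x < y -> x * y = 1 ->
  k = x + y - 2 -> 1 <= v -> k * (m%:R + 1) ^+ 2 <= 121 / 100 ->
  (2 * m%:R + 3) * x <= 2 * m%:R + 1 ->
  2 * wtail m x y v t <= (m%:R - t%:R + 1) * y ^+ t * (m%:R + t%:R) * (m%:R + t%:R - 1).
Proof.
move=> /andP[t0 tm] x0 xy xy1 kE v1 kw xb.
pose M : R := m%:R; pose w := (M + 1) ^+ 2; pose T : R := t%:R.
have M0 : 0 <= M by [].
have w0 : 0 < w by rewrite /w exprn_gt0 //; lra.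
have T1 : 1 <= T by rewrite (ler_nat _ 1).
have TM : T <= M by rewrite ler_nat.
have k0 : 0 <= k.
  have h : x * k = (x - 1) ^+ 2 by rewrite kE; ring: xy1.
  by rewrite -(pmulr_rge0 _ x0) h sqr_ge0.
have km : k * m%:R ^+ 2 <= 121 / 100.
  apply: le_trans kw; apply: ler_wpM2l => //.
  by rewrite lerXn2r ?nnegrE //; rewrite -/M; lra.
have kw' : k <= 121 / 100 / w by rewrite ler_pdivlMr.
have up : wtail m x y v t <= 3 * M / 10 + 121 / 100 / w *
    (78 / 100 * (M * (S3 M - S3 T) + (S4 M - S4 T)) + 1 / 3 * (M * (S1 M - S1 T) + (S2 M - S2 T))).
  rewrite /wtail -(sum_weighted _ _ tm) mulr_sumr lerD2l.
  apply: ler_sum_nat => s /andP[_ sm]; rewrite mulrCA.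
  apply: ler_wpM2l; first exact: addr_ge0.
  apply: le_trans (gap_le x0 xy xy1 kE v1 km (ltnW sm)) _.
  rewrite [X in k * (_ + X)]mulrC [X in k * (_ + X)](_ : _ = 1 / 3 * s%:R); last by rewrite mul1r.
  by apply: ler_wpM2r => //; nneg.
have yt : (2 * M + 1 + 2 * T) / (2 * M + 1) <= y ^+ t.
  have y1 : 1 + 2 / (2 * M + 1) <= y.
    rewrite -(ler_pM2l x0) xy1 -(ler_pM2r (_ : 0 < 2 * M + 1)); last by lra.
    rewrite [leLHS](_ : _ = (2 * M + 3) * x); last by field; apply/lt0r_neq0; lra.
    by rewrite mul1r.
  have z0 : 0 <= 2 / (2 * M + 1) by apply: divr_ge0; lra.
  apply: (@le_trans _ _ ((1 + 2 / (2 * M + 1)) ^+ t)).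
    apply: le_trans (bernoulli_ge t z0); rewrite -/T le_eqVlt; apply/orP; left; apply/eqP.
    by field; apply/lt0r_neq0; lra.
  by rewrite lerXn2r ?nnegrE //; lra.
apply: (@le_trans _ _ ((M - T + 1) * ((2 * M + 1 + 2 * T) / (2 * M + 1)) * (M + T) * (M + T -
  1))); last first.
  rewrite -/M -/T; do 2 (apply: ler_wpM2r; first by lra).
  by apply: ler_wpM2l => //; lra.
move: up; move: (wtail m x y v t) => Z up.
apply: (le_trans (ler_wpM2l _ up)); first by lra.
have q0 : 0 < 2 * M + 1 by lra.
have wq0 : 0 < w * (2 * M + 1) by exact: mulr_gt0.
rewrite -subr_ge0 -(pmulr_lge0 _ wq0).
rewrite [leRHS](_ : _ = (M + 1) ^+ 2 * ((M - T + 1) * (2 * M + 1 + 2 * T) * (M + T) * (M + T - 1)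
    - 6 / 10 * M * (2 * M + 1)) - 242 / 100 * (2 * M + 1) *
    (78 / 100 * (M * (S3 M - S3 T) + (S4 M - S4 T)) + 1 / 3 * (M * (S1 M - S1 T) + (S2 M - S2
      T)))); last first.
  by rewrite -/w; field; apply/andP; split; exact: lt0r_neq0.
clear -T1 TM; rewrite /S1 /S2 /S3 /S4.
have -> : M = 1 + (T - 1) + (M - T) by ring.
have -> : T = 1 + (T - 1) by ring.
have : 0 <= T - 1 by lra.
have : 0 <= M - T by lra.
rewrite (_ : 1 + (1 + (T - 1) - 1) = 1 + (T - 1)); last by ring.
rewrite (_ : M - (1 + (T - 1)) = M - T); last by ring.
move: (M - T) (T - 1) => r a r0 a0; clear -r0 a0.
have mon i j : 0 <= a ^+ i * r ^+ j by apply: mulr_ge0; exact: exprn_ge0.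
have m01 := mon 0%N 1%N. have m02 := mon 0%N 2%N. have m03 := mon 0%N 3%N.
have m04 := mon 0%N 4%N. have m05 := mon 0%N 5%N. have m06 := mon 0%N 6%N.
have m10 := mon 1%N 0%N. have m11 := mon 1%N 1%N. have m12 := mon 1%N 2%N.
have m13 := mon 1%N 3%N. have m14 := mon 1%N 4%N. have m15 := mon 1%N 5%N.
have m20 := mon 2%N 0%N. have m21 := mon 2%N 1%N. have m22 := mon 2%N 2%N.
have m23 := mon 2%N 3%N. have m24 := mon 2%N 4%N. have m30 := mon 3%N 0%N.
have m31 := mon 3%N 1%N. have m32 := mon 3%N 2%N. have m33 := mon 3%N 3%N.
have m40 := mon 4%N 0%N. have m41 := mon 4%N 1%N. have m42 := mon 4%N 2%N.
have m50 := mon 5%N 0%N. have m51 := mon 5%N 1%N.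
clear mon; lra.
Qed.
End WeightTail.

(** Counts the subsets of size i + q + 1 of i + d + 1 points by the position i + j of their element
    number i + 1. *)
Lemma sum_bin_bin d i q :
  (\sum_(j < d.+1) 'C(i + j, i) * 'C(d - j, q) = 'C(i + d.+1, i + q.+1))%N.
Proof.
elim: d q => [|d IH] q.
  rewrite big_ord1 addn0 binn mul1n subn0 addn1; case: q => [|q].
    by rewrite addn1 !binn.
  by rewrite [RHS]bin_small //; lia.
rewrite big_ord_recr /= subnn.
case: q => [|q].
  rewrite bin0 muln1 (eq_bigr (fun j : 'I_d.+1 => 'C(i + j, i) * 'C(d - j, 0)))%N.
    by rewrite IH !addn1 !addnS -binS.
  by move=> j _; rewrite !bin0.
rewrite bin0n muln0 addn0.
under eq_bigr => j _ do rewrite subSn ?leq_ord // binS mulnDr.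
by rewrite big_split /= !IH !addnS -binS.
Qed.

(** * Measures on triples with a fixed sum *)

Section TriangularMeasures.
Variables (R : realFieldType) (n : nat).
Implicit Types (F : nat -> nat -> R) (f g : nat -> R).

(* F i j is the mass of the triple (i, j, n - i - j). *)
Definition marginal_sum F i : R :=
  \sum_(j < (n - i).+1) (F i j + F j i + F j (n - i - j)%N).

(** Only the sum of the three marginals is prescribed: adding up the cyclic rotations of F later
    turns this sum into each single marginal. *)
Definition representable f := exists2 F, (forall i j, 0 <= F i j) &
  forall i, (i <= n)%N -> marginal_sum F i = f i.

Lemma representableD f g : representable f -> representable g ->
  representable (fun i => f i + g i).
Proof.
move=> [F F0 Ff] [G G0 Gg]; exists (fun i j => F i j + G i j).
  by move=> i j; exact: addr_ge0.
move=> i ni; rewrite -Ff // -Gg // -big_split /=; apply: eq_bigr => j _; ring.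
Qed.

Lemma representableZ a f : 0 <= a -> representable f -> representable (fun i => a * f i).
Proof.
move=> a0 [F F0 Ff]; exists (fun i j => a * F i j).
  by move=> i j; exact: mulr_ge0.
move=> i ni; rewrite -Ff // mulr_sumr; apply: eq_bigr => j _; ring.
Qed.

Lemma representable0 : representable (fun=> 0).
Proof. by exists (fun _ _ => 0) => // i _; rewrite /marginal_sum big1 // => j _; rewrite
  !addr0. Qed.

Lemma representable_eq f g : (forall i, (i <= n)%N -> f i = g i) ->
  representable f -> representable g.
Proof. by move=> fg [F F0 Ff]; exists F => // i ni; rewrite Ff ?fg. Qed.

Lemma representable_sum N (a : 'I_N -> R) (f : 'I_N -> nat -> R) :
  (forall k, 0 <= a k) -> (forall k, representable (f k)) ->
  representable (fun i => \sum_k a k * f k i).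
Proof.
elim: N a f => [|N IH] a f a0 fr.
  by apply: representable_eq representable0 => i _; rewrite big_ord0.
have := representableD (representableZ (a0 ord0) (fr ord0))
  (IH (fun k => a (lift ord0 k)) (fun k => f (lift ord0 k)) (fun k => a0 _) (fun k => fr _)).
by apply: representable_eq => i _; rewrite big_ord_recl.
Qed.

Let sum_delta N s : \sum_(j < N) (val j == s)%:R = (s < N)%:R :> R.
Proof.
have [sN|sN] := ltnP s N; last by rewrite big1 // => j _; rewrite ltn_eqF // (leq_trans
  (ltn_ord j)).
rewrite (bigD1 (Ordinal sN)) //= eqxx big1 ?addr0 // => j.
by rewrite -val_eqE /= => /negPf->.
Qed.

(** Unit mass on every triple with first part s; each of the other two parts is then uniform on
    0..n-s. *)
Lemma representable_star s : (s <= n)%N ->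
  representable (fun i => (n - i).+1%:R * (i == s)%:R + 2 * (i <= n - s)%:R).
Proof.
move=> sn; exists (fun i _ => (i == s)%:R) => // i ni.
rewrite /marginal_sum !big_split /= sumr_const card_ord !sum_delta -mulr_natl -addrA.
have -> : (s < (n - i).+1)%N = (i <= n - s)%N by lia.
ring.
Qed.

(* The Polya-urn triples: given the size of the third part, the first part is
   hypergeometric; each of the three coordinates is then uniform. *)
Lemma representable_urn K : (K <= n)%N ->
  representable (fun i => n.+1%:R^-1 + (i <= K)%:R / K.+1%:R + (i <= n - K)%:R / (n - K).+1%:R).
Proof.
move=> Kn.
pose B i j := ((i <= K) * ('C(i + j, i) * 'C(n - i - j, K - i)))%N.
pose A : R := ((n.+1 * 'C(n, K))%:R)^-1.
have first_marginal L i : (i <= n)%N ->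
  (\sum_(j < (n - i).+1) (i <= L) * ('C(i + j, i) * 'C(n - i - j, L - i)) = (i <= L) * 'C(n.+1,
    L.+1))%N.
  move=> ni; case: leqP => iL; last by rewrite big1.
  under eq_bigr do rewrite mul1n.
  by rewrite sum_bin_bin mul1n; congr 'C(_, _); lia.
have e1 i : (i <= n)%N -> (\sum_(j < (n - i).+1) B i j = (i <= K) * 'C(n.+1, K.+1))%N.
  exact: first_marginal.
have e2 i : (i <= n)%N -> (\sum_(j < (n - i).+1) B j i = (i <= n - K) * 'C(n.+1, (n - K).+1))%N.
  move=> ni; rewrite -first_marginal //; apply: eq_bigr => j _; rewrite /B.
  have jn : (j <= n - i)%N by rewrite -ltnS.
  have [iK|iK] := leqP i (n - K); last first.
    have [jK|//] := leqP j K.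
    by rewrite (bin_small (_ : n - j - i < K - j)%N) ?muln0 //; lia.
  have [jK|jK] := leqP j K; last by rewrite (bin_small (_ : n - i - j < n - K - i)%N) ?muln0
    //; lia.
  rewrite !mul1n addnC -(bin_sub (leq_addl _ _)) addnK; congr (_ * _)%N.
  rewrite -[in RHS]bin_sub; last by lia.
  by congr 'C(_, _); lia.
have e3 i : (i <= n)%N -> (\sum_(j < (n - i).+1) B j (n - i - j) = 'C(n, K))%N.
  move=> ni; rewrite -[in RHS](subnK ni) -binomial.Vandermonde.
  rewrite -(big_mkord xpredT (fun j => B j (n - i - j))%N) -(big_mkord xpredT (fun j => 'C(n -
    i, j) * 'C(i, K - j)))%N.
  have BE j : (j <= n - i)%N -> B j (n - i - j)%N = ((j <= K) * ('C(n - i, j) * 'C(i, K - j)))%N.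
    by move=> jn; rewrite /B subnKC //; do 4 f_equal; lia.
  have -> : (\sum_(0 <= j < (n - i).+1) B j (n - i - j) = \sum_(0 <= j < n.+1) (j <= K) * ('C(n
    - i, j) * 'C(i, K - j)))%N.
    rewrite [RHS](@big_cat_nat _ _ _ (n - i).+1) //=; last by lia.
    rewrite [X in (_ + X)%N]big_nat_cond [X in (_ + X)%N]big1 ?addn0; last first.
      by move=> j /andP[/andP[h _] _]; rewrite bin_small ?muln0.
    by apply: eq_big_nat => j /andP[_ jn]; exact: BE.
  rewrite (@big_cat_nat _ _ _ K.+1) //=.
  rewrite [X in (_ + X)%N]big_nat_cond [X in (_ + X)%N]big1 ?addn0; last first.
    by move=> j /andP[/andP[h _] _]; rewrite leqNgt h.
  by apply: eq_big_nat => j /andP[_ jn]; rewrite -ltnS jn mul1n.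
exists (fun i j => A * (B i j)%:R) => [i j|i ni].
  by rewrite mulr_ge0 // invr_ge0.
rewrite /marginal_sum.
under eq_bigr do rewrite -!mulrDr -!natrD.
rewrite -mulr_sumr -natr_sum !big_split /= e1 // e2 // e3 // !natrD !natrM.
have C0 L : (L <= n)%N -> ('C(n, L))%:R != 0 :> R by move=> Ln; rewrite pnatr_eq0 -lt0n bin_gt0.
have c1 : ('C(n.+1, K.+1))%:R = n.+1%:R * 'C(n, K)%:R / K.+1%:R :> R.
  by rewrite -natrM mul_bin_diag natrM mulrAC mulfV ?mul1r // pnatr_eq0.
have c2 : ('C(n.+1, (n - K).+1))%:R = n.+1%:R * 'C(n, K)%:R / (n - K).+1%:R :> R.
  by rewrite -(bin_sub Kn) -natrM mul_bin_diag natrM mulrAC mulfV ?mul1r // pnatr_eq0.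
rewrite c1 c2 /A natrM; field.
by rewrite C0 // !nat1r !pnatr_eq0.
Qed.

(** On every triple the three values 3 i - n add up to 0, because the parts add up to n. *)
Lemma representable_mean f : representable f ->
  \sum_(i < n.+1) (3 * i%:R - n%:R) * f i = 0.
Proof.
move=> [F _ Ff].
pose T (G : nat -> nat -> R) := \sum_(i < n.+1) \sum_(j < (n - i).+1) G i j.
have TE G : T G = \sum_(i < n.+1) \sum_(j < n.+1 | (i + j <= n)%N) G i j.
  apply: eq_bigr => i _; rewrite (big_ord_widen_cond n.+1 xpredT (G i)) ?ltnS ?leq_subr //.
  by apply: eq_bigl => j /=; rewrite ltnS; have := ltn_ord i; lia.
have Tswap G : T G = T (fun i j => G j i).
  rewrite !TE (exchange_big_dep xpredT) //=; apply: eq_bigr => i _.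
  by apply: eq_bigl => j; rewrite addnC.
have Trev G : T G = T (fun i j => G i (n - i - j)%N).
  apply: eq_bigr => i _; rewrite (reindex_inj rev_ord_inj) /=.
  by apply: eq_bigr => j _; rewrite subSS.
rewrite (_ : \sum_(i < n.+1) _ = T (fun i j => (3 * i%:R - n%:R) * F i j)
  + T (fun i j => (3 * i%:R - n%:R) * F j i) + T (fun i j => (3 * i%:R - n%:R) * F j (n - i -
    j)%N)); last first.
  rewrite -!big_split /=; apply: eq_bigr => i _.
  by rewrite -Ff ?leq_ord // mulr_sumr -!big_split /=; apply: eq_bigr => j _; rewrite !mulrDr.
rewrite [X in _ + X + _]Tswap [X in _ + _ + X]Tswap [X in _ + _ + X]Trev.
rewrite -!big_split /=; apply: big1 => i _; rewrite -!big_split /=; apply: big1 => j _.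
have ni : (i <= n)%N by rewrite -ltnS.
have jn : (j <= n - i)%N by rewrite -ltnS.
have -> : (n - (n - i - j) - i = j)%N by lia.
rewrite !natrB //; ring.
Qed.

End TriangularMeasures.

Lemma sum_mul_delta (R : pzRingType) N (a : nat -> R) i : (i < N)%N ->
  \sum_(k < N) a k * (val k == i)%:R = a i.
Proof.
move=> iN; rewrite (bigD1 (Ordinal iN)) //= eqxx mulr1 big1 ?addr0 // => j.
by rewrite -val_eqE /= => /negPf->; rewrite mulr0.
Qed.

(* The weights om and nu are chosen so that consecutive differences of the
   marginal sum agree with those of the geometric weights; the additive constant
   that remains vanishes because both sides have mean n/3. *)
Lemma geometric_representable (R : rcfType) m : (0 < m)%N ->
  exists2 x : R, 0 < x < 1 & representable m.*2 (fun i => x ^+ i).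
Proof.
move=> m0.
have [x [y [k [v [[x0 xy xy1 kE] [vE v1 v2] [kw vk xb] fx]]]]] := critical_point R m0.
pose n := m.*2; pose M : R := m%:R.
have nE : n%:R = 2 * M by rewrite /n -mul2n natrM.
have M1 : 1 <= M by rewrite (ler_nat _ 1).
have x1 : x < 1.
  have q : 0 < 2 * M + 3 by lra.
  by rewrite -(ltr_pM2l q) mulr1; apply: (le_lt_trans xb); rewrite -/M; lra.
have y0 : 0 < y by exact: lt_trans xy.
exists x; first by rewrite x0.
pose c := (1 - x) * x ^+ m.
have c0 : 0 < c by rewrite mulr_gt0 ?exprn_gt0 // subr_gt0.
have cxD t : x ^+ (m + t) * (1 - x) = c * x ^+ t by rewrite exprD /c; ring.
have cxB t : (t <= m)%N -> x ^+ (m - t) * (1 - x) = c * y ^+ t.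
  move=> tm; rewrite /c -{2}(subnK tm) exprD -mulrA -mulrA -exprMn xy1 expr1n mulr1.
  by rewrite mulrC.
pose Z t := wtail m x y v t.
have Z0 t : (0 < t <= m)%N -> 0 <= Z t.
  by move=> tm; apply: (wtail_ge0 (k := k)); rewrite ?v1.
have Zle t : (0 < t <= m)%N -> 2 * Z t <= (M - t%:R + 1) * y ^+ t * (M + t%:R) * (M + t%:R - 1).
  by move=> tm; apply: (wtail_le (k := k)).
have ZS t : (0 < t < m)%N -> Z t = Z t.+1
   + (M + t%:R) * ((M + t%:R + 1) * x ^+ t - (M - t%:R + 1) * y ^+ t).
  move=> /andP[t0 tm]; rewrite /Z /wtail (big_ltn tm) -/M.
  rewrite (_ : gap x y v t = (M + t%:R + 1) * x ^+ t - (M - t%:R + 1) * y ^+ t); first by ring.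
  rewrite /gap /usum /csum /sdiff vE -/M; field.
  by rewrite subr_eq0 gt_eqF.
clear vE v1 v2 kw vk xb kE.
(* The denominator is the integrating factor that turns the difference equation at i = m + t into
   [Z t - Z t.+1] = (m + t) * gap. *)
pose nu r : R := if (m < r)%N then c * Z (r - m)%N / (r%:R * (r%:R - 1) * (n%:R - r%:R + 1)) else 0.
pose lam i := i.+1%:R * (x ^+ i * (1 - x)).
(* Urns with parameters q and n - q agree, so the weights [om] are taken symmetric. Given nu, the
   difference equations at i <= m determine them; those at i > m are left to determine nu. *)
pose o i := if (i < m)%N then lam i - 2 * i.+1%:R * nu (n - i)%N else lam m + (M + 1) * M * nu m.+1.
pose om i := o (minn i (n - i)).
have nuD t : (0 < t)%N -> nu (m + t)%N = c * Z t / ((M + t%:R) * (M + t%:R - 1) * (M - t%:R + 1)).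
  move=> t0; rewrite /nu ifT; last by rewrite -addn1 leq_add2l.
  rewrite addKn natrD -/M nE; congr (_ / _); ring.
have nu0 r : (r <= m)%N -> nu r = 0 by rewrite /nu ltnNge => ->.
have den t : (0 < t <= m)%N -> 0 < (M + t%:R) * (M + t%:R - 1) * (M - t%:R + 1).
  move=> /andP[t0 tm]; have T1 : 1 <= t%:R :> R by rewrite (ler_nat _ 1).
  have TM : t%:R <= M by rewrite ler_nat.
  by rewrite !mulr_gt0 //; lra.
have nu_ge0 r : (r <= n)%N -> 0 <= nu r.
  move=> rn; have [/nu0->//|mr] := leqP r m.
  have h : (0 < r - m <= m)%N by rewrite /n in rn; lia.
  rewrite -(subnKC (ltnW mr)) nuD; last by lia.
  apply: divr_ge0; last exact: ltW (den _ h).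
  by apply: mulr_ge0; [exact: ltW | exact: Z0].
have lam0 i : 0 <= lam i by rewrite /lam !mulr_ge0 ?exprn_ge0 ?ltW // subr_gt0.
have lamB t : (t <= m)%N -> lam (m - t)%N = (M - t%:R + 1) * (c * y ^+ t).
  by move=> tm; rewrite /lam cxB // -(natr1 (m - t)) natrB.
have o_ge0 i : 0 <= o i.
  rewrite /o; case: ifP => [im|_].
    pose t := (m - i)%N.
    have ht : (0 < t <= m)%N by rewrite /t; lia.
    have -> : i = (m - t)%N by rewrite /t; lia.
    have -> : (n - (m - t) = m + t)%N by rewrite /n /t; lia.
    move: t ht => t ht; have /andP[t0 tm] := ht.
    rewrite lamB // nuD // -(natr1 (m - t)) natrB // -/M.
    have D := den _ ht; have := Zle _ ht => h.
    rewrite -(pmulr_rge0 _ D).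
    have DE : (M - t%:R + 1) != 0.
      by apply/lt0r_neq0; rewrite ltr_wpDl // subr_ge0 ler_nat.
    rewrite [leRHS](_ : _ = c * (M - t%:R + 1) * ((M - t%:R + 1) * y ^+ t * (M + t%:R) * (M +
      t%:R - 1) - 2 * Z t)).
      have TM : t%:R <= M by rewrite ler_nat.
      apply: mulr_ge0; last by lra.
      by apply: mulr_ge0; [exact: ltW | lra].
    by field; move: (lt0r_neq0 D); rewrite !mulf_eq0 !negb_or => /andP[/andP[-> ->] ->].
  apply: addr_ge0 => //; apply: mulr_ge0; last by apply: nu_ge0; rewrite /n; lia.
  by apply: mulr_ge0; lra.
pose urn q i : R := n.+1%:R^-1 + (i <= q)%:R / q.+1%:R + (i <= n - q)%:R / (n - q).+1%:R.
pose star r i : R := (n - i).+1%:R * (i == r)%:R + 2 * (i <= n - r)%:R.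
pose f i := \sum_(q < n.+1) om q / 2 * urn q i + \sum_(r < n.+1) nu r * star r i.
have f_rep : representable n f.
  apply: representableD; apply: (representable_sum (N := n.+1)) => q.
  - by apply: divr_ge0 => //; exact: o_ge0.
  - by apply: representable_urn; rewrite -ltnS.
  - by apply: nu_ge0; rewrite -ltnS.
  - by apply: representable_star; rewrite -ltnS.
have omC q : (q <= n)%N -> om (n - q)%N = om q.
  by move=> qn; rewrite /om subKn // minnC.
have fE i : f i = \sum_(q < n.+1) om q / 2 / n.+1%:R + \sum_(q < n.+1) om q / q.+1%:R * (i <= q)%:R
   + \sum_(r < n.+1) nu r * star r i.
  rewrite /f; congr (_ + _); rewrite /urn.
  have -> : \sum_(q < n.+1) om q / q.+1%:R * (i <= q)%:R = \sum_(q < n.+1) om q / 2 * ((i <=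
    q)%:R / q.+1%:R)
     + \sum_(q < n.+1) om q / 2 * ((i <= n - q)%:R / (n - q).+1%:R).
    rewrite [X in _ = _ + X](reindex_inj rev_ord_inj) /= -big_split /=.
    apply: eq_bigr => q _; have qn : (q <= n)%N by rewrite -ltnS.
    by rewrite !subSS omC // subKn //; field; rewrite nat1r pnatr_eq0.
  by rewrite -!big_split /=; apply: eq_bigr => q _; rewrite !mulrDr addrA.
have fS i : (i < n)%N -> f i - f i.+1
   = om i / i.+1%:R + (n - i).+1%:R * nu i - (n - i)%:R * nu i.+1 + 2 * nu (n - i)%N.
  move=> ni.
  have -> : om i / i.+1%:R = \sum_(q < n.+1) om q / q.+1%:R * (i <= q)%:R - \sum_(q < n.+1) om
    q / q.+1%:R * (i.+1 <= q)%:R.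
    rewrite -sumrB -(@sum_mul_delta _ n.+1 (fun q => om q / q.+1%:R)); last by lia.
    apply: eq_bigr => q _; rewrite -mulrBr; congr (_ * _).
    by case: ltngtP => _ /=; rewrite ?subrr ?subr0.
  rewrite !fE.
  have starE j : (j <= n)%N -> \sum_(r < n.+1) nu r * star r j = (n - j).+1%:R * nu j + 2 *
    \sum_(r < n.+1) nu r * (j <= n - r)%:R.
    move=> jn; rewrite -(@sum_mul_delta _ n.+1 nu j) // !mulr_sumr -big_split /=.
    by apply: eq_bigr => r _; rewrite /star eq_sym; ring.
  rewrite !starE //; last exact: ltnW.
  have -> : nu (n - i)%N = \sum_(r < n.+1) nu r * (i <= n - r)%:R - \sum_(r < n.+1) nu r *
    (i.+1 <= n - r)%:R.
    rewrite -sumrB -(@sum_mul_delta _ n.+1 nu (n - i)%N); last by rewrite ltnS leq_subr.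
    apply: eq_bigr => r _; rewrite -mulrBr; congr (_ * _).
    have -> : (val r == n - i)%N = (i == n - r)%N by move: (ltn_ord r) ni; rewrite /=; clear; lia.
    by case: ltngtP => _ /=; rewrite ?subrr ?subr0.
  by rewrite subnSK //; ring.
have fgeo i : (i < n)%N -> f i - f i.+1 = x ^+ i - x ^+ i.+1.
  move=> ni; rewrite fS // /om.
  have -> : x ^+ i - x ^+ i.+1 = x ^+ i * (1 - x) by rewrite exprSr; ring.
  have iR : i.+1%:R != 0 :> R by rewrite pnatr_eq0.
  have [im|mi|->] := ltngtP i m.
  - have -> : minn i (n - i) = i by rewrite /n; lia.
    rewrite /o im (nu0 i) ?(ltnW im) // (nu0 i.+1) // /lam.
    by field; rewrite nat1r.
  - pose t := (i - m)%N.
    have ht : (0 < t < m)%N by rewrite /n in ni; rewrite /t; lia.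
    have -> : minn i (n - i) = (m - t)%N by rewrite /n /t; lia.
    rewrite /o ifT; last by lia.
    have -> : i = (m + t)%N by rewrite /t; lia.
    have -> : (n - (m - t) = m + t)%N by rewrite /n; lia.
    have -> : (n - (m + t) = m - t)%N by rewrite /n; lia.
    move: t ht => t ht; have /andP[t0 tm] := ht.
    rewrite (nu0 (m - t)%N) ?leq_subr // -addnS !nuD // lamB ?(ltnW tm) // cxD ZS //.
    have D1 := den t; rewrite t0 (ltnW tm) in D1; have {}D1 := lt0r_neq0 (D1 isT).
    have D2 := den t.+1; rewrite tm in D2; have {}D2 := lt0r_neq0 (D2 isT).
    move: D1 D2; rewrite -(natr1 (m - t)) natrB ?(ltnW tm) // natrD -/M -(natr1 t).
    rewrite !mulf_eq0 !negb_or => /andP[/andP[d1 d2] d3] /andP[/andP[d4 d5] d6].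
    field.
    by rewrite -/M d2 d3 d4 d5 d6.
  - have -> : minn m (n - m) = m by rewrite /n; lia.
    have -> : (n - m = m)%N by rewrite /n; lia.
    rewrite /o ltnn (nu0 m) // /lam -(natr1 m) -/M.
    by field; apply/lt0r_neq0; lra.
have fc i : (i <= n)%N -> f i = x ^+ i + (f 0%N - 1).
  elim: i => [|i IH] ni; first by rewrite expr0; ring.
  by have := fgeo i ni; rewrite IH ?(ltnW ni) // => h; rewrite -[LHS](subKr (f i)) IH ?(ltnW
    ni) //; lra.
have := representable_mean f_rep.
rewrite (eq_bigr (fun i : 'I_n.+1 => (3 * i%:R - n%:R) * x ^+ i + (3 * i%:R - n%:R) * (f 0%N -
  1))); last first.
  by move=> i _; rewrite fc ?leq_ord // mulrDr.
rewrite big_split /= -mulr_suml.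
have -> : \sum_(i < n.+1) (3 * i%:R - n%:R) * x ^+ i = 0 :> R.
  by rewrite -[RHS]fx /mean_defect -/n nE.
have -> : \sum_(i < n.+1) (3 * i%:R - n%:R) = n%:R * (n%:R + 1) / 2 :> R.
  rewrite sumrB -mulr_sumr sumr_const card_ord -[n%:R *+ n.+1]mulr_natr -(natr1 n).
  have -> : \sum_(i < n.+1) i%:R = n%:R * (n%:R + 1) / 2 :> R.
    elim: (n) => [|j IH]; first by rewrite big_ord1 !mul0r.
    by rewrite big_ord_recr /= IH -(natr1 j); field.
  by field.
rewrite add0r => /eqP; rewrite mulf_eq0 => /orP[/eqP h|/eqP h].
  by move: h; rewrite nE => h; nra.
by apply: representable_eq f_rep => i ni; rewrite fc // h addr0.
Qed.

Lemma prime_geometric_representable (R : rcfType) p : prime p ->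
  exists2 x : R, 0 < x < 1 & representable p.-1 (fun i => x ^+ i).
Proof.
move=> pp; have [p2|/(odd_prime_gt2)] := even_prime pp.
  (* Mass 1/2 on the triple (1, 0, 0) has marginal sums 1 and 1/2. *)
  subst p; exists 2^-1; first by lra.
  exists (fun i j => ((i == 1%N) && (j == 0%N))%:R / 2) => [i j|].
    by apply: divr_ge0.
  move=> [|[|//]] _; rewrite /marginal_sum !big_ord_recl big_ord0 /=; last by rewrite expr1; lra.
  by rewrite expr0; lra.
move=> /(_ pp) p2; have po : odd p by case: (even_prime pp) p2 => [->|].
have -> : p.-1 = (p.-1./2).*2.
  by rewrite -[LHS]odd_double_half; case: p pp p2 po => [//|p] /= _ _ /negbTE ->.
by apply: geometric_representable; case: p p2 {pp po} => [|[|[|p]]].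
Qed.

Lemma symmetric_geometric_measure (R : rcfType) p : prime p ->
  exists (x : R) (W : 'I_p -> 'I_p -> 'I_p -> R),
  [/\ 0 < x < 1, forall i j k, 0 <= W i j k,
      forall i j k, W i j k != 0 -> (i + j + k = p.-1)%N &
      [/\ forall i, \sum_j \sum_k W i j k = x ^+ i,
          forall i, \sum_j \sum_k W j i k = x ^+ i &
          forall i, \sum_j \sum_k W j k i = x ^+ i]].
Proof.
move=> pp; have [x x01 [F F0 Fx]] := prime_geometric_representable R pp.
case: p pp Fx => [//|n] _ /= Fx.
pose G (i j k : 'I_n.+1) := (i + j + k == n)%N%:R * F i j.
(* Summing over rotations makes each marginal of W the sum of the three marginals of F. *)
pose W i j k := G i j k + G j k i + G k i j.
have Wcyc i j k : W i j k = W j k i by rewrite /W; ring.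
have delta (i j : 'I_n.+1) : \sum_(k < n.+1) (i + j + k == n)%N%:R = (i + j <= n)%N%:R :> R.
  have [ijn|ijn] := leqP.
    have kn : (n - (i + j) < n.+1)%N by rewrite ltnS leq_subr.
    rewrite (bigD1 (Ordinal kn)) //= subnKC // eqxx big1 ?addr0 // => k.
    by rewrite -val_eqE /= => h; rewrite (_ : _ == _ = false) //; lia.
  by rewrite big1 // => k _; rewrite (_ : _ == _ = false) //; lia.
have widen (i : 'I_n.+1) (H : nat -> R) : \sum_(j < n.+1) (i + j <= n)%N%:R * H j = \sum_(j <
  (n - i).+1) H j.
  rewrite (big_ord_widen n.+1 H) ?ltnS ?leq_subr // [RHS]big_mkcond /=; apply: eq_bigr => j _.
  have -> : (j < (n - i).+1)%N = (i + j <= n)%N by have := ltn_ord i; lia.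
  by case: ifP; rewrite ?mul1r ?mul0r.
have W1 i : \sum_j \sum_k W i j k = x ^+ i.
  rewrite -Fx ?leq_ord // /marginal_sum !big_split /=.
  have -> : \sum_j \sum_k W i j k = \sum_j \sum_k G i j k + \sum_j \sum_k G j k i + \sum_j
    \sum_k G k i j.
    by rewrite -!big_split; apply: eq_bigr => j _; rewrite -!big_split.
  rewrite [X in _ + _ + X]exchange_big /= addrAC.
  have /= h2 := widen i (fun j => F j i).
  have /= h3 := widen i (fun j => F j (n - i - j)%N).
  rewrite -(widen i (F i)) -h2 -h3; congr (_ + _ + _); apply: eq_bigr => j _.
  - by rewrite -mulr_suml delta.
  - have [ijn|ijn] := leqP.
      have kn : (n - i - j < n.+1)%N by rewrite ltnS -subnDA leq_subr.
      rewrite (bigD1 (Ordinal kn)) //= big1 ?addr0.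
        by rewrite /G /= (_ : _ == _ = true) //; lia.
      move=> k; rewrite -val_eqE /= => h; rewrite /G (_ : _ == _ = false) ?mul0r //; lia.
    by rewrite mul0r big1 // => k _; rewrite /G (_ : _ == _ = false) ?mul0r //; lia.
  - by rewrite -mulr_suml delta addnC.
exists x, W; split=> //.
- by move=> i j k; rewrite /W /G !addr_ge0 ?mulr_ge0.
- move=> i j k W0; apply/eqP; apply: contraNT W0 => /negbTE h; rewrite /W /G h.
  have -> : (j + k + i == n)%N = false by rewrite -h; congr (_ == _); lia.
  have -> : (k + i + j == n)%N = false by rewrite -h; congr (_ == _); lia.
  by rewrite !mul0r !addr0.
split=> // i; rewrite -W1.
  by rewrite exchange_big /=; apply: eq_bigr => j _; apply: eq_bigr => k _; rewrite -Wcyc.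
by apply: eq_bigr => j _; apply: eq_bigr => k _; rewrite Wcyc Wcyc -Wcyc.
Qed.

(** * Large tricoloured sum-free sets *)

Lemma exists_ge_average (I : finType) (A : {set I}) (f : I -> nat) : (0 < #|A|)%N ->
  exists2 i, i \in A & (\sum_(j in A) f j <= #|A| * f i)%N.
Proof.
case/card_gt0P => x0 x0A; have [i iA imax] := @arg_maxnP I x0 (mem A) f x0A.
by exists i => //; rewrite -sum_nat_const; apply: leq_sum => j jA; exact: imax.
Qed.

Definition meets (U : eqType) (e e' : U * U * U) :=
  [|| e'.1.1 == e.1.1, e'.1.2 == e.1.2 | e'.2 == e.2].

(** * Isolated edges under a random restriction *)

Section Isolated.
Variables (Om U : finType) (O : {set Om}) (E : {set U * U * U}).
Variables (alive : Om -> U * U * U -> bool) (r a K : nat).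

Definition isolated w := [set e in E | alive w e &
  [forall e' in E, (e' != e) && meets e e' ==> ~~ alive w e']].

(** The mixed triple meets each of t, u and v, so if it is an alive edge, isolation forces it to
    equal all three. *)
Lemma isolated_induced w t u v :
  t \in isolated w -> u \in isolated w -> v \in isolated w ->
  (t.1.1, u.1.2, v.2) \in E -> alive w (t.1.1, u.1.2, v.2) -> t = u /\ u = v.
Proof.
rewrite !inE.
move=> /and3P[tE ta /forall_inP ti] /and3P[uE ua /forall_inP ui] /and3P[vE va /forall_inP vi] eE al.
have eq_of s : (forall e', e' \in E -> (e' != s) && meets s e' ==> ~~ alive w e') ->
    meets s (t.1.1, u.1.2, v.2) -> (t.1.1, u.1.2, v.2) = s.
  move=> si sh; apply/eqP; have := si _ eE; rewrite al implybF sh andbT.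
  by rewrite negbK.
have <- := eq_of t ti; last by rewrite /meets eqxx.
have <- := eq_of u ui; last by rewrite /meets eqxx orbT.
by have <- := eq_of v vi; last by rewrite /meets eqxx !orbT.
Qed.

Hypotheses (O_gt0 : (0 < #|O|)%N) (K_gt0 : (0 < K)%N) (r_le : (6 * r <= K)%N).
Hypotheses (deg1 : forall u, (#|[set e in E | e.1.1 == u]| <= r)%N)
  (deg2 : forall u, (#|[set e in E | e.1.2 == u]| <= r)%N)
  (deg3 : forall u, (#|[set e in E | e.2 == u]| <= r)%N).
Hypothesis alive_ge : forall e, e \in E -> (a <= #|[set w in O | alive w e]|)%N.
Hypothesis alive2_le : forall e e', e \in E -> e' \in E -> e' != e -> meets e e' ->
  (#|[set w in O | alive w e && alive w e']| * K <= a)%N.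

Let card_meets e : (#|[set e' in E | meets e e']| <= 3 * r)%N.
Proof.
apply: (@leq_trans #|[set e' in E | e'.1.1 == e.1.1] :|: [set e' in E | e'.1.2 == e.1.2]
   :|: [set e' in E | e'.2 == e.2]|).
  by apply: subset_leq_card; apply/subsetP => e'; rewrite !inE /meets => /andP[-> /or3P[]->];
    rewrite ?orbT.
apply: leq_trans (leq_card_setU _ _) _.
rewrite (_ : 3 * r = r + r + r)%N; last by lia.
apply: leq_add => //; apply: leq_trans (leq_card_setU _ _) _; exact: leq_add.
Qed.

(* First moment minus the expected number of surviving pairs that meet. *)
Lemma exists_isolated : exists2 w, w \in O & (#|E| * a <= 2 * #|O| * #|isolated w|)%N.
Proof.
have [w wO wmax] := exists_ge_average (fun w => #|isolated w|) O_gt0.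
exists w => //.
have low : (#|E| * a <= \sum_(w in O) \sum_(e in E) alive w e)%N.
  rewrite exchange_big /= -sum_nat_const; apply: leq_sum => e eE.
  by apply: leq_trans (alive_ge eE) _; rewrite -sum1dep_card big_mkcondr.
pose both w := (\sum_(e in E) \sum_(e' in E | (e' != e) && meets e e') (alive w e && alive w e'))%N.
have split_alive w' : (\sum_(e in E) alive w' e <= #|isolated w'| + both w')%N.
  rewrite -sum1dep_card big_mkcondr /= -big_split /=; apply: leq_sum => e eE.
  have [ae|//] := boolP (alive w' e).
  have [//|] := boolP [forall e' in E, (e' != e) && meets e e' ==> ~~ alive w' e'].
  rewrite negb_forall_in => /exists_inP[e' e'E]; rewrite negb_imply negbK => /andP[m ae'].
  by rewrite /= add0n (bigD1 e') ?e'E //= ae' leq_addr.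
(* An edge meets at most 3 r others, each alive together with it for at most a / K outcomes. As 6 r
   <= K, the total loss is at most half of #|E| * a. *)
have up : (K * \sum_(w in O) both w <= #|E| * (3 * r * a))%N.
  rewrite /both exchange_big /= big_distrr /= -sum_nat_const; apply: leq_sum => e eE.
  rewrite exchange_big /= big_distrr /=.
  apply: (@leq_trans (\sum_(e' in E | (e' != e) && meets e e') a)%N).
    apply: leq_sum => e' /and3P[e'E ne m]; rewrite mulnC.
    apply: leq_trans (alive2_le eE e'E ne m); rewrite leq_mul2r; apply/orP; right.
    by rewrite -sum1dep_card [X in (_ <= X)%N]big_mkcondr.
  rewrite sum_nat_const leq_mul2r; apply/orP; right.
  apply: leq_trans (card_meets e); apply: subset_leq_card.
  by apply/subsetP => e'; rewrite !inE => /and3P[-> _ ->].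
have tot : (#|E| * a <= #|O| * #|isolated w| + \sum_(w in O) both w)%N.
  apply: (leq_trans low); apply: (@leq_trans (\sum_(w in O) (#|isolated w| + both w))%N).
    by apply: leq_sum => w' _; exact: split_alive.
  by rewrite big_split /= leq_add2r.
rewrite -(leq_pmul2r K_gt0).
move: tot up r_le; move: (\sum_(w in O) both w)%N => b tot up rK.
move: (#|isolated w|) (#|O|) (#|E|) tot up => s Q e' tot up.
have h1 : (e' * (6 * r * a) <= e' * (K * a))%N.
  by rewrite leq_mul2l; apply/orP; right; rewrite leq_mul2r rK orbT.
have h2 : (K * (e' * a) <= K * (Q * s + b))%N by rewrite leq_mul2l tot orbT.
clear -up h1 h2; nia.
Qed.

End Isolated.

(** The fibres are translates of each other by multiples of a one-sided inverse of w, so they all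
    have the same size. *)
Lemma card_mulmx_fiber (F : finFieldType) m n k (w : 'M[F]_(m, n)) (u : 'M[F]_(m, k)) :
  row_free w -> (#|[set M : 'M[F]_(n, k) | w *m M == u]| * #|F| ^ (m * k) = #|F| ^ (n * k))%N.
Proof.
move=> wf; pose fib u := [set M : 'M[F]_(n, k) | w *m M == u].
have fibE u1 u2 : (#|fib u1| <= #|fib u2|)%N.
  pose tr (M : 'M[F]_(n, k)) := M + pinvmx w *m (u2 - u1).
  have tr_inj : injective tr by move=> M N /addIr.
  rewrite -(card_imset _ tr_inj); apply: subset_leq_card; apply/subsetP => _ /imsetP[M + ->].
  rewrite !inE => /eqP Mu; rewrite /tr mulmxDr mulmxA mulmxVp // mul1mx Mu.
  by rewrite addrC subrK.
have -> : (#|F| ^ (n * k))%N = (\sum_(u' : 'M[F]_(m, k)) #|fib u'|)%N.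
  rewrite -card_mx -cardsT -sum1_card (partition_big (fun M : 'M_(n, k) => w *m M) xpredT) //=.
  by apply: eq_bigr => u' _; rewrite sum1dep_card /fib; apply: eq_card => M; rewrite !inE.
rewrite (eq_bigr (fun=> #|fib u|)) => [|u' _].
  by rewrite sum_nat_const card_mx mulnC.
by apply/eqP; rewrite eqn_leq !fibE.
Qed.

(** * Hashing into a set without midpoints *)

Section Hashing.
Variables (q D k r : nat) (U : finType) (E : {set U * U * U}).
Variables (ia ib ic : U -> 'rV['F_q]_D) (B : {set 'rV['F_q]_k}).
Hypotheses (q_prime : prime q) (q_gt2 : (2 < q)%N).
Hypotheses (ia_inj : injective ia) (ib_inj : injective ib) (ic_inj : injective ic).
Hypothesis sumE : forall e, e \in E -> ia e.1.1 + ib e.1.2 + ic e.2 = 0.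
Hypotheses (deg_a : forall u, (#|[set e in E | e.1.1 == u]| <= r)%N)
  (deg_b : forall u, (#|[set e in E | e.1.2 == u]| <= r)%N)
  (deg_c : forall u, (#|[set e in E | e.2 == u]| <= r)%N).
Hypothesis apB : forall b b' c, b \in B -> b' \in B -> c \in B ->
  b + b' = c + c -> b = c /\ b' = c.
Hypothesis r_le : (6 * r <= q ^ k)%N.

Let Om : finType := ('M['F_q]_(D, k) * 'rV['F_q]_k * 'rV['F_q]_k)%type.
(** On an edge fa + fb = 2 fc, because the three embedded vertices add up to 0. Three hashes in B
    therefore coincide. *)
Let fa (w : Om) u := ia u *m w.1.1 + w.1.2.
Let fb (w : Om) u := ib u *m w.1.1 + w.2.
Let fc (w : Om) u := 2^-1 *: (w.1.2 + w.2 - ic u *m w.1.1).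
Let alive w (e : U * U * U) := [&& fa w e.1.1 \in B, fb w e.1.2 \in B & fc w e.2 \in B].
Let two0 : 2 != 0 :> 'F_q.
Proof.
rewrite -(dvdn_pcharf (pchar_Fp q_prime)).
by apply/negP => /dvdn_leq h; move: (h isT); rewrite leqNgt q_gt2.
Qed.

Let halve (a b : 'rV['F_q]_k) : a + b = 2^-1 *: (a + b) + 2^-1 *: (a + b).
Proof. by rewrite -scalerDl -mulr2n -[_ *+ 2]mulr_natl mulfV ?scale1r. Qed.

Let aliveP w e : e \in E -> alive w e ->
  [/\ fa w e.1.1 \in B, fb w e.1.2 = fa w e.1.1 & fc w e.2 = fa w e.1.1].
Proof.
move=> eE /and3P[ea eb ec].
have h : fa w e.1.1 + fb w e.1.2 = fc w e.2 + fc w e.2.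
  rewrite /fc -halve /fa /fb.
  have -> : ic e.2 = - (ia e.1.1 + ib e.1.2) by apply/eqP; rewrite -addr_eq0 addrC sumE.
  rewrite mulNmx opprK mulmxDl; set s := _ *m _; set t := _ *m _.
  by rewrite addrACA addrC.
by have [-> ->] := apB ea eb ec h.
Qed.

Let card_alive e : e \in E -> (#|B| * q ^ (D * k) <= #|[set w | alive w e]|)%N.
Proof.
move=> eE.
pose f (z : 'rV['F_q]_k * 'M['F_q]_(D, k)) : Om :=
  (z.2, z.1 - ia e.1.1 *m z.2, z.1 - ib e.1.2 *m z.2).
have f_inj : injective f by move=> [b M] [b' M'] [] /= -> /addIr->.
have <- : (#|setX B [set: 'M['F_q]_(D, k)]| = #|B| * q ^ (D * k))%N.
  by rewrite cardsX cardsT card_mx card_Fp.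
rewrite -(card_imset _ f_inj); apply: subset_leq_card; apply/subsetP => _ /imsetP[[b M] + ->].
rewrite !inE andbT /= => bB; rewrite /alive /fa /fb /fc /= !(addrC (_ *m _)) !subrK bB /=.
have -> : ic e.2 = - (ia e.1.1 + ib e.1.2) by apply/eqP; rewrite -addr_eq0 addrC sumE.
rewrite mulNmx opprK mulmxDl addrACA !subrK.
by rewrite scalerDr -scalerDl -mulr2n -[_ *+ 2]mulr_natl mulfV ?scale1r.
Qed.

(** If both edges are alive, the shared vertex makes all six hashes equal. The matrix then kills a
    nonzero difference of embedded vertices, which costs a factor q^k. *)
Let card_alive2 e e' : e \in E -> e' \in E -> e' != e -> meets e e' ->
  (#|[set w | alive w e && alive w e']| * q ^ k <= #|B| * q ^ (D * k))%N.
Proof.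
move=> eE e'E ne sh.
have [v [v0 hv]] : exists v : 'rV['F_q]_D, v != 0 /\
    forall w, alive w e -> alive w e' -> v *m w.1.1 = 0.
  have main w : alive w e -> alive w e' -> (ia e.1.1 - ia e'.1.1) *m w.1.1 = 0 /\
     (ib e.1.2 - ib e'.1.2) *m w.1.1 = 0.
    move=> /(aliveP eE)[_ e1 e2] /(aliveP e'E)[_ e1' e2'].
    have ee : fa w e.1.1 = fa w e'.1.1.
      case/or3P: sh => /eqP h; first by rewrite h.
        by rewrite -e1 -e1' h.
      by rewrite -e2 -e2' h.
    split; rewrite mulmxBl; apply/eqP; rewrite subr_eq0; apply/eqP.
      exact: (addIr w.1.2).
    by apply: (addIr w.2); rewrite -/(fb w _) e1 ee -e1'.
  have [ea|ea] := eqVneq (ia e.1.1) (ia e'.1.1); last first.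
    by exists (ia e.1.1 - ia e'.1.1); rewrite subr_eq0; split=> // w h1 h2; case: (main w h1 h2).
  exists (ib e.1.2 - ib e'.1.2); split; last by move=> w h1 h2; case: (main w h1 h2).
  rewrite subr_eq0; apply: contra ne => /eqP eb.
  have ec : ic e.2 = ic e'.2.
    by have := sumE eE; rewrite ea eb -(sumE e'E) => /addrI.
  move: ea eb ec => /ia_inj + /ib_inj + /ic_inj.
  by case: (e) (e') => [[? ?] ?] [[? ?] ?] /= -> -> ->.
pose g (w : Om) := (fa w e.1.1, w.1.1).
have g_inj : {in [set w | alive w e && alive w e'] &, injective g}.
  move=> w w'; rewrite !inE => /andP[h _] /andP[h' _].
  have [_ b1 _] := aliveP eE h; have [_ b2 _] := aliveP eE h'.
  move=> [e1 e2]; have e3 : fb w e.1.2 = fb w' e.1.2 by rewrite b1 b2.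
  move: e1 e3 e2; rewrite /fa /fb; case: (w) (w') => [[M s] t] [[M' s'] t'] /= h1 h3 h2.
  by move: h1 h3; rewrite h2 => /(addrI _) -> /(addrI _) ->.
rewrite -(card_in_imset g_inj).
apply: (@leq_trans (#|setX B [set M : 'M['F_q]_(D, k) | v *m M == 0]| * q ^ k)).
  rewrite leq_mul2r; apply/orP; right; apply: subset_leq_card; apply/subsetP => _ /imsetP[w + ->].
  rewrite !inE => /andP[h h']; rewrite /= hv // eqxx andbT.
  by case: (aliveP eE h).
rewrite cardsX -mulnA leq_mul2l; apply/orP; right.
have := @card_mulmx_fiber 'F_q 1 D k v 0; rewrite mul1n card_Fp // => -> //.
by rewrite /row_free rank_rV v0.
Qed.

(** Being alive is a condition on each vertex separately, so every mixed triple of surviving edges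
    is alive and [isolated_induced] applies. *)
Lemma hashed_isolated_edges : exists S : {set U * U * U}, [/\ S \subset E,
  forall t u v, t \in S -> u \in S -> v \in S -> (t.1.1, u.1.2, v.2) \in E ->
    t = u /\ u = v
  & (#|E| * #|B| <= 2 * q ^ (2 * k) * #|S|)%N].
Proof.
have [||||||||w _ hw] := @exists_isolated Om U setT E alive r (#|B| * q ^ (D * k)) (q ^ k) => //.
- by apply/card_gt0P; exists (0, 0, 0); rewrite inE.
- by rewrite expn_gt0 prime_gt0.
- move=> e eE; apply: leq_trans (card_alive eE) _.
  by apply: subset_leq_card; apply/subsetP => w; rewrite !inE.
- move=> e e' eE e'E ne m; apply: leq_trans (card_alive2 eE e'E ne m).
  rewrite leq_mul2r; apply/orP; right.
  by apply: subset_leq_card; apply/subsetP => w; rewrite !inE.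
exists (isolated E alive w); split.
- by apply/subsetP => e; rewrite inE => /andP[].
- move=> t u v tS uS vS eE; apply: (isolated_induced tS uS vS eE).
  move: tS uS vS; rewrite !inE => /and3P[_ /and3P[ta _ _] _] /and3P[_ /and3P[_ ua _] _]
    /and3P[_ /and3P[_ _ va] _].
  exact/and3P.
have N0 : (0 < q ^ (D * k))%N by rewrite expn_gt0 prime_gt0.
rewrite -(leq_pmul2r N0) -mulnA; apply: (leq_trans hw).
have OmE : #|{: Om}| = (q ^ (D * k) * q ^ (2 * k))%N.
  by rewrite /Om !card_prod !card_mx card_Fp // !mul1n -mulnA -expnD addnn mul2n.
rewrite cardsT OmE.
by rewrite leq_eqVlt; apply/orP; left; apply/eqP; clear; lia.
Qed.

End Hashing.

Lemma natr_Fp_inj q (a b : nat) : prime q -> (a < q)%N -> (b < q)%N ->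
  a%:R = b%:R :> 'F_q -> a = b.
Proof.
move=> qp aq bq /(congr1 val) /=.
by rewrite !val_Fp_nat // !modn_small.
Qed.

Lemma midpoint_leqif (a b c : nat) : (a + b = c + c)%N ->
  (2 * c ^ 2 <= a ^ 2 + b ^ 2 ?= iff (a == b))%N.
Proof.
wlog ab : a b / (a <= b)%N.
  move=> H e; have [|/ltnW] := leqP a b; first by move=> /H; exact.
  by move=> /H h; rewrite eq_sym [X in leqif _ X _]addnC; apply: h; rewrite addnC.
move=> e; have [d [-> ->]] : exists d, b = (a + 2 * d)%N /\ c = (a + d)%N.
  by exists (c - a)%N; lia.
split; first by nia.
by apply/eqP/eqP => h; nia.
Qed.

(* Behrend's construction: vectors with digits below q/2 add without carries, and
   a sphere contains no midpoint of two of its points. *)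
Lemma exists_midpoint_free q k : prime q -> (2 < q)%N ->
  exists B : {set 'rV['F_q]_k},
    (forall b b' c, b \in B -> b' \in B -> c \in B -> b + b' = c + c -> b = c /\ b' = c) /\
    (q ^ k <= 2 ^ k * (#|B| * (k * q ^ 2).+1))%N.
Proof.
move=> qp q2; pose h := (q./2).+1.
have q0 : (0 < q)%N by exact: prime_gt0.
have hq (i : 'I_h) : (i + i < q)%N.
  have qo : odd q by case: (even_prime qp) q2 => [->|].
  by have := ltn_ord i; have := odd_double_half q; rewrite qo /h; lia.
have hq2 (i j : 'I_h) : (i + j < q)%N by move: (hq i) (hq j); clear; lia.
pose N (f : {ffun 'I_k -> 'I_h}) := (\sum_i f i ^ 2)%N.
have Nle f : (N f < (k * q ^ 2).+1)%N.
  rewrite ltnS; apply: (@leq_trans (\sum_(i < k) q ^ 2)%N); last by rewrite sum_nat_const card_ord.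
  by apply: leq_sum => i _; rewrite leq_exp2r //; have := hq (f i); lia.
have [s hs] : exists s : 'I_(k * q ^ 2).+1, (h ^ k <= (k * q ^ 2).+1 * #|[set f | N f == s]|)%N.
  have [|s _ hs] := @exists_ge_average 'I_(k * q ^ 2).+1 setT (fun s => #|[set f | N f == s]|).
    by rewrite cardsT card_ord.
  exists s; rewrite cardsT card_ord (eq_bigl xpredT) in hs; last by move=> j; rewrite inE.
  apply: leq_trans hs.
  rewrite -[in X in (X ^ _)%N](card_ord h) -[k in (_ ^ k)%N]card_ord -card_ffun -cardsT -sum1_card.
  rewrite (partition_big (fun f => Ordinal (Nle f)) xpredT) //=; apply: leq_sum => j _.
  by rewrite sum1dep_card; apply: subset_leq_card; apply/subsetP => f; rewrite !inE -val_eqE.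
pose row (f : {ffun 'I_k -> 'I_h}) : 'rV['F_q]_k := \row_i (f i)%:R.
have row_inj : injective row.
  move=> f g /matrixP fg; apply/ffunP => i; apply: val_inj; have := fg 0 i; rewrite !mxE.
  by apply: natr_Fp_inj => //; [have := hq (f i) | have := hq (g i)]; lia.
exists [set row f | f in [set f | N f == s]]; split; last first.
  rewrite card_imset // (mulnC #|_|); apply: (@leq_trans (2 ^ k * h ^ k)); last by rewrite
    leq_mul2l hs orbT.
  have h2 : (q <= 2 * h)%N by have := odd_double_half q; rewrite /h; case: odd => /=; lia.
  by rewrite -expnMn; case: (k) => [|k'] //; rewrite leq_exp2r.
move=> _ _ _ /imsetP[f + ->] /imsetP[f' + ->] /imsetP[g + ->].
rewrite !inE => /eqP Nf /eqP Nf' /eqP Ng /matrixP e.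
have e2 i : (f i + f' i = g i + g i)%N.
  have := e 0 i; rewrite !mxE -!natrD; by apply: natr_Fp_inj => //; exact: hq2.
(* The inequality 2 g^2 <= f^2 + f'^2 holds in each coordinate. On a sphere the sums agree, so every
   coordinate is an equality case. *)
have := @leqif_sum 'I_k xpredT (fun i => f i == f' i) (fun i => 2 * g i ^ 2)%N
  (fun i => f i ^ 2 + f' i ^ 2)%N.
case.
  by move=> i _; have := midpoint_leqif (e2 i); rewrite -val_eqE.
move=> _; rewrite [X in X == _](_ : _ = 2 * N g)%N; last by rewrite big_distrr.
rewrite [X in _ == X](_ : _ = N f + N f')%N; last by rewrite -big_split.
rewrite Nf Nf' Ng mul2n addnn eqxx.
move=> /esym/forallP ff; have {}ff : f = f' by apply/ffunP => i; apply/eqP; have := ff i.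
subst f'; have -> : g = f by apply/ffunP => i; apply: val_inj; apply: double_inj; rewrite
  -!addnn e2.
by [].
Qed.

(** * Types of digit vectors and regularity *)

Section Types.
Variables (d p : nat).
Let P := 'I_p.
Let T := {ffun 'I_d -> P}.
Implicit Types (x y z : T) (s : {perm 'I_d}).

(** The counts live in a finite type, so that a pigeonhole over the at most (d + 1)^p types is
    possible. *)
Definition type_of x : {ffun 'I_p -> 'I_d.+1} :=
  [ffun i => inord #|[set l | x l == i]|].

Definition ffun_perm s x : T := [ffun l => x (s l)].

Lemma ffun_perm_inj s : injective (ffun_perm s).
Proof.
move=> x y /ffunP e; apply/ffunP => l; have := e (s^-1%g l).
by rewrite !ffunE permKV.
Qed.

Lemma type_of_perm s x : type_of (ffun_perm s x) = type_of x.
Proof.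
apply/ffunP => i; rewrite !ffunE; congr inord.
rewrite -[RHS](card_preimset _ (@perm_inj _ s)).
by apply: eq_card => l; rewrite !inE ffunE.
Qed.

Lemma eq_type_perm x y : type_of x = type_of y -> exists s, y = ffun_perm s x.
Proof.
move=> /ffunP e.
have cnt (z : T) i : count_mem i [tuple z l | l < d] = #|[set l | z l == i]|.
  rewrite /= count_map -size_filter cardE; apply/perm_size/uniq_perm.
  - by rewrite filter_uniq // enum_uniq.
  - exact: enum_uniq.
  - by move=> l; rewrite mem_filter !mem_enum !inE /= andbT.
have : perm_eq [tuple y l | l < d] [tuple x l | l < d].
  apply/allP => i _ /=; rewrite !cnt; have /(congr1 val) := e i.
  have lt_d (z : T) : (#|[set l | z l == i]| < d.+1)%N.
    by rewrite ltnS -[X in (_ <= X)%N](card_ord d) max_card.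
  by rewrite !ffunE /= !inordK // => ->.
case/tuple_permP => s hs; exists s; apply/ffunP => l; rewrite ffunE.
have /(congr1 (fun t => tnth t l)) := val_inj hs.
by rewrite !tnth_mktuple.
Qed.

Lemma type_of_sum x y : type_of x = type_of y -> (\sum_l x l = \sum_l y l)%N.
Proof.
case/eq_type_perm => s ->; rewrite (reindex_inj (@perm_inj _ s)) /=.
by apply: eq_bigr => l _; rewrite ffunE.
Qed.

Definition edges (X Y Z : {set T}) : {set T * T * T} :=
  [set e | [&& e.1.1 \in X, e.1.2 \in Y, e.2 \in Z
     & [forall l, (e.1.1 l + e.1.2 l + e.2 l == p.-1)%N]]].

Let shift s (e : T * T * T) := (ffun_perm s e.1.1, ffun_perm s e.1.2, ffun_perm s e.2).

(** Coordinate permutations preserve the edge set and act transitively on the vectors of a given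
    type. *)
Lemma edges_regular (pr : T * T * T -> T) tx ty tz a b :
  let E := edges [set x | type_of x == tx] [set x | type_of x == ty] [set x | type_of x == tz] in
  (forall s e, pr (shift s e) = ffun_perm s (pr e)) ->
  type_of a = type_of b ->
  (#|[set e in E | pr e == a]| <= #|[set e in E | pr e == b]|)%N.
Proof.
move=> E prs /eq_type_perm[s ->].
have shift_inj : injective (shift s).
  by move=> [[x y] z] [[x' y'] z'] [] /ffun_perm_inj -> /ffun_perm_inj -> /ffun_perm_inj ->.
rewrite -(card_imset _ shift_inj); apply: subset_leq_card; apply/subsetP => _ /imsetP[e + ->].
rewrite !inE prs => /andP[/and4P[/eqP h1 /eqP h2 /eqP h3 /forallP h4] /eqP ->].
rewrite /= !type_of_perm h1 h2 h3 !eqxx /= andbT.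
by apply/forallP => l; rewrite !ffunE.
Qed.

Lemma edges_regular_card (pr : T * T * T -> T) tx ty tz (tp : {ffun 'I_p -> 'I_d.+1}) a :
  let E := edges [set x | type_of x == tx] [set x | type_of x == ty] [set x | type_of x == tz] in
  (forall s e, pr (shift s e) = ffun_perm s (pr e)) ->
  (forall e, e \in E -> type_of (pr e) = tp) -> type_of a = tp ->
  (#|[set e in E | pr e == a]| * #|[set x | type_of x == tp]| = #|E|)%N.
Proof.
move=> E prs prE ap.
rewrite -[RHS]sum1_card (partition_big pr (mem [set x | type_of x == tp])) /=; last first.
  by move=> e /prE; rewrite inE => ->.
rewrite (eq_bigr (fun=> #|[set e in E | pr e == a]|)); first by rewrite sum_nat_const mulnC.
move=> x; rewrite inE => /eqP xp; rewrite sum1dep_card.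
apply/eqP; rewrite eqn_leq /E -![in X in (_ <= X)%N]/E.
by apply/andP; split; apply: edges_regular; rewrite ?ap ?xp.
Qed.

End Types.

Lemma exists_real_average (R : realDomainType) (I : finType) (f : I -> R) (x0 : I) :
  exists i : I, \sum_j f j <= #|I|%:R * f i.
Proof.
pose i := [arg max_(i > x0) f i]%O; exists i.
have imax j : f j <= f i by rewrite /i; case: arg_maxP => // i' _; exact.
rewrite mulr_natl -sumr_const; exact: ler_sum.
Qed.

(** * Product measures and a heavy triple of types *)

Section WeightedTypes.
Variables (R : realFieldType) (d p : nat) (rho : R) (W : 'I_p * 'I_p * 'I_p -> R).
Hypotheses (rho_gt0 : 0 < rho) (W0 : forall e, 0 <= W e).
Let T := {ffun 'I_d -> 'I_p}.
Let TT := {ffun 'I_d -> 'I_p * 'I_p * 'I_p}.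

Let weight (t : TT) : R := \prod_l W (t l).
Let proj (pr : 'I_p * 'I_p * 'I_p -> 'I_p) (t : TT) : T := [ffun l => pr (t l)].

Let weight_fiber (pr : 'I_p * 'I_p * 'I_p -> 'I_p) (x : T) : (forall i : 'I_p, \sum_(e | pr e
  == i) W e = rho ^+ i) ->
  \sum_(t | proj pr t == x) weight t = rho ^+ (\sum_l x l).
Proof.
move=> prW; rewrite expr_sum.
rewrite (eq_bigr (fun l => \sum_e if pr e == x l then W e else 0)); last first.
  by move=> l _; rewrite -prW big_mkcond.
rewrite (bigA_distr_bigA (fun l e => if pr e == x l then W e else 0)) /= big_mkcond.
apply: eq_bigr => t _; case: eqP => [<-|/eqP tx].
  by apply: eq_bigr => l _; rewrite ffunE eqxx.
have /existsP[l hl] : [exists l, pr (t l) != x l].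
  rewrite -negb_forall; apply: contra tx => /forallP h; apply/eqP/ffunP => l.
  by rewrite ffunE; apply/eqP.
by rewrite (bigD1 l) //= (negbTE hl) mul0r.
Qed.

Let weight_type (pr : 'I_p * 'I_p * 'I_p -> 'I_p) (x0 : T) : (forall i : 'I_p, \sum_(e | pr e
  == i) W e = rho ^+ i) ->
  \sum_(t | type_of (proj pr t) == type_of x0) weight t
  = #|[set x | type_of x == type_of x0]|%:R * rho ^+ (\sum_l x0 l).
Proof.
move=> prW; rewrite (partition_big (proj pr) (fun x => type_of x == type_of x0)) //=.
rewrite mulr_natl -sumr_const [RHS](eq_bigl (fun x => type_of x == type_of x0)); last by move=>
  x; rewrite inE.
apply: eq_bigr => x /eqP xt; rewrite -(type_of_sum xt) -(weight_fiber _ prW).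
by apply: eq_bigl => t; case: (proj pr t =P x) => [->|]; rewrite ?andbF // xt eqxx.
Qed.

(* Pigeonhole over types replaces an entropy estimate: the weight of a class is at
   most the weight of its projection to each coordinate. *)
Lemma exists_heavy_type : (0 < p)%N ->
  (forall e, W e != 0 -> (e.1.1 + e.1.2 + e.2 = p.-1)%N) ->
  (forall i : 'I_p, \sum_(e | e.1.1 == i) W e = rho ^+ i) ->
  (forall i : 'I_p, \sum_(e | e.1.2 == i) W e = rho ^+ i) ->
  (forall i : 'I_p, \sum_(e | e.2 == i) W e = rho ^+ i) ->
  exists x y z : T, (forall l, x l + y l + z l = p.-1)%N /\
    (\sum_(i < p) rho ^+ i) ^+ (3 * d) <=
     (d.+1 ^ (9 * p))%:R * (#|[set u | type_of u == type_of x]|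
       * #|[set u | type_of u == type_of y]| * #|[set u | type_of u == type_of z]|)%:R
       * rho ^+ (d * p.-1).
Proof.
move=> p0 Wsum W1 W2 W3; pose G := \sum_(i < p) rho ^+ i.
have G0 : 0 < G.
  rewrite /G; case: (p) p0 => // p' _; rewrite big_ord_recl ltr_wpDr ?expr0 //.
  by apply: sumr_ge0 => i _; rewrite exprn_ge0 ?ltW.
pose TP := {ffun 'I_p -> 'I_d.+1}.
pose cls (t : TT) := (type_of (proj (fun e => e.1.1) t), type_of (proj (fun e => e.1.2) t),
  type_of (proj (fun e => e.2) t)).
have tot : \sum_t weight t = G ^+ d.
  have -> : G = \sum_e W e.
    by rewrite (partition_big (fun e => e.1.1) xpredT) //=; apply: eq_bigr => i _; rewrite -W1.
  rewrite -[X in _ = _ ^+ X](card_ord d) -prodr_const.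
  by rewrite (bigA_distr_bigA (fun _ e => W e)).
have [tau htau] : exists tau, G ^+ d <= #|{: TP * TP * TP}|%:R * \sum_(t | cls t == tau) weight t.
  rewrite -tot (partition_big cls xpredT) //.
  exact: exists_real_average ([ffun=> ord0], [ffun=> ord0], [ffun=> ord0]).
rewrite !card_prod card_ffun !card_ord in htau.
set S := \sum_(t | _) _ in htau.
have S0 : S != 0.
  apply/eqP => S0; move: htau; rewrite S0 mulr0 leNgt exprn_gt0 //.
have [t ht wt] : exists2 t, cls t == tau & weight t != 0.
  apply/exists_inP; apply: contraNT S0; rewrite negb_exists_in => /forall_inP h.
  by rewrite /S big1 // => t /h; rewrite negbK => /eqP.
pose x := proj (fun e => e.1.1) t; pose y := proj (fun e => e.1.2) t; pose z := proj (fun e =>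
  e.2) t.
have xyz l : (x l + y l + z l = p.-1)%N.
  rewrite !ffunE; apply: Wsum; move: wt; apply: contraNneq => h.
  by rewrite /weight (bigD1 l) //= h mul0r.
exists x, y, z; split=> //.
have tauE : tau = (type_of x, type_of y, type_of z) by rewrite -(eqP ht).
have wle (Q : pred TT) : (forall t, cls t == tau -> Q t) -> S <= \sum_(t | Q t) weight t.
  move=> clsQ; rewrite /S big_mkcond [leRHS]big_mkcond /=; apply: ler_sum => t' _.
  have w0 : 0 <= weight t' by apply: prodr_ge0.
  by case: ifP => [/clsQ ->//|_]; case: ifP.
have S1 : S <= #|[set u | type_of u == type_of x]|%:R * rho ^+ (\sum_l x l).
  by rewrite -(weight_type x W1); apply: wle => t'; rewrite tauE => /eqP[-> _ _].
have S2 : S <= #|[set u | type_of u == type_of y]|%:R * rho ^+ (\sum_l y l).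
  by rewrite -(weight_type y W2); apply: wle => t'; rewrite tauE => /eqP[_ -> _].
have S3 : S <= #|[set u | type_of u == type_of z]|%:R * rho ^+ (\sum_l z l).
  by rewrite -(weight_type z W3); apply: wle => t'; rewrite tauE => /eqP[_ _ ->].
have Sge : 0 <= S by apply: sumr_ge0 => t' _; apply: prodr_ge0.
have S3E : S ^+ 3 <= (#|[set u | type_of u == type_of x]|
       * #|[set u | type_of u == type_of y]| * #|[set u | type_of u == type_of z]|)%:R
       * rho ^+ (d * p.-1).
  have -> : (d * p.-1 = \sum_l x l + \sum_l y l + \sum_l z l)%N.
    by rewrite -!big_split /= (eq_bigr (fun=> p.-1)) ?sum_nat_const ?card_ord // => l _;
      rewrite xyz.
  rewrite !natrM !exprD (_ : _ * _ = (#|[set u | type_of u == type_of x]|%:R * rho ^+ (\sum_l x l))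
    * (#|[set u | type_of u == type_of y]|%:R * rho ^+ (\sum_l y l))
    * (#|[set u | type_of u == type_of z]|%:R * rho ^+ (\sum_l z l))); last by ring.
  rewrite -[S ^+ 3]/(S * (S * S)) mulrA.
  apply: ler_pM; rewrite ?mulr_ge0 //.
  exact: ler_pM.
rewrite mulnC exprM -/G.
(* The pigeonhole runs over (d + 1)^(3 p) triples of types, and cubing it gives the exponent 9 p. *)
apply: (@le_trans _ _ ((((d.+1 ^ p) * (d.+1 ^ p) * (d.+1 ^ p))%:R * S) ^+ 3)).
  by rewrite lerXn2r ?nnegrE ?exprn_ge0 ?mulr_ge0 // ltW.
rewrite exprMn -natrX -[leRHS]mulrA.
have -> : ((d.+1 ^ p * d.+1 ^ p * d.+1 ^ p) ^ 3 = d.+1 ^ (9 * p))%N.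
  by rewrite -!expnD -expnM; congr (_ ^ _)%N; clear; lia.
exact: ler_wpM2l.
Qed.
End WeightedTypes.

Definition sum_free3 p n (S : {set 'rV['F_p]_n * 'rV['F_p]_n * 'rV['F_p]_n}) :=
  (forall t, t \in S -> t.1.1 + t.1.2 + t.2 = 0) /\
  (forall t u v, t \in S -> u \in S -> v \in S -> t.1.1 + u.1.2 + v.2 = 0 ->
    t = u /\ u = v).

Lemma in_setX3 (V : finType) (A B C : {set V}) (w : V * V * V) :
  (w \in setX (setX A B) C) = [&& w.1.1 \in A, w.1.2 \in B & w.2 \in C].
Proof. by case: w => [[a b] c]; rewrite !in_setX andbA. Qed.

(** * Three blocks with rotated roles *)

Section RotatedBlocks.
Variables (d p : nat).
Hypothesis p_prime : prime p.
Let T := {ffun 'I_d -> 'I_p}.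
Let U := (T * T * T)%type.

(** The third vertex of an edge is shifted by -(p - 1), so that digits adding up to p - 1 become
    vectors adding up to 0. The ring is left open: 'F_q serves the hashing, 'F_p the resulting
    sum-free set. *)
Let row_of (R : pzRingType) (off : R) (f : T) : 'rV[R]_d := \row_l ((f l)%:R + off).
Let emb (R : pzRingType) (off : R) (u : U) : 'rV[R]_(d + d + d) :=
  row_mx (row_mx (row_of off u.1.1) (row_of off u.1.2)) (row_of off u.2).

Let emb_inj q (off : 'F_q) : prime q -> (p <= q)%N -> injective (emb off).
Proof.
move=> qp pq [[f1 f2] f3] [[g1 g2] g3] /eq_row_mx[/eq_row_mx[/= /matrixP h1 /matrixP h2]
  /matrixP h3].
have aux (f g : T) : row_of off f =2 row_of off g -> f = g.
  move=> h; apply/ffunP => l; apply: val_inj; have := h 0 l; rewrite !mxE => /addIr.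
  by apply: natr_Fp_inj => //; apply: leq_trans pq.
by rewrite (aux _ _ h1) (aux _ _ h2) (aux _ _ h3).
Qed.

Let sums (R : pzRingType) (f g h : T) := forall l, (f l + g l + h l)%:R = p.-1%:R :> R.

Let emb_sum (R : pzRingType) (a b c : U) :
  emb 0 a + emb 0 b + emb (- p.-1%:R) c = 0 :> 'rV[R]_(d + d + d) <->
  [/\ sums R a.1.1 b.1.1 c.1.1, sums R a.1.2 b.1.2 c.1.2 & sums R a.2 b.2 c.2].
Proof.
have aux (f g h : T) : row_of 0 f + row_of 0 g + row_of (- p.-1%:R) h = 0 :> 'rV[R]_d <-> sums
  R f g h.
  split=> [/matrixP e l|e].
    have := e 0 l; rewrite !mxE !addr0 addrA -!natrD => /eqP.
    by rewrite subr_eq0 => /eqP.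
  by apply/matrixP => i l; rewrite !mxE !addr0 addrA -!natrD e subrr.
rewrite /emb !add_row_mx; split=> [e|[/aux -> /aux -> /aux ->]]; last by rewrite !row_mx0.
move: e; rewrite -[RHS]row_mx0 -[X in _ = row_mx X _]row_mx0 => /eq_row_mx[/eq_row_mx[h1 h2] h3].
by split; apply/aux.
Qed.

Variables x y z : T.
Hypothesis xyz : forall l, (x l + y l + z l = p.-1)%N.
Let X := [set u : T | type_of u == type_of x].
Let Y := [set u : T | type_of u == type_of y].
Let Z := [set u : T | type_of u == type_of z].
Let E0 := edges X Y Z.

(* The types fix the total of x + y + z, so coordinatewise congruence to p - 1
   modulo p forces equality of integers. *)
Let sums_edge f g h : f \in X -> g \in Y -> h \in Z -> sums 'F_p f g h -> (f, g, h) \in E0.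
Proof.
move=> fX gY hZ e; rewrite inE fX gY hZ /=; apply/forallP => /= l0.
have le l : (p.-1 <= f l + g l + h l ?= iff (p.-1 == f l + g l + h l))%N.
  split=> //; have /(congr1 val) := e l; rewrite /= !val_Fp_nat //.
  rewrite [RHS]modn_small ?ltn_predL ?prime_gt0 // => <-; exact: leq_mod.
have := @leqif_sum 'I_d xpredT _ _ _ (fun l _ => le l).
move: fX gY hZ; rewrite !inE => /eqP/type_of_sum fX /eqP/type_of_sum gY /eqP/type_of_sum hZ.
have -> : (\sum_l (f l + g l + h l) = \sum_(l < d) p.-1)%N.
  rewrite !big_split /= fX gY hZ -!big_split /=.
  by apply: eq_bigr => l _; rewrite xyz.
by move=> [_]; rewrite eqxx => /esym/forallP/(_ l0) /eqP <-.
Qed.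

Let dX := #|[set e in E0 | e.1.1 == x]|.
Let dY := #|[set e in E0 | e.1.2 == y]|.
Let dZ := #|[set e in E0 | e.2 == z]|.

Let E0_types e : e \in E0 -> [/\ type_of e.1.1 = type_of x, type_of e.1.2 = type_of y & type_of
  e.2 = type_of z].
Proof. by rewrite !inE => /and4P[/eqP-> /eqP-> /eqP->]. Qed.

Let dXE : (dX * #|X| = #|E0|)%N.
Proof. by apply: edges_regular_card => // e /E0_types[]. Qed.
Let dYE : (dY * #|Y| = #|E0|)%N.
Proof. by apply: edges_regular_card => // e /E0_types[]. Qed.
Let dZE : (dZ * #|Z| = #|E0|)%N.
Proof. by apply: edges_regular_card => // e /E0_types[]. Qed.

Let degX a : (#|[set e in E0 | e.1.1 == a]| <= dX)%N.
Proof.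
have [ax|ax] := eqVneq (type_of a) (type_of x); first exact: edges_regular.
rewrite (_ : [set e in _ | _] = set0) ?cards0 //; apply/setP => e; rewrite in_set [RHS]inE.
by apply: contraNF ax => /andP[/E0_types[<- _ _] /eqP->].
Qed.
Let degY a : (#|[set e in E0 | e.1.2 == a]| <= dY)%N.
Proof.
have [ax|ax] := eqVneq (type_of a) (type_of y); first exact: edges_regular.
rewrite (_ : [set e in _ | _] = set0) ?cards0 //; apply/setP => e; rewrite in_set [RHS]inE.
by apply: contraNF ax => /andP[/E0_types[_ <- _] /eqP->].
Qed.
Let degZ a : (#|[set e in E0 | e.2 == a]| <= dZ)%N.
Proof.
have [ax|ax] := eqVneq (type_of a) (type_of z); first exact: edges_regular.
rewrite (_ : [set e in _ | _] = set0) ?cards0 //; apply/setP => e; rewrite in_set [RHS]inE.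
by apply: contraNF ax => /andP[/E0_types[_ _ <-] /eqP->].
Qed.

Let E0_inj12 (e e' : U) : e \in E0 -> e' \in E0 -> e.1.1 = e'.1.1 -> e.1.2 = e'.1.2 -> e = e'.
Proof.
case: e e' => [[f g] h] [[f' g'] h']; rewrite !inE /= => /and4P[_ _ _ /forallP h1] /and4P[_ _ _
  /forallP h2] ef eg.
subst f' g'; congr (_, _, _); apply/ffunP => l; apply: val_inj; apply/eqP.
by rewrite -(eqn_add2l (f l + g l)) (eqP (h1 l)) (eqP (h2 l)).
Qed.
Let E0_inj13 (e e' : U) : e \in E0 -> e' \in E0 -> e.1.1 = e'.1.1 -> e.2 = e'.2 -> e = e'.
Proof.
case: e e' => [[f g] h] [[f' g'] h']; rewrite !inE /= => /and4P[_ _ _ /forallP h1] /and4P[_ _ _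
  /forallP h2] ef eg.
subst f' h'; congr (_, _, _); apply/ffunP => l; apply: val_inj; apply/eqP.
by rewrite -(eqn_add2r (h l)) -(eqn_add2l (f l)) !addnA (eqP (h1 l)) (eqP (h2 l)).
Qed.

Let card_T : #|{: T}| = (p ^ d)%N. Proof. by rewrite card_ffun !card_ord. Qed.

Let card_le (f : U -> T) (D : {set U}) : {in D &, injective f} -> (#|D| <= p ^ d)%N.
Proof. by move=> /card_in_imset <-; rewrite -card_T max_card. Qed.

Let dX_le : (dX <= p ^ d)%N.
Proof.
apply: (@card_le (fun e => e.1.2)) => e e'.
rewrite in_set => /andP[eE /eqP e1]; rewrite in_set => /andP[e'E /eqP e'1]; apply: E0_inj12 => //.
by rewrite e1.
Qed.
Let dY_le : (dY <= p ^ d)%N.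
Proof.
apply: (@card_le (fun e => e.1.1)) => e e'.
rewrite in_set => /andP[eE /eqP e1]; rewrite in_set => /andP[e'E /eqP e'1] h; apply: E0_inj12 => //.
by rewrite e1.
Qed.
Let dZ_le : (dZ <= p ^ d)%N.
Proof.
apply: (@card_le (fun e => e.1.1)) => e e'.
rewrite in_set => /andP[eE /eqP e1]; rewrite in_set => /andP[e'E /eqP e'1] h; apply: E0_inj13 => //.
by rewrite e1.
Qed.

Let E0_gt0 : (0 < #|E0|)%N.
Proof.
apply/card_gt0P; exists (x, y, z); rewrite !inE !eqxx /=.
by apply/forallP => l; rewrite xyz.
Qed.

Let rot (w : U * U * U) : U * U * U :=
  ((w.1.1.1.1, w.1.2.1.2, w.2.2), (w.1.1.1.2, w.1.2.2, w.2.1.1), (w.1.1.2, w.1.2.1.1, w.2.1.2)).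

Let rot_inj : injective rot.
Proof.
by move=> [[[[a b] c] [[a' b'] c']] [[a'' b''] c'']] [[[[e f] g] [[e' f'] g']] [[e'' f''] g'']]
  [] -> -> -> -> -> -> -> -> ->.
Qed.

Let E := rot @: setX (setX E0 E0) E0.

Let degE (pr : U * U * U -> U) (A B C : {set U}) r :
  (#|A| * #|B| * #|C| <= r)%N -> forall u,
  (forall w, w.1.1 \in E0 -> w.1.2 \in E0 -> w.2 \in E0 -> pr (rot w) = u ->
     [&& w.1.1 \in A, w.1.2 \in B & w.2 \in C]) ->
  (#|[set e in E | pr e == u]| <= r)%N.
Proof.
move=> ABC u h; apply: leq_trans ABC.
rewrite -cardsX -cardsX -[X in (_ <= X)%N](card_imset _ rot_inj); apply: subset_leq_card.
apply/subsetP => e; rewrite in_set => /andP[/imsetP[w wE ->] /eqP pw].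
move: wE; rewrite in_setX3 => /and3P[w1 w2 w3].
by apply: imset_f; rewrite in_setX3; exact: h.
Qed.

(* Rotating the roles of X, Y, Z in three blocks gives all three vertex classes the
   same size |X||Y||Z|, whatever the sizes of the three types. *)
Lemma rotated_blocks : exists r : nat, [/\ (0 < r)%N, (r <= p ^ (3 * d))%N &
  forall q k (B : {set 'rV['F_q]_k}), prime q -> (2 < q)%N -> (p <= q)%N ->
    (forall b b' c, b \in B -> b' \in B -> c \in B -> b + b' = c + c -> b = c /\ b' = c) ->
    (6 * r <= q ^ k)%N ->
    exists S : {set 'rV['F_p]_(d + d + d) * 'rV['F_p]_(d + d + d) * 'rV['F_p]_(d + d + d)},
      sum_free3 S /\ (r * (#|X| * #|Y| * #|Z|) * #|B| <= 2 * q ^ (2 * k) * #|S|)%N].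
Proof.
exists (dX * dY * dZ)%N; split.
- have gX : (0 < dX)%N by move: E0_gt0; rewrite -dXE muln_gt0 => /andP[].
  have gY : (0 < dY)%N by move: E0_gt0; rewrite -dYE muln_gt0 => /andP[].
  have gZ : (0 < dZ)%N by move: E0_gt0; rewrite -dZE muln_gt0 => /andP[].
  by rewrite !muln_gt0 gX gY gZ.
- by rewrite (_ : 3 * d = d + d + d)%N ?expnD ?leq_mul //; lia.
move=> q k B qp q2 pq apB r_le.
have sumE (R : pzRingType) e : e \in E ->
    emb 0 e.1.1 + emb 0 e.1.2 + emb (- p.-1%:R) e.2 = 0 :> 'rV[R]_(d + d + d).
  case/imsetP => w + ->; rewrite in_setX3 => /and3P[w1 w2 w3]; apply/emb_sum.
  move: w1 w2 w3; rewrite !inE => /and4P[_ _ _ /forallP h1] /and4P[_ _ _ /forallP h2] /and4P[_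
    _ _ /forallP h3].
  split=> l /=; first by rewrite (eqP (h1 l)).
    by rewrite addnC addnA (eqP (h2 l)).
  by rewrite -addnA addnC (eqP (h3 l)).
have da u : (#|[set e in E | e.1.1 == u]| <= dX * dY * dZ)%N.
  apply: (@degE (fun e => e.1.1) [set e in E0 | e.1.1 == u.1.1] [set e in E0 | e.1.2 == u.1.2]
    [set e in E0 | e.2 == u.2]); first by rewrite !leq_mul.
  by move=> w w1 w2 w3 /= <-; apply/and3P; split; rewrite in_set ?w1 ?w2 ?w3 eqxx.
have db u : (#|[set e in E | e.1.2 == u]| <= dX * dY * dZ)%N.
  apply: (@degE (fun e => e.1.2) [set e in E0 | e.1.2 == u.1.1] [set e in E0 | e.2 == u.1.2]
    [set e in E0 | e.1.1 == u.2]); first by rewrite mulnC -[X in (_ <= X)%N]mulnA !leq_mul.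
  by move=> w w1 w2 w3 /= <-; apply/and3P; split; rewrite in_set ?w1 ?w2 ?w3 eqxx.
have dc u : (#|[set e in E | e.2 == u]| <= dX * dY * dZ)%N.
  apply: (@degE (fun e => e.2) [set e in E0 | e.2 == u.1.1] [set e in E0 | e.1.1 == u.1.2]
    [set e in E0 | e.1.2 == u.2]); first by rewrite [X in (_ <= X)%N]mulnC mulnA !leq_mul.
  by move=> w w1 w2 w3 /= <-; apply/and3P; split; rewrite in_set ?w1 ?w2 ?w3 eqxx.
have [S0 [S0E ind cardS]] := hashed_isolated_edges qp q2 (emb_inj qp pq) (emb_inj qp pq)
  (emb_inj qp pq) (sumE 'F_q) da db dc apB r_le.
pose phi (e : U * U * U) := (emb (0 : 'F_p) e.1.1, emb (0 : 'F_p) e.1.2, emb (- p.-1%:R : 'F_p)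
  e.2).
have phi_inj : injective phi.
  move=> [[a b] c] [[a' b'] c'] [] ha hb hc.
  by rewrite (emb_inj p_prime (leqnn p) ha) (emb_inj p_prime (leqnn p) hb) (emb_inj p_prime
    (leqnn p) hc).
exists (phi @: S0); split; last first.
  rewrite (card_imset _ phi_inj); apply: leq_trans cardS.
  rewrite leq_mul2r (card_imset _ rot_inj) !cardsX -{1}dXE -{1}dYE -dZE.
  apply/orP; right; rewrite leq_eqVlt; apply/orP; left; apply/eqP; clear; lia.
split=> [t /imsetP[e eS ->]|].
  exact: sumE (subsetP S0E _ eS).
move=> _ _ _ /imsetP[t tS ->] /imsetP[u uS ->] /imsetP[v vS ->] /= /emb_sum[s1 s2 s3].
(* A zero sum modulo p makes each block of the mixed triple an edge by [sums_edge], so the mixed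
   triple lies in E and isolation applies to it. *)
suff eE : (t.1.1, u.1.2, v.2) \in E by have [-> ->] := ind _ _ _ tS uS vS eE.
have /imsetP[a aE ta] := subsetP S0E _ tS; move: aE; rewrite in_setX3 => /and3P[a1 a2 a3].
have /imsetP[b bE ub] := subsetP S0E _ uS; move: bE; rewrite in_setX3 => /and3P[b1 b2 b3].
have /imsetP[c cE vc] := subsetP S0E _ vS; move: cE; rewrite in_setX3 => /and3P[c1 c2 c3].
apply/imsetP; exists ((t.1.1.1.1, u.1.2.1.1, v.2.1.1), (v.2.1.2, t.1.1.1.2, u.1.2.1.2),
   (u.1.2.2, v.2.2, t.1.1.2)); last by rewrite /rot /=; case: (t.1.1) (u.1.2) (v.2) => [[? ?]
     ?] [[? ?] ?] [[? ?] ?].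
have inX e : e \in E0 -> e.1.1 \in X by case/E0_types => h _ _; rewrite inE h.
have inY e : e \in E0 -> e.1.2 \in Y by case/E0_types => _ h _; rewrite inE h.
have inZ e : e \in E0 -> e.2 \in Z by case/E0_types => _ _ h; rewrite inE h.
rewrite in_setX3; apply/and3P; split.
- by apply: sums_edge => //; rewrite ?ta ?ub ?vc /=; [exact: inX | exact: inY | exact: inZ].
- apply: sums_edge; rewrite ?ta ?ub ?vc /=; [exact: inX | exact: inY | exact: inZ |].
  by move=> l; rewrite -(s2 l) ta ub vc /= -addnA addnC.
- apply: sums_edge; rewrite ?ta ?ub ?vc /=; [exact: inX | exact: inY | exact: inZ |].
  by move=> l; rewrite -(s3 l) ta ub vc /= addnC addnA.
Qed.

End RotatedBlocks.

(** * Asymptotic size of the sum-free sets *)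

Section Asymptotics.
Variable R : realType.

(** Bernoulli's inequality for the root of b of order m + 1 bounds b^d below by a multiple of (d +
    1)^(m + 1); the extra factor d + 1 beats the constant. *)
Lemma poly_le_geometric (b C : R) m : 1 < b -> exists d0, forall d, (d0 <= d)%N ->
  C * d.+1%:R ^+ m <= b ^+ d.
Proof.
move=> b1; pose c := b `^ (m.+1%:R^-1).
have b0 : 0 <= b by lra.
have cb : c ^+ m.+1 = b.
  by rewrite -powR_mulrn ?powR_ge0 // -powRrM mulVf ?pnatr_eq0 // powRr1.
have c1 : 1 < c.
  rewrite ltNge; apply/negP => c1; move: b1; rewrite -cb ltNge.
  by rewrite exprn_ile1 // powR_ge0.
pose e := Num.min 1 (c - 1).
have e0 : 0 < e by rewrite lt_min; apply/andP; split; lra.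
exists (Num.trunc (C / e ^+ m.+1)).+1 => d hd.
have h1 : e * d.+1%:R <= c ^+ d.
  have := @bernoulli_ge R (c - 1) d; rewrite (_ : 1 + (c - 1) = c); last by ring.
  move=> h.
  apply: le_trans (h _); last by lra.
  have d0 : 0 <= d%:R :> R by [].
  have e1 : e <= 1 by rewrite ge_min lexx.
  have e2 : e <= c - 1 by rewrite ge_min lexx orbT.
  by rewrite -(natr1 d) mulrDr mulr1 addrC lerD // mulrC ler_wpM2l.
rewrite -cb -exprM mulnC exprM.
apply: (@le_trans _ _ ((e * d.+1%:R) ^+ m.+1)); last first.
  by rewrite lerXn2r ?nnegrE // ?mulr_ge0 ?exprn_ge0 //; lra.
rewrite exprMn [d.+1%:R ^+ m.+1]exprSr mulrA mulrAC ler_pM2r ?exprn_gt0 ?ltr0Sn //.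
rewrite mulrC -ler_pdivrMr ?exprn_gt0 //.
by apply: le_trans (ltW (truncnS_gt _)) _; rewrite ler_nat ltnW.
Qed.

Lemma sum_coord_fiber p (F : 'I_p * 'I_p * 'I_p -> R) (i : 'I_p) :
  [/\ \sum_(e | e.1.1 == i) F e = \sum_j \sum_k F (i, j, k),
      \sum_(e | e.1.2 == i) F e = \sum_j \sum_k F (j, i, k) &
      \sum_(e | e.2 == i) F e = \sum_j \sum_k F (j, k, i)].
Proof.
split; rewrite pair_bigA /=.
- rewrite (reindex_onto (fun z => (i, z.1, z.2)) (fun e => (e.1.2, e.2))) /=.
    by apply: eq_bigl => -[a b] /=; rewrite !eqxx.
  by move=> [[a b] c] /= /eqP ->.
- rewrite (reindex_onto (fun z => (z.1, i, z.2)) (fun e => (e.1.1, e.2))) /=.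
    by apply: eq_bigl => -[a b] /=; rewrite !eqxx.
  by move=> [[a b] c] /= /eqP ->.
- rewrite (reindex_onto (fun z => (z.1, z.2, i)) (fun e => (e.1.1, e.1.2))) /=.
    by apply: eq_bigl => -[a b] /=; rewrite !eqxx.
  by move=> [[a b] c] /= /eqP ->.
Qed.

Lemma growth_rate_le p (x : R) : prime p -> 0 < x < 1 -> growth_rate R p <= growth_fun p x.
Proof.
move=> pp x01; apply: ge_inf; last by exists x.
by exists (9 / 8) => _ [y /= y01 <-]; exact: growth_fun_ge.
Qed.

Lemma growth_fun_pow p (x : R) d : 0 < x -> growth_fun p x ^+ (3 * d) * x ^+ (d * p.-1) =
  (\sum_(i < p) x ^+ i) ^+ (3 * d).
Proof.
move=> x0; rewrite /growth_fun exprMn mulrAC.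
rewrite -[(x `^ _) ^+ _]powR_mulrn ?powR_ge0 // -powRrM.
rewrite (_ : - (p.-1%:R / 3) * (3 * d)%:R = - (d * p.-1)%:R); last by rewrite !natrM; field.
rewrite powRN powR_mulrn ?(ltW x0) // mulVf ?mul1r // expf_neq0 //; exact: lt0r_neq0.
Qed.

(** One factor b^d absorbs the polynomial number of types, the other the density lost by the
    midpoint-free set. *)
Lemma large_sum_free p (b : R) : prime p -> 1 < b -> exists d0, forall d, (d0 <= d)%N ->
  exists S : {set 'rV['F_p]_(d + d + d) * 'rV['F_p]_(d + d + d) * 'rV['F_p]_(d + d + d)},
    sum_free3 S /\ growth_rate R p ^+ (3 * d) <= #|S|%:R * b ^+ (2 * d).
Proof.
move=> pp b1.
have p0 : (0 < p)%N by exact: prime_gt0.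
have b0 : 0 < b by lra.
have [rho [W [rho01 W0 Wsum [W1 W2 W3]]]] := symmetric_geometric_measure R pp.
have /andP[rho0 rho1] := rho01.
(* The hashing loses 4^k, where q^k is at most 6 q r and r <= p^(3 d). For a fixed prime q >= 4^(L +
   1) with p^3 <= b^L, this loss is at most 6 q b^d. *)
have [L bL] : exists L, (p ^ 3)%:R <= b ^+ L.
  have [L hL] := poly_le_geometric (p ^ 3)%:R 0 b1.
  by exists L; have := hL L (leqnn _); rewrite expr0 mulr1.
have [q qbig qp] : exists2 q, (maxn p (4 ^ L.+1) < q)%N & prime q.
  by have [q q1 q2] := prime_above (maxn p (4 ^ L.+1)); exists q.
have pq : (p <= q)%N by apply: ltnW; apply: leq_ltn_trans qbig; rewrite leq_maxl.
have qL : (4 ^ L.+1 <= q)%N by apply: ltnW; apply: leq_ltn_trans qbig; rewrite leq_maxr.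
have q2 : (2 < q)%N by apply: leq_trans qL; rewrite expnS; have := expn_gt0 4 L; lia.
have [d0 hd0] := poly_le_geometric (12 * q ^ 3 * (6 * q))%:R (9 * p) b1.
exists d0 => d dd0.
have [x [y [z [xyz heavy]]]] := @exists_heavy_type R d p rho
  (fun e => W e.1.1 e.1.2 e.2) rho0 (fun e => W0 _ _ _) p0 (fun e => Wsum _ _ _)
  (fun i => etrans (let: And3 h _ _ := sum_coord_fiber _ i in h) (W1 i))
  (fun i => etrans (let: And3 _ h _ := sum_coord_fiber _ i in h) (W2 i))
  (fun i => etrans (let: And3 _ _ h := sum_coord_fiber _ i in h) (W3 i)).
have [r [r0 rle hS]] := rotated_blocks pp xyz.
pose k := up_log q (6 * r).
have r6 : (1 < 6 * r)%N by clear -r0; lia.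
have /andP[k1 k2] := up_log_bounds (prime_gt1 qp) r6.
have [B [apB Bcard]] := exists_midpoint_free k qp q2.
have [S [Ssf Scard]] := hS q k B qp q2 pq apB k2.
exists S; split=> //.
move: heavy Scard; set Q := (#|_| * #|_| * #|_|)%N => heavy Scard.
have k0 : (0 < k)%N by rewrite up_log_gt0 (prime_gt1 qp) r6.
have qk : (q ^ k <= 6 * r * q)%N.
  by rewrite -(prednK k0) expnSr leq_mul2r ltnW ?orbT.
have Sle : (Q <= 12 * q ^ 3 * 4 ^ k * #|S|)%N.
  have h1 : (r * Q * q ^ k <= 2 ^ k * (k * q ^ 2).+1 * (2 * q ^ (2 * k) * #|S|))%N.
    apply: (@leq_trans (r * Q * (2 ^ k * (#|B| * (k * q ^ 2).+1)))); first by rewrite leq_mul2l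
      Bcard orbT.
    rewrite [X in (X <= _)%N](_ : _ = 2 ^ k * (k * q ^ 2).+1 * (r * Q * #|B|))%N; last by
      clear; lia.
    by rewrite leq_mul2l Scard orbT.
  have h2 : ((k * q ^ 2).+1 <= q ^ 2 * 2 ^ k)%N.
    apply: (@leq_trans (q ^ 2 * k.+1)%N); last by rewrite leq_mul2l ltn_expl ?orbT.
    by rewrite mulnS mulnC -addn1 addnC leq_add2r expn_gt0 (ltnW (ltnW q2)).
  have h3 : (r * Q <= 2 ^ k * (q ^ 2 * 2 ^ k) * (2 * (6 * r * q) * #|S|))%N.
    have qk0 : (0 < q ^ k)%N by rewrite expn_gt0 (ltnW (ltnW q2)).
    rewrite -(leq_pmul2r qk0); apply: (leq_trans h1).
    rewrite (_ : q ^ (2 * k) = q ^ k * q ^ k)%N; last by rewrite -expnD addnn mul2n.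
    have aux (P A A' K G s : nat) : (A <= A')%N -> (K <= G)%N ->
        (P * A * (2 * (K * K) * s) <= P * A' * (2 * G * s) * K)%N.
      move=> AA KG; have h : (P * 2 * s * K * (A * K) <= P * 2 * s * K * (A' * G))%N.
        by rewrite leq_mul2l leq_mul ?orbT.
      by clear -h; lia.
    exact: aux.
  rewrite -(leq_pmul2l r0); apply: (leq_trans h3).
  have -> : (4 ^ k = 2 ^ k * 2 ^ k)%N by rewrite -expnMn.
  rewrite (expnS q 2) leq_eqVlt; apply/orP; left; apply/eqP.
  by move: (2 ^ k)%N (q ^ 2)%N (#|S|) => u v s; clear; lia.
have k4 : (4 ^ k)%:R <= (6 * q)%:R * b ^+ d.
  have h : (4 ^ k)%:R ^+ L.+1 <= ((6 * q)%:R * b ^+ d) ^+ L.+1 :> R.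
    rewrite -natrX -expnM mulnC expnM.
    apply: (@le_trans _ _ (6 * r * q)%:R).
      by rewrite ler_nat; apply: leq_trans qk; case: (k) => // k'; rewrite leq_exp2r.
    apply: (@le_trans _ _ ((6 * q)%:R * (p ^ (3 * d))%:R)).
      by rewrite -natrM ler_nat mulnAC leq_mul2l rle orbT.
    rewrite exprMn; apply: ler_pM => //.
      have q6 : (1 < 6 * q)%N by clear -q2; lia.
      by rewrite -natrX ler_nat -{1}(expn1 (6 * q)) leq_exp2l.
    rewrite expnM [((p ^ 3) ^ d)%:R]natrX -[leRHS]exprM mulnC exprM.
    apply: lerXn2r; rewrite ?nnegrE ?(exprn_ge0 _ (ltW b0)) //.
    by apply: (le_trans bL); rewrite exprS ler_peMl ?exprn_ge0 // ltW.
  by rewrite -(ler_pXn2r (n := L.+1)) ?nnegrE // mulr_ge0 ?exprn_ge0 // ltW.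
have gr0 : 0 <= growth_rate R p by apply: le_trans (growth_rate_ge R pp); rewrite divr_ge0.
have gf0 : 0 <= growth_fun p rho by apply: le_trans (growth_rate_le pp rho01).
apply: (@le_trans _ _ (growth_fun p rho ^+ (3 * d))).
  by rewrite lerXn2r ?nnegrE //; exact: growth_rate_le.
have rd0 : 0 < rho ^+ (d * p.-1) by rewrite exprn_gt0.
rewrite -(ler_pM2r rd0) growth_fun_pow //; apply: (le_trans heavy).
rewrite ler_pM2r //.
apply: (@le_trans _ _ ((d.+1 ^ (9 * p))%:R * (12 * q ^ 3 * 4 ^ k * #|S|)%:R)).
  by apply: ler_wpM2l => //; rewrite ler_nat.
apply: (@le_trans _ _ (#|S|%:R * (((12 * q ^ 3)%:R * (d.+1 ^ (9 * p))%:R) * ((6 * q)%:R * b ^+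
  d)))).
  rewrite [((_ * _ * _) * _)%:R]natrM [((_ * _) * 4 ^ k)%:R]natrM.
  rewrite [leLHS](_ : _ = #|S|%:R * ((12 * q ^ 3)%:R * (d.+1 ^ (9 * p))%:R * (4 ^ k)%:R)); last
    by ring.
  by apply: ler_wpM2l => //; apply: ler_wpM2l => //; rewrite mulr_ge0.
apply: ler_wpM2l => //; rewrite mul2n -addnn exprD mulrA ler_pM2r ?exprn_gt0 //.
rewrite mulrAC -natrM natrX; exact: hd0.
Qed.

End Asymptotics.

(** * Tightness of the exponent *)

Lemma exists_subset_card (T : finType) (A : {set T}) m : (m <= #|A|)%N ->
  exists2 B : {set T}, B \subset A & #|B| = m.
Proof.
move=> mA; exists [set x in take m (enum A)].
  by apply/subsetP => x; rewrite inE => /mem_take; rewrite mem_enum.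
by rewrite cardsE (card_uniqP _) ?take_uniq ?enum_uniq // size_takel // -cardE.
Qed.

Lemma sum_free3_sub p n (S S' : {set 'rV['F_p]_n * 'rV['F_p]_n * 'rV['F_p]_n}) :
  S' \subset S -> sum_free3 S -> sum_free3 S'.
Proof.
move=> /subsetP sub [S0 S1]; split=> [t /sub/S0//|t u v /sub tS /sub uS /sub vS].
exact: S1.
Qed.

Section SumFreeTriangles.
Variables (p n : nat) (S : {set 'rV['F_p]_n * 'rV['F_p]_n * 'rV['F_p]_n}).
Hypothesis Ssf : sum_free3 S.
Let X := [set t.1.1 | t in S].
Let Y := [set t.1.2 | t in S].
Let Z := [set t.2 | t in S].

Lemma card_sum_free_triangles : (#|triangles X Y Z| <= #|S|)%N.
Proof.
apply: subset_leq_card; apply/subsetP => -[[a b] c].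
rewrite inE /= => /and4P[/imsetP[t tS ->] /imsetP[u uS ->] /imsetP[v vS ->] /eqP e].
have [<- <-] := Ssf.2 _ _ _ tS uS vS e.
by case: (t) tS => [[? ?] ?].
Qed.

Lemma sum_free_coord_inj : [/\ {in S &, injective (fun t => t.1.1)},
  {in S &, injective (fun t => t.1.2)} & {in S &, injective (fun t => t.2)}].
Proof.
split=> t u tS uS e.
- have h : t.1.1 + u.1.2 + u.2 = 0 by rewrite e Ssf.1.
  by case: (Ssf.2 _ _ _ tS uS uS h).
- have h : u.1.1 + t.1.2 + u.2 = 0 by rewrite e Ssf.1.
  by case: (Ssf.2 _ _ _ uS tS uS h).
- have h : u.1.1 + u.1.2 + t.2 = 0 by rewrite e Ssf.1.
  by case: (Ssf.2 _ _ _ uS uS tS h).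
Qed.

(** The members of S are triangles without common vertices, so a removed vertex destroys at most one
    of them. *)
Lemma sum_free_removal (R : realType) (eps : R) : removable eps X Y Z ->
  #|S|%:R <= eps * (p ^ n)%:R.
Proof.
move=> [X0 [Y0 [Z0 [_ [le_eps /setP no]]]]]; apply: le_trans le_eps; rewrite ler_nat.
have [i1 i2 i3] := sum_free_coord_inj.
pose S1 := [set t in S | t.1.1 \in X0]; pose S2 := [set t in S | t.1.2 \in Y0].
pose S3 := [set t in S | t.2 \in Z0].
have le1 : (#|S1| <= #|X0|)%N.
  rewrite -(@card_in_imset _ _ (fun t => t.1.1) S1).
    by apply: subset_leq_card; apply/subsetP => _ /imsetP[t + ->]; rewrite inE => /andP[].
  by move=> t u; rewrite !inE => /andP[tS _] /andP[uS _]; exact: i1.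
have le2 : (#|S2| <= #|Y0|)%N.
  rewrite -(@card_in_imset _ _ (fun t => t.1.2) S2).
    by apply: subset_leq_card; apply/subsetP => _ /imsetP[t + ->]; rewrite inE => /andP[].
  by move=> t u; rewrite !inE => /andP[tS _] /andP[uS _]; exact: i2.
have le3 : (#|S3| <= #|Z0|)%N.
  rewrite -(@card_in_imset _ _ (fun t => t.2) S3).
    by apply: subset_leq_card; apply/subsetP => _ /imsetP[t + ->]; rewrite inE => /andP[].
  by move=> t u; rewrite !inE => /andP[tS _] /andP[uS _]; exact: i3.
apply: (@leq_trans #|S1 :|: S2 :|: S3|); last first.
  apply: leq_trans (leq_card_setU _ _) _; apply: leq_add => //.
  by apply: leq_trans (leq_card_setU _ _) _; apply: leq_add.
apply: subset_leq_card; apply/subsetP => t tS; rewrite !inE tS /=.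
move: (no t); rewrite finset.in_set0 => /negbT; apply: contraNT; rewrite !negb_or =>
  /andP[/andP[h1 h2] h3].
rewrite in_set !in_setD h1 h2 h3 /= Ssf.1 // eqxx andbT.
by apply/and3P; split; apply/imsetP; exists t.
Qed.
End SumFreeTriangles.

(** A subset of S with m = floor(eps N) + 1 members cannot be removed at cost eps N, although it
    spans only m <= 2 eps N triangles. Admissibility thus excludes delta N^2 >= 2 eps N unless
    equality holds. *)
Lemma admissible_sum_free (R : realType) p n (eps delta : R)
  (S : {set 'rV['F_p]_n * 'rV['F_p]_n * 'rV['F_p]_n}) :
  admissible p eps delta -> (0 < n)%N -> sum_free3 S ->
  1 <= eps * (p ^ n)%:R -> 2 * eps * (p ^ n)%:R <= #|S|%:R ->
  delta * (p ^ n)%:R <= 2 * eps.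
Proof.
move=> [e0 d0 adm] n0 Ssf eN1 eS.
set N : R := (p ^ n)%:R in eN1 eS *.
have N0 : 0 < N by move: eN1; rewrite -(pmulr_rgt0 _ e0); lra.
pose m := (Num.trunc (eps * N)).+1.
have m1 : eps * N < m%:R by exact: truncnS_gt.
have m2 : m%:R <= 2 * eps * N.
  rewrite /m -(natr1 (Num.trunc _)); have := truncn_le (eps * N); rewrite (_ : 0 <= _) => [h|];
    last by lra.
  by lra.
have [S' S'S S'm] : exists2 S' : {set _}, S' \subset S & #|S'| = m.
  by apply: exists_subset_card; rewrite -(ler_nat R); lra.
have sf := sum_free3_sub S'S Ssf.
rewrite leNgt; apply/negP => big.
have /(adm n n0) /(sum_free_removal sf) : #|triangles [set t.1.1 | t in S'] [set t.1.2 | t in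
  S'] [set t.2 | t in S']|%:R
    <= delta * (p ^ (2 * n))%:R.
  apply: (@le_trans _ _ m%:R); first by rewrite ler_nat -S'm; exact: card_sum_free_triangles.
  apply: (le_trans m2); rewrite mulnC expnM natrX -/N expr2 mulrA ler_pM2r //; exact: ltW.
by rewrite S'm -/N leNgt m1.
Qed.

Lemma admissible_bound (R : realType) p (eta : R) : prime p -> 0 < eta ->
  exists epsilon0 : R, 0 < epsilon0 /\
    forall epsilon delta : R, admissible p epsilon delta -> epsilon < epsilon0 ->
      delta <= epsilon `^ (Cexp R p - eta).
Proof.
move=> pp eta0; pose c := cexp R p.
have /andP[c0 c1] : 0 < c < 1 := cexp_in01 R pp.
(* The slack keeps s = c + tau below 1 and lets 1 / s fall short of 1 / c by at most eta / 2. *)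
pose tau := Num.min (eta * c ^+ 2 / 2) ((1 - c) / 2).
have tau0 : 0 < tau.
  by rewrite lt_min; apply/andP; split; rewrite ?divr_gt0 ?mulr_gt0 ?exprn_gt0 //; lra.
have tau1 : tau <= (1 - c) / 2 by rewrite ge_min lexx orbT.
have tau2 : tau <= eta * c ^+ 2 / 2 by rewrite ge_min lexx.
pose s := c + tau.
have s0 : 0 < s by rewrite /s; lra.
have s1 : s < 1 by rewrite /s; lra.
have sinv : 1 / c - eta / 2 <= 1 / s.
  rewrite -subr_ge0 (_ : _ - _ = (eta / 2 * c * s - tau) / (c * s)); last first.
    by rewrite /s; field; rewrite !lt0r_neq0 // -/s.
  apply: divr_ge0; last by rewrite mulr_ge0 ?ltW.
  rewrite subr_ge0; apply: (le_trans tau2).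
  have : 0 <= eta * c * tau by rewrite !mulr_ge0 ?ltW.
  rewrite /s; lra.
pose P : R := ln p%:R.
have p0 : (0 < p)%N by exact: prime_gt0.
have pR : 0 < p%:R :> R by rewrite ltr0n.
have P0 : 0 < P by rewrite ln_gt0 // (ltr_nat _ 1) prime_gt1.
(* With N = p^(3 d), the loss b^(2 d) in [large_sum_free] is exactly N^tau. *)
pose b := expR (3 / 2 * tau * P).
have b1 : 1 < b by rewrite expR_gt1 !mulr_gt0 //; lra.
have [d0 hd0] := large_sum_free pp b1.
pose l2 : R := ln 2.
have l20 : 0 < l2 by rewrite ln_gt0 //; lra.
(* One summand per requirement on - ln eps: d exceeds d0, eps N >= 1, and the additive errors cost
   at most eta / 2 in the exponent. *)
pose Lam := (l2 + 3 * s * P * (d0.+2)%:R) + (l2 / s + 3 * P) / (1 / s - 1)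
   + (l2 + l2 / s + 3 * P) / (eta / 2).
have i1 : 0 < 1 / s - 1 by rewrite subr_gt0 ltr_pdivlMr // mul1r.
have t1 : 0 <= l2 + 3 * s * P * (d0.+2)%:R.
  by rewrite addr_ge0 ?mulr_ge0 ?ltW //; lra.
have ls0 : 0 < l2 / s by rewrite divr_gt0.
have t2 : 0 <= (l2 / s + 3 * P) / (1 / s - 1) by rewrite divr_ge0 ?(ltW i1) //; lra.
have t3 : 0 <= (l2 + l2 / s + 3 * P) / (eta / 2) by apply: divr_ge0; lra.
exists (expR (- Lam)); split; first exact: expR_gt0.
move=> eps delta adm epsL; have [e0 dl0 _] := adm.
pose lam := - ln eps.
have lamL : Lam < lam by rewrite /lam ltrNr -ltr_expR lnK.
have lam1 : l2 + 3 * s * P * (d0.+2)%:R <= lam by rewrite /Lam in lamL; lra.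
have lam2 : l2 / s + 3 * P <= lam * (1 / s - 1).
  by rewrite -ler_pdivrMr //; rewrite /Lam in lamL; lra.
have lam3 : l2 + l2 / s + 3 * P <= lam * (eta / 2).
  by rewrite -ler_pdivrMr; [rewrite /Lam in lamL; lra | lra].
(* Its integer part d is the largest with N^s <= 1 / (2 eps) for N = p^(3 d), so that N^(1 - s) >= 2
   eps N. *)
pose u := (lam - l2) / (3 * s * P).
have sP0 : 0 < 3 * s * P by rewrite !mulr_gt0 //; lra.
have u0 : d0.+2%:R <= u by rewrite ler_pdivlMr // mulrC; lra.
pose d := Num.trunc u.
have u00 : 0 <= u by apply: le_trans u0.
have du : d%:R <= u by rewrite truncn_le.
have ud : u < d.+1%:R by exact: truncnS_gt.
have d2 : (d0.+2 <= d)%N.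
  by rewrite -ltnS -(ltr_nat R); apply: le_lt_trans ud.
have dd0 : (d0 <= d)%N by apply: leq_trans d2; rewrite !leqW.
have d1 : (0 < d)%N by apply: leq_trans d2.
have [S [Ssf Scard]] := hd0 d dd0.
pose n := (d + d + d)%N.
have nE : n = (3 * d)%N by rewrite /n; clear; lia.
pose N : R := (p ^ n)%:R.
have N0 : 0 < N by rewrite ltr0n expn_gt0 p0.
have lnN : ln N = 3 * d%:R * P.
  by rewrite /N natrX lnXn // nE -[_ *+ _]mulr_natl natrM.
have lnN1 : s * ln N <= lam - l2.
  rewrite lnN (_ : s * _ = d%:R * (3 * s * P)); last by ring.
  by rewrite -ler_pdivlMr.
have lnN2 : (lam - l2) / s - 3 * P <= ln N.
  have : u * (3 * s * P) <= (d%:R + 1) * (3 * s * P).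
    by rewrite ler_pM2r // natr1 ltW.
  rewrite /u divfK ?lt0r_neq0 // lnN => h.
  rewrite lerBlDr ler_pdivrMr //; apply: (le_trans h).
  by rewrite [leLHS](_ : _ = (3 * d%:R * P + 3 * P) * s) //; ring.
have key : delta * N <= 2 * eps.
  apply: (@admissible_sum_free _ _ n _ _ S) => //; first by rewrite nE muln_gt0.
  - rewrite -/N -ler_ln ?posrE ?mulr_gt0 // ln1 lnM ?posrE //.
    have : ln eps = - lam by rewrite /lam opprK.
    move=> ->; have : lam * (1 / s - 1) = lam / s - lam by rewrite mulrBr mulr1 mul1r.
    have : (lam - l2) / s = lam / s - l2 / s by rewrite mulrBl.
    move: lam2 lnN2; move: (lam / s) (l2 / s) ((lam - l2) / s) (ln N) (lam * _) => x1 x2 x3 x4 x5.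
    clear; lra.
  - have b2d : 0 < b ^+ (2 * d) by rewrite exprn_gt0 ?expR_gt0.
    rewrite -/N -(ler_pM2r b2d); apply: le_trans Scard.
    have gr0 : 0 < growth_rate R p.
      by apply: lt_le_trans (growth_rate_ge R pp); rewrite divr_gt0.
    have eN : 0 < 2 * eps * N by rewrite !mulr_gt0.
    have Jd : 0 < growth_rate R p ^+ (3 * d) by rewrite exprn_gt0.
    rewrite -ler_ln ?posrE //; last by rewrite mulr_gt0.
    rewrite (@lnM _ (2 * eps * N)) ?posrE // (@lnM _ (2 * eps)) ?posrE ?mulr_gt0 //.
    rewrite lnM ?posrE // !lnXn ?expR_gt0 // /b expRK -/l2.
    have -> : ln eps = - lam by rewrite /lam opprK.
    have -> : ln (growth_rate R p) = (1 - c) * P.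
      by rewrite -(powR_cexp R pp) ln_powR.
    rewrite -[_ *+ (2 * d)]mulr_natl -[_ *+ (3 * d)]mulr_natl !natrM.
    have : s * ln N = (c + tau) * (3 * d%:R * P) by rewrite lnN.
    move: lnN1; rewrite lnN; clearbody s l2 c lam P; clear; lra.
rewrite -ler_ln ?posrE ?powR_gt0 // ln_powR.
have : ln (delta * N) <= ln (2 * eps) by rewrite ler_ln ?posrE ?mulr_gt0.
rewrite !lnM ?posrE // -/l2.
have -> : ln eps = - lam by rewrite /lam opprK.
rewrite /Cexp -/c => h.
have e3 : (lam - l2) / s = lam / s - l2 / s by rewrite mulrBl.
have lam0 : 0 <= lam by exact: le_trans lam1.
have e4 : lam * (1 / c - eta / 2) <= lam * (1 / s) by exact: ler_wpM2l.
have e5 : lam * (1 / s) = lam / s by rewrite mul1r.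
move: h lam3 lnN2 e4; rewrite e3 e5; move: (l2 / s) (lam / s) (ln N) (ln delta) => x1 x2 x3 x4.
clearbody lam l2 P; move: (1 / c) => ic; clear; lra.
Qed.

(** * The slice rank bound *)

Section SliceRank.
Variable F : fieldType.

Lemma rank_sum_outer m n (T : finType) (A : {set T}) (f : T -> 'I_m -> F) (g : T -> 'I_n -> F) :
  (\rank (\matrix_(i < m, j < n) \sum_(a in A) f a i * g a j)%R <= #|A|)%N.
Proof.
rewrite (_ : \matrix_(i, j) _ = (\matrix_(i < m, k < #|A|) f (enum_val k) i)
    *m (\matrix_(k < #|A|, j < n) g (enum_val k) j)).
  by apply: leq_trans (mxrankM_maxl _ _) (rank_leq_col _).
apply/matrixP => i j; rewrite !mxE big_enum_val.
by apply: eq_bigr => k _; rewrite !mxE.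
Qed.

Lemma rank_mxsub_le m n p q (A : 'M[F]_(m, n)) (f : 'I_p -> 'I_m) (g : 'I_q -> 'I_n) :
  (\rank (mxsub f g A) <= \rank A)%N.
Proof.
have -> : mxsub f g A = (rowsub f 1%:M *m A) *m (colsub g 1%:M).
  by rewrite mulmx_colsub mulmx1 -rowsubE; apply/matrixP => i j; rewrite !mxE.
by apply: leq_trans (mxrankM_maxl _ _) (mxrankM_maxr _ _).
Qed.

(** The vectors orthogonal to all [f c] form a space of some dimension d >= n - #|C|. On d pivot
    coordinates such a space takes arbitrary values, here 1. *)
Lemma exists_orthogonal_support n (T : finType) (C : {set T}) (f : T -> 'I_n -> F) :
  exists (h : 'I_n -> F) d (s : 'I_d -> 'I_n),
    [/\ injective s, forall i, h (s i) = 1, (n <= d + #|C|)%N &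
        forall c, c \in C -> \sum_k h k * f c k = 0].
Proof.
pose M : 'M[F]_(n, #|C|) := \matrix_(k, c) f (enum_val c) k.
pose W := row_base (kermx M); pose d := \rank (kermx M).
have fW : row_full W^T by rewrite /row_full mxrank_tr eq_row_base.
pose s := fullrankfun fW.
pose u : 'rV[F]_d := (invmx (rowsub s W^T) *m const_mx 1)^T.
pose h := u *m W.
exists (fun k => h 0 k), d, s; split.
- exact: fullrankfun_inj.
- move=> i; have : rowsub s W^T *m u^T = const_mx 1.
    by rewrite trmxK mulmxA mulmxV ?mul1mx // fullrowsub_unit.
  move=> /matrixP /(_ i 0); rewrite [RHS]mxE => <-.
  by rewrite !mxE; apply: eq_bigr => j _; rewrite !mxE mulrC.
- by rewrite /d mxrank_ker addnC -leq_subLR leq_sub2l // rank_leq_col.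
- move=> c cC; have hM : h *m M = 0.
    by apply/sub_kermxP; rewrite (submx_trans (submxMl _ _)) // eq_row_base.
  move/matrixP: hM => /(_ 0 (enum_rank_in cC c)); rewrite [LHS]mxE [RHS]mxE => e; rewrite -[RHS]e.
  by apply: eq_bigr => k _; rewrite [M _ _]mxE enum_rankK_in.
Qed.

(* Tao's slice rank bound: contract the third index against a vector orthogonal
   to all f_c whose support is large, and compare ranks. *)
Lemma slice_rank_diagonal n (TA TB TC : finType) (A : {set TA}) (B : {set TB}) (C : {set TC})
  (fA : TA -> 'I_n -> F) (gA : TA -> 'I_n -> 'I_n -> F)
  (fB : TB -> 'I_n -> F) (gB : TB -> 'I_n -> 'I_n -> F)
  (fC : TC -> 'I_n -> F) (gC : TC -> 'I_n -> 'I_n -> F) :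
  (forall i j k, ((i == j) && (j == k))%:R = \sum_(a in A) fA a i * gA a j k
     + \sum_(b in B) fB b j * gB b i k + \sum_(c in C) fC c k * gC c i j) ->
  (n <= #|A| + #|B| + #|C|)%N.
Proof.
move=> T; have [h [d [s [s_inj hs nd hC]]]] := exists_orthogonal_support C fC.
apply: (leq_trans nd); rewrite leq_add2r.
pose D : 'M[F]_n := \matrix_(i, j) ((i == j)%:R * h j).
have DE : D = (\matrix_(i, j) \sum_(a in A) fA a i * (\sum_k h k * gA a j k))
     + (\matrix_(i, j) \sum_(b in B) (\sum_k h k * gB b i k) * fB b j).
  apply/matrixP => i j; rewrite !mxE.
  have -> : (i == j)%:R * h j = \sum_k h k * ((i == j) && (j == k))%:R.
    rewrite (bigD1 j) //= eqxx andbT big1 ?addr0 1?mulrC // => k kj.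
    by rewrite [j == k]eq_sym (negbTE kj) andbF mulr0.
  under eq_bigr => k _ do rewrite T !mulrDr !mulr_sumr.
  rewrite !big_split /= [X in _ + X]exchange_big /= [X in _ + X]big1 ?addr0; last first.
    move=> c cC; under eq_bigr => k _ do rewrite mulrA.
    by rewrite -mulr_suml hC ?mul0r.
  congr (_ + _); rewrite exchange_big /=; apply: eq_bigr => a _.
    by rewrite mulr_sumr; apply: eq_bigr => k _; rewrite mulrCA.
  by rewrite mulr_suml; apply: eq_bigr => k _; rewrite mulrCA mulrC.
apply: (@leq_trans (\rank D)); last first.
  by rewrite DE; apply: leq_trans (mxrank_add _ _) (leq_add _ _); exact: rank_sum_outer.
apply: leq_trans (rank_mxsub_le D s s).
rewrite (_ : mxsub s s D = 1%:M) ?mxrank1 //.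
by apply/matrixP => i j; rewrite !mxE (inj_eq s_inj) hs mulr1.
Qed.

Lemma trinomial_monomials p : exists (J : finType) (e1 e2 e3 : J -> 'I_p.+1) (q : J -> F),
  (forall t, e1 t + e2 t + e3 t <= p)%N /\
  forall a b c, 1 - (a + b + c) ^+ p = \sum_t q t * (a ^+ e1 t * b ^+ e2 t * c ^+ e3 t).
Proof.
pose J : finType := (unit + 'I_p.+1 * 'I_p.+1)%type.
pose e1 (t : J) := if t is inr (i, _) then rev_ord i else ord0.
pose e2 (t : J) : 'I_p.+1 := if t is inr (i, j) then inord (i - j) else ord0.
(* The minimum keeps the total degree at most p for the indices j > i too, whose coefficient
   vanishes. *)
pose e3 (t : J) : 'I_p.+1 := if t is inr (i, j) then inord (minn i j) else ord0.
pose q (t : J) : F := if t is inr (i, j) then - ('C(p, i) * 'C(i, j))%:R else 1.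
exists J, e1, e2, e3, q; split.
  move=> [//|[i j]] /=; have ip : (i <= p)%N by rewrite -ltnS.
  by rewrite subSS !inordK ?ltnS; lia.
move=> a b c; rewrite big_sumType /= (big_pred1 tt) => [|[]//]; rewrite !expr0 !mulr1; congr (_
  + _).
pose G (i j : 'I_p.+1) := q (inr (i, j)) *
  (a ^+ e1 (inr (i, j)) * b ^+ e2 (inr (i, j)) * c ^+ e3 (inr (i, j))).
rewrite -addrA exprDn -sumrN [RHS](eq_bigr (fun z => G z.1 z.2)) => [|[i j] //].
rewrite -(pair_bigA _ G) /G /=.
apply: eq_bigr => i _; have ip : (i <= p)%N by rewrite -ltnS.
rewrite exprDn (big_ord_widen p.+1 (fun j => b ^+ (i - j) * c ^+ j *+ 'C(i, j))) ?ltnS //.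
rewrite mulr_sumr -sumrMnl -sumrN big_mkcond /=; apply: eq_bigr => j _.
rewrite ltnS subSS inordK; last by rewrite ltnS; lia.
case: leqP => ji; last by rewrite (bin_small ji) muln0 oppr0 mul0r.
rewrite inordK; last by rewrite ltnS; lia.
by rewrite natrM -[b ^+ _ * _ *+ _]mulr_natl -[a ^+ _ * _ *+ _]mulr_natl; ring.
Qed.

End SliceRank.

Definition low_exponents p n : {set {ffun 'I_n -> 'I_p}} :=
  [set a : {ffun 'I_n -> 'I_p} | (3 * \sum_l a l <= n * p.-1)%N].

(* The indicator of x + y + z = 0 is the product over coordinates of
   1 - (x + y + z)^(p-1); in each monomial one of the three total degrees is at
   most a third of n(p-1). *)
Lemma sum_free3_card_low p n (S : {set 'rV['F_p]_n * 'rV['F_p]_n * 'rV['F_p]_n}) :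
  prime p -> sum_free3 S -> (#|S| <= 3 * #|low_exponents p n|)%N.
Proof.
move=> pp [S0 S1]; have pE : p = p.-1.+1 by rewrite prednK // prime_gt0.
have [J [e1 [e2 [e3 [q [deg tri]]]]]] := trinomial_monomials 'F_p p.-1.
pose M := {ffun 'I_n -> J}.
pose al (e : J -> 'I_p.-1.+1) (m : M) : {ffun 'I_n -> 'I_p} := [ffun l => cast_ord (esym pE) (e
  (m l))].
pose mon (v : 'rV['F_p]_n) (a : {ffun 'I_n -> 'I_p}) := \prod_l v 0 l ^+ a l.
pose K (m : M) := \prod_l q (m l).
have expand (x y z : 'rV['F_p]_n) : (x + y + z == 0)%:R
    = \sum_m K m * (mon x (al e1 m) * mon y (al e2 m) * mon z (al e3 m)).
  transitivity (\prod_l (1 - (x 0 l + y 0 l + z 0 l) ^+ p.-1)).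
    have [/matrixP xyz|] := eqVneq.
      by rewrite big1 // => l _; have := xyz 0 l; rewrite !mxE => ->;
        rewrite expr0n (_ : (p.-1 == 0)%N = false) ?subr0 //; case: (p) pp => [|[]].
    move=> ne; have [l hl] : exists l, x 0 l + y 0 l + z 0 l != 0.
      apply/existsP; apply: contraR ne; rewrite negb_exists => /forallP h.
      by apply/eqP/matrixP => i l; rewrite (ord1 i) !mxE; apply/eqP; rewrite -[_ == _]negbK.
    rewrite (bigD1 l) //= (_ : _ ^+ p.-1 = 1) ?subrr ?mul0r //.
    apply: (mulfI hl); rewrite mulr1 -exprS -pE.
    by have := finfield.expf_card (x 0 l + y 0 l + z 0 l); rewrite card_Fp.
  under eq_bigr do rewrite tri.
  rewrite (bigA_distr_bigA (fun l t => q t * (x 0 l ^+ e1 t * y 0 l ^+ e2 t * z 0 l ^+ e3 t))) /=.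
  apply: eq_bigr => m _; rewrite !big_split /=.
  by congr (_ * (_ * _ * _)); apply: eq_bigr => l _; rewrite ffunE.
pose L := low_exponents p n.
have degm m : al e1 m \notin L -> al e2 m \notin L -> al e3 m \in L.
  rewrite !inE -!ltnNge => h1 h2.
  have : (\sum_l al e1 m l + \sum_l al e2 m l + \sum_l al e3 m l <= n * p.-1)%N.
    rewrite -!big_split /= -[n in (n * _)%N]card_ord -sum_nat_const; apply: leq_sum => l _.
    by rewrite !ffunE; exact: deg.
  by clear -h1 h2; lia.
pose t (i : 'I_#|S|) := enum_val i.
have tS i : t i \in S by exact: enum_valP.
pose P1 m := al e1 m \in L; pose P2 m := al e2 m \in L.
pose T0 m i j k := K m * (mon (t i).1.1 (al e1 m) * mon (t j).1.2 (al e2 m) * mon (t k).2 (al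
  e3 m)).
(* Each monomial is assigned to its first factor of low degree, so that none is counted twice. *)
have split_sum i j k : \sum_m T0 m i j k = \sum_(a in L) \sum_(m | P1 m && (al e1 m == a)) T0 m
  i j k
   + \sum_(a in L) \sum_(m | ~~ P1 m && P2 m && (al e2 m == a)) T0 m i j k
   + \sum_(a in L) \sum_(m | ~~ P1 m && ~~ P2 m && (al e3 m == a)) T0 m i j k.
  rewrite (bigID P1) /= -addrA; congr (_ + _).
    by rewrite (partition_big (al e1) (mem L)).
  rewrite (bigID P2) /=; congr (_ + _).
    by rewrite (partition_big (al e2) (mem L)) // => m /andP[].
  by rewrite (partition_big (al e3) (mem L)) // => m /andP[]; exact: degm.
rewrite (_ : 3 * #|L| = #|L| + #|L| + #|L|)%N; last by clear; lia.
apply: (@slice_rank_diagonal 'F_p #|S| _ _ _ L L L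
  (fun a i => mon (t i).1.1 a) (fun a j k => \sum_(m | P1 m && (al e1 m == a))
       K m * (mon (t j).1.2 (al e2 m) * mon (t k).2 (al e3 m)))
  (fun a j => mon (t j).1.2 a) (fun a i k => \sum_(m | ~~ P1 m && P2 m && (al e2 m == a))
       K m * (mon (t i).1.1 (al e1 m) * mon (t k).2 (al e3 m)))
  (fun a k => mon (t k).2 a) (fun a i j => \sum_(m | ~~ P1 m && ~~ P2 m && (al e3 m == a))
       K m * (mon (t i).1.1 (al e1 m) * mon (t j).1.2 (al e2 m)))) => i j k.
have -> : (i == j) && (j == k) = ((t i).1.1 + (t j).1.2 + (t k).2 == 0).
  apply/andP/eqP => [[/eqP-> /eqP->]|e]; first exact: S0.
  by have [/enum_val_inj -> /enum_val_inj ->] := S1 _ _ _ (tS i) (tS j) (tS k) e; rewrite !eqxx.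
rewrite expand split_sum; congr (_ + _ + _); apply: eq_bigr => a _;
  rewrite mulr_sumr; apply: eq_bigr => m /andP[_ /eqP <-]; rewrite /T0; ring.
Qed.

(** Rankin's trick: since x < 1, each low exponent vector contributes at least x^(n (p - 1) / 3) to
    the expansion of the n-th power of the sum of the x^i. *)
Lemma low_exponents_card (R : realType) p n (x : R) : 0 < x < 1 ->
  #|low_exponents p n|%:R <= growth_fun p x ^+ n.
Proof.
move=> /andP[x0 x1]; pose D : R := n%:R * (p.-1%:R / 3).
have xD : 0 < x `^ D by exact: powR_gt0.
rewrite /growth_fun exprMn -[(x `^ _) ^+ _]powR_mulrn ?powR_ge0 // -powRrM mulNr mulrC.
rewrite -[X in - X]mulrC -/D powRN ler_pdivlMr //.
rewrite -[X in _ ^+ X](card_ord n) -prodr_const (bigA_distr_bigA (fun _ (i : 'I_p) => x ^+ i)) /=.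
rewrite mulr_natl -sumr_const.
apply: (@le_trans _ _ (\sum_(a in low_exponents p n) \prod_l x ^+ a l)); last first.
  rewrite [leRHS](bigID (mem (low_exponents p n))) /= lerDl; apply: sumr_ge0 => a _.
  by apply: prodr_ge0 => l _; rewrite exprn_ge0 // ltW.
apply: ler_sum => a; rewrite inE -(ler_nat R) !natrM => h.
rewrite -expr_sum -powR_mulrn ?(ltW x0) //; apply: ger_powR; first by rewrite x0 ltW.
rewrite /D; lra.
Qed.

Lemma sum_free3_card (R : realType) p n (S : {set 'rV['F_p]_n * 'rV['F_p]_n * 'rV['F_p]_n}) :
  prime p -> sum_free3 S -> #|S|%:R <= 3 * growth_rate R p ^+ n.
Proof.
move=> pp Ssf.
have bound (x : R) : 0 < x < 1 -> #|S|%:R / 3 <= growth_fun p x ^+ n.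
  move=> x01; rewrite ler_pdivrMr // mulrC.
  apply: (@le_trans _ _ (3 * #|low_exponents p n|%:R)).
    by rewrite -natrM ler_nat; exact: sum_free3_card_low.
  by apply: ler_wpM2l => //; exact: low_exponents_card.
have s0 : 0 <= #|S|%:R / 3 :> R by rewrite divr_ge0.
(* The bound holds for each x, but the infimum is taken before the n-th power. Roots of order n are
   compared, so n = 0 is separate. *)
rewrite mulrC -ler_pdivrMr //; case: n => [|n] in S Ssf bound s0 *.
  by rewrite expr0; have := bound 2^-1; rewrite expr0; apply; lra.
pose r := (#|S|%:R / 3) `^ (n.+1%:R^-1) : R.
have rE : r ^+ n.+1 = #|S|%:R / 3.
  by rewrite -powR_mulrn ?powR_ge0 // -powRrM mulVf ?pnatr_eq0 // powRr1.
have r0 : 0 <= r by exact: powR_ge0.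
rewrite -rE lerXn2r ?nnegrE //; first by apply: le_trans (growth_rate_ge R pp); rewrite divr_ge0.
apply: lb_le_inf; first by exists (growth_fun p 2^-1), 2^-1 => //=; lra.
move=> _ [x /= x01 <-].
have g0 : 0 <= growth_fun p x by apply: le_trans (growth_fun_ge pp x01); rewrite divr_ge0.
by rewrite -(ler_pXn2r (n := n.+1)) ?nnegrE // rE bound.
Qed.

(** * Removal from few triangles *)

Lemma lsubmxB (R : pzRingType) m n1 n2 (A B : 'M[R]_(m, n1 + n2)) :
  lsubmx (A - B) = lsubmx A - lsubmx B.
Proof. exact: linearB. Qed.

Lemma lsubmxN (R : pzRingType) m n1 n2 (A : 'M[R]_(m, n1 + n2)) :
  lsubmx (- A) = - lsubmx A.
Proof. exact: linearN. Qed.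

Lemma lsubmxD (R : pzRingType) m n1 n2 (A B : 'M[R]_(m, n1 + n2)) :
  lsubmx (A + B) = lsubmx A + lsubmx B.
Proof. exact: linearD. Qed.

Lemma lsubmx_mulB_eq0 (R : pzRingType) n1 n2 (u v : 'rV[R]_(n1 + n2)) (g : 'M_(n1 + n2)) :
  lsubmx (u *m g) = lsubmx (v *m g) -> lsubmx ((u - v) *m g) = 0 :> 'rV_n1.
Proof. by move=> e; rewrite mulmxBl lsubmxB e subrr. Qed.

(** * Random affine subspaces *)

Section LinearSampling.
Variables (F : finFieldType) (j m : nat).
Let n := (j + m)%N.
Let G := [set g : 'M[F]_n | g \in unitmx].

Let fib (w u : 'rV[F]_n) := #|[set g in G | w *m g == u]|.

Let fib_le (w u1 u2 : 'rV[F]_n) : u1 != 0 -> u2 != 0 -> (fib w u1 <= fib w u2)%N.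
Proof.
move=> u10 u20.
have rk (u : 'rV[F]_n) : u != 0 -> \rank u = 1%N by rewrite rank_rV => ->.
have u1f : u1 *m (pinvmx u1 *m u2) = u2.
  by rewrite mulmxA mulmxVp ?mul1mx // /row_free rk.
have [|B Bu e] := @complete_unitmx F 1 n u1 (pinvmx u1 *m u2); first by rewrite u1f !rk.
have B_inj : injective (fun g : 'M[F]_n => g *m B).
  by apply: row_free_inj; rewrite row_free_unit.
rewrite /fib -(card_imset _ B_inj); apply: subset_leq_card; apply/subsetP => _ /imsetP[g + ->].
by rewrite !inE unitmx_mul Bu andbT mulmxA => /andP[-> /eqP->]; rewrite -e u1f eqxx.
Qed.

(** For a random invertible g the vector w g is uniform on the nonzero vectors, so its first j
    coordinates vanish with probability (q^m - 1) / (q^n - 1) <= q^(-j), where q = #|F|. *)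
Lemma card_unitmx_lsub (w : 'rV[F]_n) : w != 0 ->
  (#|[set g in G | lsubmx (w *m g) == 0%R]| * #|F| ^ j <= #|G|)%N.
Proof.
move=> w0; pose c := fib w w.
have fibc u : u != 0 -> fib w u = c.
  by move=> u0; apply/eqP; rewrite eqn_leq !fib_le.
have wg0 g : g \in G -> w *m g != 0.
  rewrite inE => gu; apply: contra w0 => /eqP wg.
  by rewrite -[w](mulmxK gu) wg mul0mx.
have total (P : pred 'rV[F]_n) : #|[set g in G | P (w *m g)]| = (c * #|[set u : 'rV[F]_n | (u
  != 0%R) && P u]|)%N.
  rewrite -sum1_card (partition_big (fun g => w *m g) (fun u => (u != 0) && P u)) /=; last first.
    by move=> g; rewrite inE => /andP[/wg0 -> ->].
  rewrite (eq_bigr (fun=> c)) => [|u /andP[u0 Pu]].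
    by rewrite sum_nat_const mulnC; congr (_ * _)%N; apply: eq_card => u; rewrite !inE.
  rewrite sum1dep_card -(fibc u u0) /fib; apply: eq_card => g; rewrite !inE.
  by case: (w *m g =P u) => [->|]; rewrite ?andbF // Pu !andbT.
have -> : #|G| = (c * #|[set u : 'rV[F]_n | (u != 0%R) && true]|)%N.
  by rewrite -total; apply: eq_card => g; rewrite !inE andbT.
rewrite (total (fun u => lsubmx u == 0)) -mulnA leq_mul2l; apply/orP; right.
have F0 : (0 < #|F|)%N by apply/card_gt0P; exists 0.
have -> : #|[set u : 'rV[F]_n | (u != 0) && true]| = (#|F| ^ n).-1.
  have := cardsC1 (0 : 'rV[F]_n); rewrite card_mx mul1n => <-.
  by apply: eq_card => u; rewrite !inE andbT.
have -> : #|[set u : 'rV[F]_n | (u != 0) && (lsubmx u == 0)]| = (#|F| ^ m).-1.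
  have r_inj : injective (@row_mx F 1 j m 0) by move=> u v /eq_row_mx[].
  have := cardsC1 (0 : 'rV[F]_m); rewrite card_mx mul1n => <-.
  rewrite -(card_imset _ r_inj); apply: eq_card => u; rewrite !inE.
  apply/andP/imsetP => [[u0 /eqP ul]|[v]].
    exists (rsubmx u); last by rewrite -[LHS]hsubmxK ul.
    by rewrite !inE; apply: contra u0 => /eqP ur; rewrite -[u]hsubmxK ul ur row_mx0.
  rewrite !inE => v0 ->; rewrite row_mxKl eqxx; split=> //.
  by apply: contra v0 => /eqP; rewrite -row_mx0 => /eq_row_mx[_ ->].
by rewrite -subn1 mulnBl mul1n -expnD addnC -/n -subn1 leq_sub2l // expn_gt0 F0.
Qed.

End LinearSampling.

(** An invertible g and values a, b are drawn; x survives if x g starts with a, and y if y g starts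
    with b. On a triangle z g must then start with -(a + b). The last m coordinates tell survivors
    apart and carry the sum-free set. *)
Lemma triangles_sampling p j m (X Y Z : {set 'rV['F_p]_(j + m)}) D : prime p ->
  (forall x, #|[set t in triangles X Y Z | t.1.1 == x]| <= D)%N ->
  (forall y, #|[set t in triangles X Y Z | t.1.2 == y]| <= D)%N ->
  (forall z, #|[set t in triangles X Y Z | t.2 == z]| <= D)%N ->
  (6 * D <= p ^ j)%N ->
  exists S : {set 'rV['F_p]_m * 'rV['F_p]_m * 'rV['F_p]_m},
    sum_free3 S /\ (#|triangles X Y Z| <= 2 * p ^ (2 * j) * #|S|)%N.
Proof.
move=> pp dX dY dZ Dj; pose n := (j + m)%N.
pose Om : finType := ('M['F_p]_n * 'rV['F_p]_j * 'rV['F_p]_j)%type.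
pose G := [set g : 'M['F_p]_n | g \in unitmx].
pose O : {set Om} := setX (setX G setT) setT.
have OE w : (w \in O) = (w.1.1 \in unitmx) by case: w => [[g a] b]; rewrite !in_setX !in_setT
  !andbT in_set.
pose E := triangles X Y Z.
pose alive (w : Om) (e : 'rV['F_p]_n * 'rV['F_p]_n * 'rV['F_p]_n) :=
  (lsubmx (e.1.1 *m w.1.1) == w.1.2) && (lsubmx (e.1.2 *m w.1.1) == w.2).
have Esum e : e \in E -> e.1.1 + e.1.2 + e.2 = 0 by rewrite inE => /and4P[_ _ _ /eqP].
have alive3 w e : e \in E -> alive w e -> lsubmx (e.2 *m w.1.1) = - (w.1.2 + w.2).
  move=> /Esum e0 /andP[/eqP<- /eqP<-].
  have -> : e.2 = - (e.1.1 + e.1.2) by apply/eqP; rewrite -addr_eq0 addrC e0.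
  by rewrite mulNmx mulmxDl lsubmxN lsubmxD.
have G0 : (0 < #|G|)%N by apply/card_gt0P; exists 1%:M; rewrite inE unitmx1.
have OG : #|O| = (#|G| * p ^ (2 * j))%N.
  by rewrite !cardsX !cardsT !card_mx card_Fp // !mul1n -mulnA -expnD addnn mul2n.
have pj0 : (0 < p ^ j)%N by rewrite expn_gt0 prime_gt0.
have [|||w] := @exists_isolated Om _ O E alive D #|G| (p ^ j) _ pj0 Dj dX dY dZ.
- by rewrite OG muln_gt0 G0 expn_gt0 prime_gt0.
- move=> e eE; pose f (g : 'M['F_p]_n) : Om := (g, lsubmx (e.1.1 *m g), lsubmx (e.1.2 *m g)).
  have f_inj : injective f by move=> g g' [].
  rewrite -(card_imset _ f_inj); apply: subset_leq_card; apply/subsetP => _ /imsetP[g + ->].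
  move=> gG; apply/setIdP; split; first by rewrite OE; rewrite in_set in gG.
  by rewrite /alive /= !eqxx.
- move=> e e' eE e'E ne _.
  have [v [v0 hv]] : exists v : 'rV['F_p]_n, v != 0 /\
      forall w, alive w e -> alive w e' -> lsubmx (v *m w.1.1) = 0.
    have main w : alive w e -> alive w e' -> lsubmx ((e.1.1 - e'.1.1) *m w.1.1) = 0
        /\ lsubmx ((e.1.2 - e'.1.2) *m w.1.1) = 0.
      move=> /andP[/eqP h1 /eqP h2] /andP[/eqP h1' /eqP h2'].
      split; [exact: lsubmx_mulB_eq0 (etrans h1 (esym h1')) | exact: lsubmx_mulB_eq0 (etrans h2
        (esym h2'))].
    have [ea|ea] := eqVneq e.1.1 e'.1.1; last first.
      by exists (e.1.1 - e'.1.1); rewrite subr_eq0; split=> // w h1 h2; case: (main w h1 h2).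
    exists (e.1.2 - e'.1.2); split; last by move=> w h1 h2; case: (main w h1 h2).
    rewrite subr_eq0; apply: contra ne => /eqP eb.
    have ec : e.2 = e'.2.
      by have := Esum _ eE; rewrite ea eb -(Esum _ e'E) => /addrI.
    by move: ea eb ec; case: (e) (e') => [[? ?] ?] [[? ?] ?] /= -> -> ->.
  apply: leq_trans (card_unitmx_lsub v0); rewrite card_Fp // leq_mul2r; apply/orP; right.
  pose g (w : Om) := w.1.1.
  have g_inj : {in [set w in O | alive w e && alive w e'] &, injective g}.
    move=> [[g1 a1] b1] [[g2 a2] b2]; move=> /setIdP[_ /andP[/andP[/eqP /= <- /eqP /= <-] _]].
    by move=> /setIdP[_ /andP[/andP[/eqP /= <- /eqP /= <-] _]]; rewrite /g /= => ->.
  rewrite -(card_in_imset g_inj); apply: subset_leq_card; apply/subsetP => _ /imsetP[w + ->].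
  move=> /setIdP[+ /andP[h h']]; rewrite OE => wu.
  by apply/setIdP; split; [rewrite in_set | rewrite hv].
rewrite OE => wu hw; set I := isolated E alive w in hw.
have IE t : t \in I -> t \in E by rewrite inE => /andP[].
have Ial t : t \in I -> alive w t by rewrite inE => /and3P[].
pose phi (t : 'rV['F_p]_n * 'rV['F_p]_n * 'rV['F_p]_n) :=
  (rsubmx (t.1.1 *m w.1.1) : 'rV['F_p]_m, rsubmx (t.1.2 *m w.1.1) : 'rV['F_p]_m, rsubmx (t.2 *m
    w.1.1) : 'rV['F_p]_m).
have w_inj : injective (fun v : 'rV['F_p]_n => v *m w.1.1).
  by apply: row_free_inj; rewrite row_free_unit.
have phi_inj : {in I &, injective phi}.
  move=> t u tI uI [e1 e2 _].
  have /andP[/eqP t1 /eqP t2] := Ial _ tI; have /andP[/eqP u1 /eqP u2] := Ial _ uI.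
  have h1 : t.1.1 = u.1.1 by apply: w_inj; rewrite -[LHS]hsubmxK -[RHS]hsubmxK t1 u1 e1.
  have h2 : t.1.2 = u.1.2 by apply: w_inj; rewrite -[LHS]hsubmxK -[RHS]hsubmxK t2 u2 e2.
  have h3 : t.2 = u.2.
    by have := Esum _ (IE _ tI); rewrite h1 h2 -(Esum _ (IE _ uI)) => /addrI.
  by move: h1 h2 h3; case: (t) (u) => [[? ?] ?] [[? ?] ?] /= -> -> ->.
exists (phi @: I); split; last first.
  rewrite (card_in_imset phi_inj) -(leq_pmul2r G0); apply: (leq_trans hw).
  by rewrite OG leq_eqVlt; apply/orP; left; apply/eqP; clear; lia.
split=> [_ /imsetP[t tI ->]|].
  by rewrite /= -!linearD /= -!mulmxDl Esum ?IE // mul0mx linear0.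
move=> _ _ _ /imsetP[t tI ->] /imsetP[u uI ->] /imsetP[v vI ->] /= e.
have /andP[/eqP t1 /eqP t2] := Ial _ tI; have /andP[/eqP u1 /eqP u2] := Ial _ uI.
have v3 := alive3 _ _ (IE _ vI) (Ial _ vI).
have sum0 : t.1.1 + u.1.2 + v.2 = 0.
  apply: w_inj; rewrite mul0mx !mulmxDl -[LHS]hsubmxK !linearD /= e t1 u2 v3.
  by rewrite subrr row_mx0.
have eE : (t.1.1, u.1.2, v.2) \in E.
  have := IE _ tI; have := IE _ uI; have := IE _ vI; rewrite !inE /= sum0 eqxx.
  by move=> /and4P[_ _ -> _] /and4P[_ -> _ _] /and4P[-> _ _ _].
have al : alive w (t.1.1, u.1.2, v.2) by rewrite /alive /= t1 u2 !eqxx.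
by have [-> ->] := isolated_induced tI uI vI eE al.
Qed.

Definition matching (U : finType) (M : {set U * U * U}) :=
  [forall t in M, forall u in M, meets t u ==> (t == u)].

Lemma matchingP (U : finType) (M : {set U * U * U}) :
  reflect {in M &, forall t u, meets t u -> t = u} (matching M).
Proof.
apply: (iffP forall_inP) => [h t u tM uM m|h t tM].
  by apply/eqP; have /forall_inP/(_ u uM)/implyP := h t tM; apply.
by apply/forall_inP => u uM; apply/implyP => /(h t u tM uM) ->.
Qed.

Lemma card_heavy (T U : finType) (E : {set T}) (pr : T -> U) D m : (0 < #|E|)%N ->
  (6 * #|E| < D.+1 * m)%N ->
  (6 * #|[set x | D < #|[set e in E | pr e == x]|]%N| <= m)%N.
Proof.
move=> E0 EDm; set H := [set x | _].
have h : (#|H| * D.+1 <= #|E|)%N.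
  rewrite -sum_nat_const -[X in (_ <= X)%N]sum1_card (partition_big pr xpredT) //=.
  apply: (@leq_trans (\sum_(x in H) #|[set e in E | pr e == x]|)%N).
    by apply: leq_sum => x; rewrite inE.
  rewrite big_mkcond /=; apply: leq_sum => x _; case: ifP => // _.
  by rewrite sum1dep_card.
have h1 : (6 * #|H| * #|E| <= m * #|E|)%N.
  apply: (@leq_trans (#|H| * (6 * #|E|)))%N; first by rewrite mulnAC mulnC.
  apply: (@leq_trans (#|H| * (D.+1 * m)))%N; first by rewrite leq_mul2l (ltnW EDm) orbT.
  by rewrite mulnA mulnC leq_mul2l h orbT.
by rewrite leq_pmul2r in h1.
Qed.

Lemma triangles_subset p n (X Y Z X' Y' Z' : {set 'rV['F_p]_n}) :
  X' \subset X -> Y' \subset Y -> Z' \subset Z ->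
  triangles X' Y' Z' \subset triangles X Y Z.
Proof.
move=> /subsetP sX /subsetP sY /subsetP sZ; apply/subsetP => t; rewrite !inE.
by move=> /and4P[/sX -> /sY -> /sZ -> ->].
Qed.

(** * From disjoint triangles to many triangles *)

Section Removal.
Variables (R : realType) (p : nat).
Hypothesis p_prime : prime p.
Local Notation c := (cexp R p).
Local Notation C := (Cexp R p).
Local Notation lp := (ln p%:R : R).

Let c0 : 0 < c. Proof. by have /andP[] := cexp_in01 R p_prime. Qed.
Let c1 : c < 1. Proof. by have /andP[] := cexp_in01 R p_prime. Qed.
Let p0 : (0 < p)%N. Proof. exact: prime_gt0. Qed.
Let lp0 : 0 < lp. Proof. by rewrite ln_gt0 // (ltr_nat _ 1) prime_gt1. Qed.
Let ln_growth : ln (growth_rate R p) = (1 - c) * lp.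
Proof. by rewrite -(powR_cexp R p_prime) ln_powR. Qed.
Let growth0 : 0 < growth_rate R p.
Proof. by apply: lt_le_trans (growth_rate_ge R p_prime); rewrite divr_gt0. Qed.

Let ln_expn k : ln (p ^ k)%:R = k%:R * lp.
Proof. by rewrite natrX lnXn ?ltr0n // mulr_natl. Qed.

Let ler_lnn (a b : nat) : (0 < a)%N -> (a <= b)%N -> ln a%:R <= ln b%:R :> R.
Proof. by move=> a0 ab; rewrite ler_ln ?posrE ?ltr0n ?ler_nat // (leq_trans a0). Qed.

Let card_triangles_le n (X Y Z : {set 'rV['F_p]_n}) : (#|triangles X Y Z| <= p ^ (2 * n))%N.
Proof.
have inj : {in triangles X Y Z &, injective (fun t => (t.1.1, t.1.2))}.
  move=> [[x y] z] [[x' y'] z']; rewrite !inE /= => /and4P[_ _ _ /eqP h] /and4P[_ _ _ /eqP h']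
    [ex ey].
  by subst x' y'; move: h; rewrite -h' => /addrI ->.
rewrite -(card_in_imset inj); apply: leq_trans (max_card _) _.
by rewrite card_prod !card_mx card_Fp // mul1n -expnD addnn mul2n.
Qed.

(** Take p^j between 6 D and 6 p D: 2 p^(2 j) times 3 p^((1 - c)(n - j)) equals 6 p^((1 + c) j)
    p^((1 - c) n). *)
Lemma ln_triangles_le n (X Y Z : {set 'rV['F_p]_n}) D : (0 < D)%N ->
  (0 < #|triangles X Y Z|)%N ->
  (forall x, #|[set t in triangles X Y Z | t.1.1 == x]| <= D)%N ->
  (forall y, #|[set t in triangles X Y Z | t.1.2 == y]| <= D)%N ->
  (forall z, #|[set t in triangles X Y Z | t.2 == z]| <= D)%N ->
  ln #|triangles X Y Z|%:R <= ln 6 + (1 + c) * ln (6 * p * D)%:R + (1 - c) * (n%:R * lp).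
Proof.
move=> D0 T0 dX dY dZ; have hc0 := c0; have hc1 := c1; have hl := lp0.
have D6 : (1 < 6 * D)%N by clear -D0; lia.
have /andP[j1 j2] := up_log_bounds (prime_gt1 p_prime) D6.
set j := up_log p _ in j1 j2.
have j0 : (0 < j)%N by rewrite up_log_gt0 prime_gt1.
have jD : j%:R * lp <= ln (6 * p * D)%:R.
  rewrite -ln_expn; apply: ler_lnn; first by rewrite expn_gt0 p0.
  by rewrite -(prednK j0) expnS mulnAC mulnC leq_mul2r ltnW ?orbT.
have l6 : 0 <= ln 6 :> R by apply: ln_ge0; rewrite (ler_nat _ 1).
have [jn|nj] := leqP j n.
  have [m nE] : exists m, n = (j + m)%N by exists (n - j)%N; rewrite subnKC.
  subst n; have [S [Ssf cardS]] := triangles_sampling p_prime dX dY dZ j2.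
  have S3 := sum_free3_card R p_prime Ssf.
  have T6 : #|triangles X Y Z|%:R <= 6 * (p ^ (2 * j))%:R * growth_rate R p ^+ m.
    apply: (@le_trans _ _ (2 * (p ^ (2 * j))%:R * #|S|%:R)).
      by rewrite -!natrM ler_nat.
    rewrite (_ : 6 * _ * _ = 2 * (p ^ (2 * j))%:R * (3 * growth_rate R p ^+ m)); last by ring.
    by apply: ler_wpM2l => //; rewrite mulr_ge0.
  have pj0 : 0 < (p ^ (2 * j))%:R :> R by rewrite ltr0n expn_gt0 p0.
  have gm0 : 0 < growth_rate R p ^+ m by rewrite exprn_gt0.
  have T6' : ln #|triangles X Y Z|%:R <= ln (6 * (p ^ (2 * j))%:R * growth_rate R p ^+ m).
    by rewrite ler_ln ?posrE ?ltr0n // !mulr_gt0.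
  apply: (le_trans T6').
  rewrite lnM ?posrE ?mulr_gt0 // lnM ?posrE // lnXn // ln_growth ln_expn.
  rewrite -[_ *+ m]mulr_natl natrM natrD.
  have : 0 <= (1 + c) * (ln (6 * p * D)%:R - j%:R * lp).
    by apply: mulr_ge0; [rewrite addr_ge0 // ltW | rewrite subr_ge0].
  lra.
(* When p^j exceeds N, the trivial bound N^2 suffices. *)
have nD : n%:R * lp <= ln (6 * p * D)%:R.
  apply: le_trans jD; rewrite ler_pM2r // ler_nat; exact: ltnW.
have h2 : ln #|triangles X Y Z|%:R <= 2 * (n%:R * lp).
  by rewrite mulrA -natrM -ln_expn; apply: ler_lnn => //; exact: card_triangles_le.
have : 0 <= (1 + c) * (ln (6 * p * D)%:R - n%:R * lp).
  by apply: mulr_ge0; [rewrite addr_ge0 // ltW | rewrite subr_ge0].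
lra.
Qed.

(** Logarithmic form of T >= e^(-L) m^C N^(2 - C). It keeps the real exponents linear and lets the
    tensor square act on L by halving. *)
Definition matching_bound (L : R) := forall n (X Y Z : {set 'rV['F_p]_n})
    (M : {set 'rV['F_p]_n * 'rV['F_p]_n * 'rV['F_p]_n}),
  M \subset triangles X Y Z -> matching M -> (0 < #|M|)%N ->
  - L + C * ln #|M|%:R + (2 - C) * (n%:R * lp) <= ln #|triangles X Y Z|%:R.

(** The constants of the dense case. The division by c arises from solving for ln T, which occurs
    with coefficient 1 + c on the right and 1 on the left. *)
Let L0 := (C * ln 2 + ln 6 + (1 + c) * ln (36 * p)%:R) / c.

(* Delete the vertices of degree more than 6T/m: at least half of the matching
   survives. Either a positive proportion of the triangles survives, and then the
   sampling bound applies, or their number drops by the factor 2^C and induction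
   applies. *)
Lemma matching_bound_weak : matching_bound L0.
Proof.
move=> n X Y Z M; have [T] := ubnP #|triangles X Y Z|.
elim: T => // T IH in X Y Z M *; rewrite ltnS => leT ME Mm M0.
set E := triangles X Y Z in leT ME *.
set m := #|M| in M0 *.
have mE : (m <= #|E|)%N by exact: subset_leq_card.
have E0 : (0 < #|E|)%N by exact: leq_trans mE.
pose D := (6 * #|E| %/ m)%N.
have D0 : (0 < D)%N by rewrite divn_gt0 //; apply: (leq_trans mE); clear; lia.
have ED : (6 * #|E| < D.+1 * m)%N by exact: ltn_ceil.
pose X1 := [set x | D < #|[set t in E | t.1.1 == x]|]%N.
pose Y1 := [set x | D < #|[set t in E | t.1.2 == x]|]%N.
pose Z1 := [set x | D < #|[set t in E | t.2 == x]|]%N.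
have cX : (6 * #|X1| <= m)%N by exact: card_heavy.
have cY : (6 * #|Y1| <= m)%N by exact: card_heavy.
have cZ : (6 * #|Z1| <= m)%N by exact: card_heavy.
pose E' := triangles (X :\: X1) (Y :\: Y1) (Z :\: Z1).
have E'E : E' \subset E by apply: triangles_subset; exact: subsetDl.
pose M' := M :&: E'.
have M'2 : (m <= 2 * #|M'|)%N.
  pose MX := [set t in M | t.1.1 \in X1]; pose MY := [set t in M | t.1.2 \in Y1].
  pose MZ := [set t in M | t.2 \in Z1].
  have /matchingP Minj := Mm.
  have le1 (pr : 'rV['F_p]_n * 'rV['F_p]_n * 'rV['F_p]_n -> 'rV['F_p]_n) (A : {set 'rV['F_p]_n}) :
      (forall t u, pr t = pr u -> meets t u) -> (#|[set t in M | pr t \in A]| <= #|A|)%N.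
    move=> prm; have inj : {in [set t in M | pr t \in A] &, injective pr}.
      by move=> t u /setIdP[tM _] /setIdP[uM _] /prm; exact: Minj.
    rewrite -(card_in_imset inj); apply: subset_leq_card; apply/subsetP => _ /imsetP[t + ->].
    by case/setIdP.
  have cMX : (#|MX| <= #|X1|)%N by apply: le1 => t u; rewrite /meets => ->; rewrite eqxx.
  have cMY : (#|MY| <= #|Y1|)%N by apply: le1 => t u; rewrite /meets => ->; rewrite eqxx orbT.
  have cMZ : (#|MZ| <= #|Z1|)%N by apply: le1 => t u; rewrite /meets => ->; rewrite eqxx !orbT.
  have : (m <= #|M'| + (#|MX| + #|MY| + #|MZ|))%N.
    apply: (@leq_trans #|M' :|: (MX :|: MY :|: MZ)|).
      apply: subset_leq_card; apply/subsetP => t tM.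
      have := subsetP ME t tM; rewrite /E in_set => /and4P[tX tY tZ ts].
      rewrite !in_setU /M' in_setI tM /= /MX /MY /MZ /E' in_set !in_setD tX tY tZ ts.
      rewrite ![t \in [set _ in M | _]]in_set tM /= !andbT.
      by do 3 case: (_ \in _).
    apply: leq_trans (leq_card_setU _ _) _; rewrite leq_add2l.
    apply: leq_trans (leq_card_setU _ _) _; rewrite leq_add2r.
    exact: leq_card_setU.
  move: cX cY cZ cMX cMY cMZ; clear; lia.
have M'0 : (0 < #|M'|)%N by move: M0 M'2; clear; lia.
have M'E : M' \subset E' by exact: subsetIr.
have M'm : matching M'.
  by apply/matchingP => t u /setIP[tM _] /setIP[uM _]; exact: (matchingP _ Mm).
have E'0 : (0 < #|E'|)%N by apply: leq_trans M'0 _; exact: subset_leq_card.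
have hc0 := c0; have hc1 := c1; have hl := lp0.
have l2 : 0 < ln 2 :> R by rewrite ln_gt0 // (ltr_nat _ 1).
have C0 : 0 < C by rewrite /Cexp ltr_wpDl // divr_gt0.
have mR : 0 < m%:R :> R by rewrite ltr0n.
have [big|small] := lerP (ln #|E|%:R - C * ln 2) (ln #|E'|%:R).
  have deg' (pr : 'rV['F_p]_n * 'rV['F_p]_n * 'rV['F_p]_n -> 'rV['F_p]_n) :
     (forall t, t \in E' -> #|[set u in E | pr u == pr t]| <= D)%N ->
     forall x, (#|[set t in E' | pr t == x]| <= D)%N.
    move=> h x; have [->|[t /setIdP[tE' /eqP tx]]] := set_0Vmem [set t in E' | pr t == x].
      by rewrite cards0.
    apply: leq_trans (h t tE'); apply: subset_leq_card; apply/subsetP => u /setIdP[uE' ux].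
    by apply/setIdP; split; [exact: (subsetP E'E) | rewrite tx].
  have dx : forall x, (#|[set t in E' | t.1.1 == x]| <= D)%N.
    apply: (deg' (fun t => t.1.1)) => t; rewrite /E' in_set => /and4P[/setDP[_ h] _ _ _].
    by move: h; rewrite in_set -leqNgt.
  have dy : forall x, (#|[set t in E' | t.1.2 == x]| <= D)%N.
    apply: (deg' (fun t => t.1.2)) => t; rewrite /E' in_set => /and4P[_ /setDP[_ h] _ _].
    by move: h; rewrite in_set -leqNgt.
  have dz : forall x, (#|[set t in E' | t.2 == x]| <= D)%N.
    apply: (deg' (fun t => t.2)) => t; rewrite /E' in_set => /and4P[_ _ /setDP[_ h] _].
    by move: h; rewrite in_set -leqNgt.
  have dense := ln_triangles_le D0 E'0 dx dy dz.
  have lnD : ln (6 * p * D)%:R <= ln (36 * p)%:R + ln #|E|%:R - ln m%:R :> R.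
    have D6 : D%:R <= 6 * #|E|%:R / m%:R :> R.
      by rewrite ler_pdivlMr // -!natrM ler_nat leq_trunc_div.
    have E0R : 0 < #|E|%:R :> R by rewrite ltr0n.
    have p36 : 0 < (36 * p)%:R :> R by rewrite ltr0n muln_gt0 p0.
    have -> : ln (36 * p)%:R + ln #|E|%:R - ln m%:R = ln ((36 * p)%:R * #|E|%:R / m%:R) :> R.
      by rewrite ln_div ?posrE ?mulr_gt0 // lnM ?posrE.
    rewrite ler_ln ?posrE ?divr_gt0 ?mulr_gt0 //; last by rewrite ltr0n !muln_gt0 p0 D0.
    have -> : (36 * p)%:R * #|E|%:R / m%:R = (6 * p)%:R * (6 * #|E|%:R / m%:R) :> R.
      by rewrite !natrM; field; exact: lt0r_neq0.
    by rewrite [leLHS]natrM; apply: ler_wpM2l.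
  have key : ln #|E|%:R - C * ln 2 <= ln 6 + (1 + c) * (ln (36 * p)%:R + ln #|E|%:R - ln m%:R)
      + (1 - c) * (n%:R * lp).
    apply: (le_trans big); apply: (le_trans dense); rewrite lerD2r lerD2l.
    by apply: ler_wpM2l => //; rewrite addr_ge0 // ltW.
  rewrite -(ler_pM2l c0) /L0.
  have -> : c * (- ((C * ln 2 + ln 6 + (1 + c) * ln (36 * p)%:R) / c) + C * ln m%:R + (2 - C) *
    (n%:R * lp))
     = - (C * ln 2 + ln 6 + (1 + c) * ln (36 * p)%:R) + (1 + c) * ln m%:R - (1 - c) * (n%:R * lp).
    by rewrite /Cexp; field; exact: lt0r_neq0.
  by clear -R key p_prime c0 c1 p0 lp0 ln_growth growth0 ln_expn ler_lnn card_triangles_le; lra.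
have E'lt : (#|E'| < #|E|)%N.
  rewrite -(ltr_nat R) -ltr_ln ?posrE ?ltr0n //; apply: (lt_le_trans small).
  by rewrite gerDl oppr_le0 mulr_ge0 ?ltW.
have := IH _ _ _ _ (leq_trans E'lt leT) M'E M'm M'0.
rewrite -/E' => IH'.
have lm : ln m%:R - ln 2 <= ln #|M'|%:R :> R.
  rewrite lerBlDr addrC -lnM ?posrE ?ltr0n // -natrM.
  exact: ler_lnn.
have : C * (ln m%:R - ln 2) <= C * ln #|M'|%:R by rewrite ler_pM2l.
by move: IH' small; clear -R p_prime c0 c1 p0 lp0 ln_growth growth0 ln_expn ler_lnn
  card_triangles_le; lra.
Qed.

Lemma row_mx_inj (F : Type) m n1 n2 (a c' : 'M[F]_(m, n1)) (b d : 'M[F]_(m, n2)) :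
  row_mx a b = row_mx c' d -> a = c' /\ b = d.
Proof. by move=> /eq_row_mx. Qed.

(* The tensor square of a configuration squares both counts, which halves the
   logarithm of the constant. *)
Lemma matching_bound_halve L : matching_bound L -> matching_bound (L / 2).
Proof.
move=> PL n X Y Z M ME Mm M0.
pose sq (A : {set 'rV['F_p]_n}) : {set 'rV['F_p]_(n + n)} := [set v | (lsubmx v \in A) &&
  (rsubmx v \in A)].
pose V3 := ('rV['F_p]_n * 'rV['F_p]_n * 'rV['F_p]_n)%type.
pose comb (w : V3 * V3) := (row_mx w.1.1.1 w.2.1.1, row_mx w.1.1.2 w.2.1.2, row_mx w.1.2 w.2.2).
pose M2 := comb @: setX M M.
set E := triangles X Y Z in ME *.
pose E2 := triangles (sq X) (sq Y) (sq Z).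
have comb_inj : injective comb.
  move=> [[[a b] d] [[a' b'] d']] [[[f g] h] [[f' g'] h']] [] /row_mx_inj[/= -> ->]
    /row_mx_inj[/= -> ->] /row_mx_inj[/= -> ->].
  by [].
have E2sub : E2 \subset comb @: setX E E.
  apply/subsetP => -[[a b] d]; rewrite /E2 !inE /= => /and4P[/andP[a1 a2] /andP[b1 b2] /andP[d1
    d2] /eqP abd].
  apply/imsetP; exists ((lsubmx a, lsubmx b, lsubmx d), (rsubmx a, rsubmx b, rsubmx d)).
    rewrite !inE /= a1 a2 b1 b2 d1 d2 /= -!lsubmxD abd.
    have -> : rsubmx a + rsubmx b + rsubmx d = rsubmx (a + b + d) by rewrite !linearD.
    by rewrite abd !linear0 !eqxx.
  by rewrite /comb /= !hsubmxK.
have M2E : M2 \subset E2.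
  apply/subsetP => _ /imsetP[[t u] + ->]; rewrite in_setX /= => /andP[/(subsetP ME) tE
    /(subsetP ME) uE].
  move: tE uE; rewrite !inE /= => /and4P[t1 t2 t3 /eqP t0] /and4P[u1 u2 u3 /eqP u0].
  by rewrite !row_mxKl !row_mxKr t1 t2 t3 u1 u2 u3 /= !add_row_mx t0 u0 row_mx0.
have /matchingP Minj := Mm.
have M2m : matching M2.
  apply/matchingP => _ _ /imsetP[[t u] tu ->] /imsetP[[t' u'] tu' ->].
  move: tu tu'; rewrite !in_setX /= => /andP[tM uM] /andP[t'M u'M] h.
  have [ht hu] : meets t t' /\ meets u u'.
    by case/or3P: h => /eqP /row_mx_inj[/= h1 h2]; split; rewrite /meets ?h1 ?h2 eqxx ?orbT.
  by rewrite (Minj _ _ tM t'M ht) (Minj _ _ uM u'M hu).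
have M2c : #|M2| = (#|M| * #|M|)%N by rewrite (card_imset _ comb_inj) cardsX.
have M20 : (0 < #|M2|)%N by rewrite M2c muln_gt0 M0.
have E0 : (0 < #|E|)%N by apply: leq_trans M0 _; exact: subset_leq_card.
have E2le : (#|E2| <= #|E| * #|E|)%N.
  by rewrite -cardsX -(card_imset _ comb_inj); exact: subset_leq_card.
have E20 : (0 < #|E2|)%N by apply: leq_trans M20 _; exact: subset_leq_card.
have := PL _ _ _ _ _ M2E M2m M20; rewrite -/E2 M2c => h.
have h2 := ler_lnn E20 E2le.
move: h h2; rewrite !natrM !lnM ?posrE ?ltr0n // natrD.
clear -R p_prime c0 c1 p0 lp0 ln_growth growth0 ln_expn ler_lnn card_triangles_le; lra.
Qed.

Lemma matching_bound0 : matching_bound 0.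
Proof.
have half k : matching_bound (L0 / 2 ^+ k).
  elim: k => [|k IH]; first by rewrite expr0 divr1; exact: matching_bound_weak.
  by rewrite exprSr invfM mulrA; exact: matching_bound_halve.
move=> n X Y Z M ME Mm M0; rewrite oppr0 add0r leNgt; apply/negP => h.
set A := C * _ + _ in h; set B := ln _ in h.
have hk k : A - B <= L0 / 2 ^+ k.
  by have := half k n X Y Z M ME Mm M0; rewrite /A /B; lra.
have e0 : 0 < A - B by rewrite subr_gt0.
pose k := Num.trunc (L0 / (A - B)).
have := hk k.+1; apply/negP; rewrite -ltNge ltr_pdivrMr ?exprn_gt0 // mulrC -ltr_pdivrMr //.
apply: (lt_le_trans (truncnS_gt _)); rewrite -natrX ler_nat; exact: ltnW (ltn_expl _ _).
Qed.

(** The 3 in eps / 3 is the number of vertices deleted per member of the maximal family. A surviving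
    triangle would meet no member and so extend the family. *)
Lemma few_triangles_removable (eps : R) n (X Y Z : {set 'rV['F_p]_n}) : 0 < eps ->
  #|triangles X Y Z|%:R < (eps / 3) `^ C * (p ^ n)%:R ^+ 2 -> removable eps X Y Z.
Proof.
move=> e0 few; set E := triangles X Y Z in few.
pose P (M : {set 'rV['F_p]_n * 'rV['F_p]_n * 'rV['F_p]_n}) := (M \subset E) && matching M.
have P0 : P finset.set0 by rewrite /P sub0set; apply/matchingP => t u; rewrite inE.
have [M /andP[ME Mm] Mmax] := @arg_maxnP _ finset.set0 P (fun M => #|M|) P0.
have N0 : 0 < (p ^ n)%:R :> R by rewrite ltr0n expn_gt0 p0.
have hc0 := c0; have C0 : 0 < C by rewrite /Cexp ltr_wpDl // divr_gt0.
have M3 : 3 * #|M|%:R <= eps * (p ^ n)%:R.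
  have [->|M0] := posnP #|M|; first by rewrite mulr0 mulr_ge0 ?ltW.
  have MR : 0 < #|M|%:R :> R by rewrite ltr0n.
  have E0 : 0 < #|E|%:R :> R by rewrite ltr0n (leq_trans M0) // subset_leq_card.
  have := matching_bound0 ME Mm M0; rewrite -/E oppr0 add0r => lowE.
  have e3 : 0 < eps / 3 by rewrite divr_gt0.
  have upE : ln #|E|%:R < C * ln (eps / 3) + 2 * (n%:R * lp).
    have r1 : 0 < (eps / 3) `^ C by exact: powR_gt0.
    have r2 : 0 < (p ^ n)%:R ^+ 2 :> R by exact: exprn_gt0.
    have <- : ln ((eps / 3) `^ C * (p ^ n)%:R ^+ 2) = C * ln (eps / 3) + 2 * (n%:R * lp).
      by rewrite lnM ?posrE // ln_powR lnXn // ln_expn -[_ *+ 2]mulr_natl.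
    by rewrite ltr_ln ?posrE // mulr_gt0.
  have : C * ln #|M|%:R < C * (ln (eps / 3) + n%:R * lp) by lra.
  rewrite ltr_pM2l // -ln_expn -lnM ?posrE // ltr_ln ?posrE ?(mulr_gt0 e3) // => h.
  by have := ltW h; lra.
pose X0 := [set t.1.1 | t in M]; pose Y0 := [set t.1.2 | t in M]; pose Z0 := [set t.2 | t in M].
exists X0, Y0, Z0; split.
  split; apply/subsetP => _ /imsetP[t /(subsetP ME) + ->]; rewrite inE;
    by move=> /and4P[].
split.
  apply: le_trans M3; rewrite -natrM ler_nat (_ : 3 * #|M| = #|M| + #|M| + #|M|)%N; last by
    clear; lia.
  by rewrite !leq_add // leq_imset_card.
apply/setP => t; rewrite [RHS]in_set0; apply/negP => tE.
have tE0 : t \in E by apply: (subsetP _ _ tE); apply: triangles_subset; exact: subsetDl.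
have no u : u \in M -> ~~ meets t u.
  move=> uM; move: tE; rewrite inE => /and4P[/setDP[_ h1] /setDP[_ h2] /setDP[_ h3] _].
  rewrite /meets; apply/or3P => -[] /eqP h.
  - by move/negP: h1; apply; rewrite -h; exact: imset_f.
  - by move/negP: h2; apply; rewrite -h; exact: (imset_f (fun t => t.1.2)).
  - by move/negP: h3; apply; rewrite -h; exact: (imset_f (fun t => t.2)).
have tM : t \notin M by apply/negP => /no; rewrite /meets eqxx.
have PM : P (t |: M).
  rewrite /P subUset sub1set tE0 ME /=; have /matchingP Minj := Mm.
  have sym u v : meets u v = meets v u by rewrite /meets !(eq_sym (u.1.1)) !(eq_sym u.1.2)
    !(eq_sym u.2).
  apply/matchingP => u v /setU1P[->|uM] /setU1P[->|vM] //.
  - by rewrite (negbTE (no _ vM)).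
  - by rewrite sym (negbTE (no _ uM)).
  - exact: Minj.
by have := Mmax _ PM; rewrite /= cardsU1 tM add1n ltnn.
Qed.

End Removal.

Theorem theorem1 (R : realType) (p : nat) (p_prime : prime p) :
  (forall epsilon delta : R,
     0 < epsilon -> epsilon < 1 ->
     delta = (epsilon / 3) `^ (Cexp R p) ->
     forall n : nat, (0 < n)%N ->
     forall X Y Z : {set 'rV['F_p]_n},
       #|triangles X Y Z|%:R < delta * (p ^ n)%:R ^+ 2 ->
       removable epsilon X Y Z) /\
  (forall eta : R, 0 < eta ->
     exists epsilon0 : R, 0 < epsilon0 /\
       forall epsilon delta : R,
         admissible p epsilon delta -> epsilon < epsilon0 ->
         delta <= epsilon `^ (Cexp R p - eta)).
Proof.
split; last by move=> eta; exact: admissible_bound.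
move=> epsilon delta epsilon0 _ -> n _ X Y Z.
exact: few_triangles_removable.
Qed.
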